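(* Let $\lambda\in\mathbb R$. The congruence solutions of the flow generated by $\mathfrak p_3^{[2]}=2$ coincide with the worldlines of the particle model defined by the action functional $\int(2\kappa+\lambda)\,ds$ on null curves; that is, a null curve $\gamma:I\to\mathbb R^{2,1}$ without flex points, parametrized by the natural parameter, is a congruence curve with velocity $\lambda$ if and only if it is a critical point of $$\mathcal L_\lambda(\gamma)=\int_\gamma(2\kappa_\gamma+\lambda)\,ds .$$ In particular, the congruence curves are integrable by quadrature.
   Context: **Null curves.** $\mathbb R^{2,1}$ is affine Minkowski 3-space, i.e. $\mathbb R^3$ with the Lorentzian inner product $\langle \mathbf x,\mathbf y\rangle=-(x^1y^3+x^3y^1)+x^2y^2$; $\|\mathbf x\|^2:=\langle\mathbf x,\mathbf x\rangle$. A nonzero timelike or null vector $\mathbf x$ is future-directed if $\langle \mathbf x,\mathbf e_1+\mathbf e_3\rangle<0$, where $(\mathbf e_1,\mathbf e_2,\mathbf e_3)$ is the standard basis. A null curve is a regular smooth parametrized curve $\gamma$ on an open interval, in $\mathbb R^{2,1}$, whose velocity is everywhere a future-directed null vector. A flex point is a point where $\gamma'\wedge\gamma''=0$. For a null curve without flex points, in an arbitrary parameter $\tau$, the 1-form $\omega_\gamma=\|\gamma''(\tau)\|^{1/2}d\tau$ is nowhere zero and invariant under orientation-preserving reparametrization; a natural parameter $s$ is one with $\omega_\gamma=ds$, i.e. $\|\gamma''(s)\|=1$. In a natural parameter the Frenet frame consists of $\mathbf t_\gamma=\gamma'$, $\mathbf n_\gamma=\gamma''$, $\mathbf b_\gamma=\gamma'''+\frac12\|\gamma'''\|^2\gamma'$,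 and the curvature is $\kappa_\gamma(s)=\frac14\|\gamma'''(s)\|^2$. **The flow.** The flow generated by $\mathfrak p_3^{[2]}=2$ is the evolution equation for null curves without flex points, parametrized by the natural parameter $s$, $$\frac{\partial\Gamma}{\partial t}=2\kappa_\Gamma\,\mathbf t_\Gamma+2\,\mathbf b_\Gamma,$$ where $\kappa_\Gamma(\cdot,t),\mathbf t_\Gamma(\cdot,t),\mathbf b_\Gamma(\cdot,t)$ are the curvature and Frenet vectors of $\Gamma(\cdot,t)$; the induced evolution of the curvature is the KdV equation $\kappa_t+\kappa_{sss}+6\kappa\kappa_s=0$. A congruence solution is a solution whose curves move without changing shape (by Lorentz rigid motion), which means that the curvature is a traveling wave. Precisely, $\gamma:I\to\mathbb R^{2,1}$ is a congruence curve with velocity $\lambda$ if there is a smooth solution $\Gamma(s,t)$ of the flow, defined for $\{(s,t)\in\mathbb R^2: s-\lambda t\in I\}$, each $\Gamma(\cdot,t)$ being a null curve without flex points in natural parameter, with $\Gamma(\cdot,0)=\gamma$ and $\kappa_\Gamma(s,t)=\kappa_\gamma(s-\lambda t)$. **Worldlines.** The functional $\mathcal L_\lambda$ is $\int(2\kappa+\lambda)\,\omega$, with $\omega=ds$ the natural 1-form and $\kappa$ the curvature of the curve. The worldlines of the particle model are the critical points of $\mathcal L_\lambda$ on null curves: $\gamma$ is a critical point if for every smooth variation $\gamma_\varepsilon$ of $\gamma=\gamma_0$ through null curves without flex points (not necessarily in natural parameter for $\varepsilon\ne0$) that agrees with $\gamma$ outside a compact subset $K\subset I$, and every compact interval $[a,b]\subset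 I$ containing $K$ in its interior, $\frac{d}{d\varepsilon}\big|_{\varepsilon=0}\int_{[a,b]}(2\kappa_{\gamma_\varepsilon}+\lambda)\,\omega_{\gamma_\varepsilon}=0$. **Integrable by quadrature** has its usual meaning: the natural parametrization $\gamma(s)$ can be obtained, up to a Lorentzian rigid motion, by finitely many algebraic operations, inversions of functions, and integrations (quadratures) of known functions. *)

(* Defs.v *)
From Stdlib Require Import Reals Rtopology.
From Coquelicot Require Import Coquelicot.
Open Scope R_scope.

(** * Minkowski 3-space *)

Definition vec : Type := (R * R * R)%type.
Definition pr1 (x : vec) : R := fst (fst x).
Definition pr2 (x : vec) : R := snd (fst x).
Definition pr3 (x : vec) : R := snd x.

Definition vzero : vec := (0, 0, 0).
Definition e1 : vec := (1, 0, 0).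
Definition e2 : vec := (0, 1, 0).
Definition e3 : vec := (0, 0, 1).
Definition vadd (x y : vec) : vec := plus x y.
Definition vscal (c : R) (x : vec) : vec := scal c x.

Definition inner (x y : vec) : R :=
  - (pr1 x * pr3 y + pr3 x * pr1 y) + pr2 x * pr2 y.
Definition normsq (x : vec) : R := inner x x.
(* Only meaningful on spacelike and null vectors; the second derivative of a
   null curve is always one of these. *)
Definition mnorm (x : vec) : R := sqrt (normsq x).

Definition future_directed (x : vec) : Prop :=
  x <> vzero /\ normsq x <= 0 /\ inner x (vadd e1 e3) < 0.

(* Coordinates of x /\ y in the basis e2/\e3, e3/\e1, e1/\e2 of the second
   exterior power. *)
Definition wedge (x y : vec) : vec :=
  (pr2 x * pr3 y - pr3 x * pr2 y,
   pr3 x * pr1 y - pr1 x * pr3 y,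
   pr1 x * pr2 y - pr2 x * pr1 y).

Definition det3 (x y z : vec) : R :=
  pr1 x * pr1 (wedge y z) + pr2 x * pr2 (wedge y z) + pr3 x * pr3 (wedge y z).

(* The linear map sending e1, e2, e3 to c1, c2, c3. *)
Definition lin (c1 c2 c3 x : vec) : vec :=
  vadd (vadd (vscal (pr1 x) c1) (vscal (pr2 x) c2)) (vscal (pr3 x) c3).

(* Orientation and time-orientation preserving affine isometries. *)
Definition lorentz_rigid_motion (A : vec -> vec) : Prop :=
  exists c1 c2 c3 v : vec,
    (forall x, A x = vadd (lin c1 c2 c3 x) v) /\
    (forall x y, inner (lin c1 c2 c3 x) (lin c1 c2 c3 y) = inner x y) /\
    det3 c1 c2 c3 = 1 /\
    (forall x, future_directed x -> future_directed (lin c1 c2 c3 x)).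

(** * Null curves *)

(* Curves are total functions; only their values on an open set of parameters
   J matter. *)

Definition ooint (a b : Rbar) (s : R) : Prop := Rbar_lt a s /\ Rbar_lt s b.

Definition dvec (X : R -> vec) (s : R) : vec :=
  (Derive (fun u => pr1 (X u)) s,
   Derive (fun u => pr2 (X u)) s,
   Derive (fun u => pr3 (X u)) s).

Definition dvec_n (n : nat) (X : R -> vec) (s : R) : vec :=
  (Derive_n (fun u => pr1 (X u)) n s,
   Derive_n (fun u => pr2 (X u)) n s,
   Derive_n (fun u => pr3 (X u)) n s).

Definition smooth_on (J : R -> Prop) (X : R -> vec) : Prop :=
  forall (n : nat) (s : R), J s ->
    ex_derive_n (fun u => pr1 (X u)) n s /\
    ex_derive_n (fun u => pr2 (X u)) n s /\
    ex_derive_n (fun u => pr3 (X u)) n s.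

(* On an open set U: all iterated mixed partial derivatives exist and are
   continuous. *)
Definition smooth2_on (U : R -> R -> Prop) (X : R -> R -> vec) : Prop :=
  forall (n : nat) (x y : R), U x y ->
    ex_diff_n (fun u v => pr1 (X u v)) n x y /\
    ex_diff_n (fun u v => pr2 (X u v)) n x y /\
    ex_diff_n (fun u v => pr3 (X u v)) n x y.

Definition null_curve (J : R -> Prop) (g : R -> vec) : Prop :=
  smooth_on J g /\
  forall s, J s -> future_directed (dvec_n 1 g s) /\ normsq (dvec_n 1 g s) = 0.

Definition flex_free (J : R -> Prop) (g : R -> vec) : Prop :=
  forall s, J s -> wedge (dvec_n 1 g s) (dvec_n 2 g s) <> vzero.

(* omega g tau is the density, with respect to d tau, of the 1-form
   || g'' ||^(1/2) d tau. *)
Definition omega (g : R -> vec) (tau : R) : R := sqrt (mnorm (dvec_n 2 g tau)).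

Definition natural_parameter (J : R -> Prop) (g : R -> vec) : Prop :=
  forall s, J s -> omega g s = 1.

(** Frenet frame and curvature in a natural parameter *)

Definition frenet_t (g : R -> vec) (s : R) : vec := dvec_n 1 g s.
Definition frenet_n (g : R -> vec) (s : R) : vec := dvec_n 2 g s.
Definition frenet_b (g : R -> vec) (s : R) : vec :=
  vadd (dvec_n 3 g s) (vscal (1/2 * normsq (dvec_n 3 g s)) (dvec_n 1 g s)).
Definition curvature_nat (g : R -> vec) (s : R) : R :=
  1/4 * normsq (dvec_n 3 g s).

(** Curvature in an arbitrary parameter *)

(* By the chain rule, d/ds = (1/omega) d/dtau for a natural parameter s of g,
   so curvature g tau is the curvature of the natural reparametrization of g,
   at the point of parameter tau. *)
Definition dnat (g : R -> vec) (X : R -> vec) (tau : R) : vec :=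
  vscal (/ omega g tau) (dvec X tau).
Definition curvature (g : R -> vec) (tau : R) : R :=
  1/4 * normsq (dnat g (dnat g (dnat g g)) tau).

Lemma curvature_natural_parameter (a b : Rbar) (g : R -> vec) :
  natural_parameter (ooint a b) g ->
  forall s, ooint a b s -> curvature g s = curvature_nat g s.
Proof.
intros Hn s Hs.
assert (Hext : forall X Y : R -> vec,
  (forall u, ooint a b u -> X u = Y u) ->
  forall u, ooint a b u -> dnat g X u = dvec Y u).
{ intros X Y HXY u Hu.
  assert (Hloc : locally u (fun v => X v = Y v)).
  { apply (filter_imp (ooint a b)); [exact HXY|].
    apply filter_and; [apply open_Rbar_gt | apply open_Rbar_lt]; apply Hu. }
  unfold dnat; rewrite (Hn u Hu), Rinv_1.
  transitivity (dvec X u).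
  { unfold vscal; apply (@scal_one R_AbsRing). }
  unfold dvec; f_equal; [f_equal|]; apply Derive_ext_loc;
    revert Hloc; apply filter_imp; intros v Hv; now rewrite Hv. }
unfold curvature, curvature_nat; do 2 f_equal.
rewrite (Hext _ (dvec (dvec g))); [reflexivity| |exact Hs].
intros u Hu; apply Hext; [|exact Hu].
intros v Hv; now apply Hext.
Qed.

(** * Congruence solutions of the flow  Gamma_t = 2 kappa t + 2 b *)

Definition flow_solution (U : R -> R -> Prop) (Gam : R -> R -> vec) : Prop :=
  smooth2_on U Gam /\
  (forall t : R,
     null_curve (fun s => U s t) (fun s => Gam s t) /\
     flex_free (fun s => U s t) (fun s => Gam s t) /\
     natural_parameter (fun s => U s t) (fun s => Gam s t)) /\
  (forall s t : R, U s t ->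
     dvec (fun t' => Gam s t') t =
     vadd (vscal (2 * curvature_nat (fun s' => Gam s' t) s)
                 (frenet_t (fun s' => Gam s' t) s))
          (vscal 2 (frenet_b (fun s' => Gam s' t) s))).

Definition congruence_curve (lam : R) (J : R -> Prop) (g : R -> vec) : Prop :=
  exists Gam : R -> R -> vec,
    flow_solution (fun s t => J (s - lam * t)) Gam /\
    (forall s, J s -> Gam s 0 = g s) /\
    (forall s t, J (s - lam * t) ->
       curvature_nat (fun s' => Gam s' t) s = curvature_nat g (s - lam * t)).

(** * Critical points of the functional  int (2 kappa + lam) omega *)

Definition action (lam : R) (g : R -> vec) (c d : R) : R :=
  RInt (fun tau => (2 * curvature g tau + lam) * omega g tau) c d.

(* V eps is the varied curve; K is the compact set off which it is fixed. *)
Definition admissible_variation (J : R -> Prop) (g : R -> vec)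
    (V : R -> R -> vec) (K : R -> Prop) : Prop :=
  exists delta : posreal,
    smooth2_on (fun eps tau => Rabs eps < delta /\ J tau) V /\
    (forall eps, Rabs eps < delta ->
       null_curve J (V eps) /\ flex_free J (V eps)) /\
    (forall tau, J tau -> V 0 tau = g tau) /\
    compact K /\
    (forall tau, K tau -> J tau) /\
    (forall eps tau, Rabs eps < delta -> J tau -> ~ K tau ->
       V eps tau = g tau).

Definition critical_point (lam : R) (J : R -> Prop) (g : R -> vec) : Prop :=
  forall (V : R -> R -> vec) (K : R -> Prop),
    admissible_variation J g V K ->
    forall c d : R, c < d ->
      (forall tau, c <= tau <= d -> J tau) ->
      (forall tau, K tau -> c < tau < d) ->
      is_derive (fun eps => action lam (V eps) c d) 0 0.

(** * Integrability by quadrature *)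

(* by_quadratures a b f: on the open interval (a,b), the function f is obtained
   from elementary known functions by finitely many algebraic operations,
   substitutions, quadratures and inversions of functions.  Roots, logarithms,
   inverse circular functions, etc. arise through the rule for inverses. *)
Inductive by_quadratures : Rbar -> Rbar -> (R -> R) -> Prop :=
| bq_const a b (c : R) : by_quadratures a b (fun _ => c)
| bq_id a b : by_quadratures a b (fun x => x)
| bq_exp a b : by_quadratures a b exp
| bq_sin a b : by_quadratures a b sin
| bq_cos a b : by_quadratures a b cos
| bq_plus a b f g : by_quadratures a b f -> by_quadratures a b g ->
    by_quadratures a b (fun x => f x + g x)
| bq_minus a b f g : by_quadratures a b f -> by_quadratures a b g ->
    by_quadratures a b (fun x => f x - g x)
| bq_mult a b f g : by_quadratures a b f -> by_quadratures a b g ->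
    by_quadratures a b (fun x => f x * g x)
| bq_div a b f g : by_quadratures a b f -> by_quadratures a b g ->
    (forall x, ooint a b x -> g x <> 0) ->
    by_quadratures a b (fun x => f x / g x)
| bq_comp a b c d f g : by_quadratures a b f -> by_quadratures c d g ->
    (forall x, ooint a b x -> ooint c d (f x)) ->
    by_quadratures a b (fun x => g (f x))
| bq_primitive a b f F : by_quadratures a b f ->
    (forall x, ooint a b x -> is_derive F x (f x)) ->
    by_quadratures a b F
| bq_inverse a b c d f g : by_quadratures c d f ->
    (forall x y, ooint c d x -> ooint c d y -> f x = f y -> x = y) ->
    (forall y, ooint a b y -> ooint c d (g y) /\ f (g y) = y) ->
    by_quadratures a b g
(* Only the values on the interval matter, and it may be shrunk. *)
| bq_restrict a b a' b' f g : by_quadratures a b f ->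
    (forall x, ooint a' b' x -> ooint a b x /\ g x = f x) ->
    by_quadratures a' b' g.

Definition integrable_by_quadrature (a b : Rbar) (g : R -> vec) : Prop :=
  exists A : vec -> vec,
    lorentz_rigid_motion A /\
    by_quadratures a b (fun s => pr1 (A (g s))) /\
    by_quadratures a b (fun s => pr2 (A (g s))) /\
    by_quadratures a b (fun s => pr3 (A (g s))).

(* Main.v *)
Require Import Defs.
From Stdlib Require Import Reals Rtopology Lra Lia.
From Coquelicot Require Import Coquelicot.
Open Scope R_scope.

(** Write [t], [n], [b] for the Frenet frame and [k] for the curvature of a
    curve in natural parameter. Both properties of the curve, being a
    congruence curve and being a critical point, are equivalent to one ordinary
    differential equation for the curvature, [k''' + 6 k k' - lam k' = 0], whose
    left-hand side is called [wave] below; and this equation can be integrated.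

    Criticality. Let [X] be the field of a variation through null curves, so
    that [X'] is orthogonal to [t]. Writing the variation of the action density
    in terms of [X] and integrating by parts, the coefficient left in front of
    [X'] is, modulo [t], the momentum
    [(k'' + 2 k^2 - lam k) t - k' n + (k - lam / 2) b], and the derivative of the
    momentum is [wave * t]. Hence the first variation is minus the integral of
    [wave * <t, X>] ([first_variation]), which settles one direction. For the
    other one needs variations that stay null and have compact support. The
    field [X = (h'' + 2 k h) t - h' n + h b] has a derivative proportional to
    [t], so that the straight lines [g + eps X] are null curves for every
    function [h] and small [eps], and [<t, X> = - h]; taking bump functions for [h] forces
    [wave] to vanish ([critical_iff_wave]).

    Congruence. The curvature of a solution of the flow obeys the KdV equation,
    which becomes the wave equation for a travelling wave
    ([congruence_wave]). Conversely, when [wave] vanishes the momentum is a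
    constant vector. The cross product with a multiple of it is then an
    infinitesimal rotation [M] for which the field [(2 k + lam) t + 2 b] along
    the curve has derivative [M t]; it is therefore the restriction of an
    infinitesimal rigid motion, and moving the curve by the corresponding
    one-parameter group while shifting the parameter solves the flow
    ([wave_congruence]). Since [M^3] is a multiple of [M], the group has a closed
    form.

    Quadratures. Two integrations of the wave equation give [k'^2 = P(k)] with a
    cubic [P]. Inverting one quadrature on an interval where [k] is monotone is
    not enough, because the interval may contain many oscillations; instead [k]
    is written as an elementary function of a strictly increasing quantity,
    which itself solves an autonomous first order equation ([profile_quad]):
    unless [k] is constant, this quantity is up to sign [k] itself, or a square
    root of the distance of [k] to its only critical value, or a phase of which
    [k] is the cosine up to scale and shift. Finally, the
    constant momentum reduces the Frenet equations to a rotation about a fixed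
    vector by an angle that is a quadrature ([quad_tangent]). In the frame the
    only difficulty is to find a vector that is never proportional to the
    momentum: [t] serves when the momentum is timelike, [t + b] otherwise. *)

(** * Smooth functions of two variables *)

Definition D1 (f : R -> R -> R) : R -> R -> R :=
  fun x y => Derive (fun z => f z y) x.
Definition D2 (f : R -> R -> R) : R -> R -> R :=
  fun x y => Derive (fun z => f x z) y.

Definition open2 (U : R -> R -> Prop) : Prop :=
  forall x y, U x y -> locally_2d U x y.

(** Regularity is stratified by order because the derivatives of [/ f] and
    [sqrt f] contain these functions again: the induction that proves them
    smooth uses the statement for the same function at one order less. *)
Definition classC (U : R -> R -> Prop) (n : nat) (f : R -> R -> R) : Prop :=
  forall x y, U x y -> ex_diff_n f n x y.

Definition smooth2 (U : R -> R -> Prop) (f : R -> R -> R) : Prop :=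
  forall n, classC U n f.

Lemma classC_S (U : R -> R -> Prop) (n : nat) (f : R -> R -> R) :
  (forall x y, U x y -> continuity_2d_pt f x y) ->
  (forall x y, U x y -> ex_derive (fun z => f z y) x) ->
  (forall x y, U x y -> ex_derive (fun z => f x z) y) ->
  classC U n (D1 f) -> classC U n (D2 f) -> classC U (S n) f.
Proof.
intros H0 H1 H2 H3 H4 x y Hxy; simpl; repeat split; auto.
Qed.

Lemma classC_cont (U : R -> R -> Prop) (n : nat) (f : R -> R -> R) :
  classC U n f -> forall x y, U x y -> continuity_2d_pt f x y.
Proof. intros H x y Hxy; specialize (H x y Hxy); destruct n; apply H. Qed.

Lemma classC_ex1 (U : R -> R -> Prop) (n : nat) (f : R -> R -> R) :
  classC U (S n) f -> forall x y, U x y -> ex_derive (fun z => f z y) x.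
Proof. intros H x y Hxy; apply (H x y Hxy). Qed.

Lemma classC_ex2 (U : R -> R -> Prop) (n : nat) (f : R -> R -> R) :
  classC U (S n) f -> forall x y, U x y -> ex_derive (fun z => f x z) y.
Proof. intros H x y Hxy; apply (H x y Hxy). Qed.

Lemma classC_D1 (U : R -> R -> Prop) (n : nat) (f : R -> R -> R) :
  classC U (S n) f -> classC U n (D1 f).
Proof. intros H x y Hxy; apply (H x y Hxy). Qed.

Lemma classC_D2 (U : R -> R -> Prop) (n : nat) (f : R -> R -> R) :
  classC U (S n) f -> classC U n (D2 f).
Proof. intros H x y Hxy; apply (H x y Hxy). Qed.

Lemma classC_pred (U : R -> R -> Prop) (n : nat) (f : R -> R -> R) :
  classC U (S n) f -> classC U n f.
Proof. intros H x y Hxy; apply (ex_diff_n_m (S n)); auto. Qed.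

Lemma classC_ext (U : R -> R -> Prop) (n : nat) (f g : R -> R -> R) :
  open2 U -> (forall x y, U x y -> f x y = g x y) ->
  classC U n f -> classC U n g.
Proof.
intros HU Hfg Hf x y Hxy.
apply (ex_diff_n_ext_loc f); [|auto].
destruct (HU x y Hxy) as [d Hd]; exists d; intros u v Hu Hv; auto.
Qed.

Lemma classC_const (U : R -> R -> Prop) (n : nat) (c : R) :
  open2 U -> classC U n (fun _ _ => c).
Proof.
intros HU; revert c; induction n as [|n IH]; intros c.
- intros x y _; split; [apply continuity_2d_pt_const | trivial].
- apply classC_S.
  + intros; apply continuity_2d_pt_const.
  + intros; apply ex_derive_const.
  + intros; apply ex_derive_const.
  + apply (classC_ext U n (fun _ _ => 0)); auto.
    intros; unfold D1; now rewrite Derive_const.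
  + apply (classC_ext U n (fun _ _ => 0)); auto.
    intros; unfold D2; now rewrite Derive_const.
Qed.

Lemma classC_plus (U : R -> R -> Prop) (n : nat) (f g : R -> R -> R) :
  open2 U -> classC U n f -> classC U n g ->
  classC U n (fun x y => f x y + g x y).
Proof.
intros HU; revert f g; induction n as [|n IH]; intros f g Hf Hg.
- intros x y Hxy; split; [|trivial].
  apply continuity_2d_pt_plus; eapply classC_cont; eauto.
- apply classC_S.
  + intros; apply continuity_2d_pt_plus; eapply classC_cont; eauto.
  + intros; apply (ex_derive_plus (V := R_NormedModule)); eapply classC_ex1; eauto.
  + intros; apply (ex_derive_plus (V := R_NormedModule)); eapply classC_ex2; eauto.
  + apply (classC_ext U n (fun x y => D1 f x y + D1 g x y)); auto.
    * intros; symmetry; apply Derive_plus; eapply classC_ex1; eauto.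
    * apply IH; now apply classC_D1.
  + apply (classC_ext U n (fun x y => D2 f x y + D2 g x y)); auto.
    * intros; symmetry; apply Derive_plus; eapply classC_ex2; eauto.
    * apply IH; now apply classC_D2.
Qed.

Lemma classC_mult (U : R -> R -> Prop) (n : nat) (f g : R -> R -> R) :
  open2 U -> classC U n f -> classC U n g ->
  classC U n (fun x y => f x y * g x y).
Proof.
intros HU; revert f g; induction n as [|n IH]; intros f g Hf Hg.
- intros x y Hxy; split; [|trivial].
  apply continuity_2d_pt_mult; eapply classC_cont; eauto.
- apply classC_S.
  + intros; apply continuity_2d_pt_mult; eapply classC_cont; eauto.
  + intros; apply ex_derive_mult; eapply classC_ex1; eauto.
  + intros; apply ex_derive_mult; eapply classC_ex2; eauto.
  + apply (classC_ext U n (fun x y => D1 f x y * g x y + f x y * D1 g x y)); auto.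
    * intros; symmetry; apply Derive_mult; eapply classC_ex1; eauto.
    * apply classC_plus; auto; apply IH;
        try (now apply classC_D1); now apply classC_pred.
  + apply (classC_ext U n (fun x y => D2 f x y * g x y + f x y * D2 g x y)); auto.
    * intros; symmetry; apply Derive_mult; eapply classC_ex2; eauto.
    * apply classC_plus; auto; apply IH;
        try (now apply classC_D2); now apply classC_pred.
Qed.

Lemma classC_inv (U : R -> R -> Prop) (n : nat) (f : R -> R -> R) :
  open2 U -> (forall x y, U x y -> f x y <> 0) -> classC U n f ->
  classC U n (fun x y => / f x y).
Proof.
intros HU H0; revert f H0; induction n as [|n IH]; intros f H0 Hf.
- intros x y Hxy; split; [|trivial].
  apply continuity_2d_pt_inv; [eapply classC_cont; eauto | auto].
- assert (Hinv : classC U n (fun x y => / f x y)) by (apply IH; auto using classC_pred).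
  apply classC_S.
  + intros; apply continuity_2d_pt_inv; [eapply classC_cont; eauto | auto].
  + intros; apply ex_derive_inv; [eapply classC_ex1; eauto | auto].
  + intros; apply ex_derive_inv; [eapply classC_ex2; eauto | auto].
  + apply (classC_ext U n (fun x y => (-1 * D1 f x y) * (/ f x y * / f x y))); auto.
    * intros x y Hxy; unfold D1; rewrite Derive_inv;
        [field; auto | eapply classC_ex1; eauto | auto].
    * repeat apply classC_mult; auto using classC_const, classC_D1.
  + apply (classC_ext U n (fun x y => (-1 * D2 f x y) * (/ f x y * / f x y))); auto.
    * intros x y Hxy; unfold D2; rewrite (Derive_inv (fun z => f x z));
        [field; auto | eapply classC_ex2; eauto | auto].
    * repeat apply classC_mult; auto using classC_const, classC_D2.
Qed.

Lemma classC_sqrt (U : R -> R -> Prop) (n : nat) (f : R -> R -> R) :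
  open2 U -> (forall x y, U x y -> 0 < f x y) -> classC U n f ->
  classC U n (fun x y => sqrt (f x y)).
Proof.
intros HU H0; revert f H0; induction n as [|n IH]; intros f H0 Hf.
- intros x y Hxy; split; [|trivial].
  apply (continuity_1d_2d_pt_comp sqrt); [|eapply classC_cont; eauto].
  apply continuity_pt_sqrt; specialize (H0 x y Hxy); lra.
- assert (Hs : classC U n (fun x y => sqrt (f x y))) by (apply IH; auto using classC_pred).
  assert (Hp : forall x y, U x y -> 0 < sqrt (f x y)) by (intros; apply sqrt_lt_R0; auto).
  assert (Hi : classC U n (fun x y => / sqrt (f x y))).
  { apply classC_inv; auto. intros x y Hxy; specialize (Hp x y Hxy); lra. }
  assert (Hd : forall g x l, 0 < g x -> is_derive g x l ->
            is_derive (fun z => sqrt (g z)) x (1/2 * l * / sqrt (g x))).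
  { intros g x l Hg Hl.
    replace (1/2 * l * / sqrt (g x)) with (l / (2 * sqrt (g x))).
    - now apply is_derive_sqrt.
    - field; apply Rgt_not_eq, sqrt_lt_R0; lra. }
  apply classC_S.
  + intros x y Hxy; apply (continuity_1d_2d_pt_comp sqrt); [|eapply classC_cont; eauto].
    apply continuity_pt_sqrt; specialize (H0 x y Hxy); lra.
  + intros x y Hxy; eexists; apply Hd; [now apply H0|].
    apply Derive_correct; eapply classC_ex1; eauto.
  + intros x y Hxy; eexists; apply (Hd (fun z => f x z)); [now apply H0|].
    apply Derive_correct; eapply classC_ex2; eauto.
  + apply (classC_ext U n (fun x y => 1/2 * D1 f x y * / sqrt (f x y))); auto.
    * intros x y Hxy; symmetry; apply is_derive_unique, (Hd (fun z => f z y)); [now apply H0|].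
      apply Derive_correct; eapply classC_ex1; eauto.
    * repeat apply classC_mult; auto using classC_const, classC_D1.
  + apply (classC_ext U n (fun x y => 1/2 * D2 f x y * / sqrt (f x y))); auto.
    * intros x y Hxy; symmetry; apply is_derive_unique, (Hd (fun z => f x z)); [now apply H0|].
      apply Derive_correct; eapply classC_ex2; eauto.
    * repeat apply classC_mult; auto using classC_const, classC_D2.
Qed.

Lemma smooth2_ext (U : R -> R -> Prop) (f g : R -> R -> R) :
  open2 U -> (forall x y, U x y -> f x y = g x y) -> smooth2 U f -> smooth2 U g.
Proof. intros HU Hfg Hf n; apply (classC_ext U n f g); auto. Qed.

Lemma smooth2_const (U : R -> R -> Prop) (c : R) :
  open2 U -> smooth2 U (fun _ _ => c).
Proof. intros HU n; now apply classC_const. Qed.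

Lemma smooth2_plus (U : R -> R -> Prop) (f g : R -> R -> R) :
  open2 U -> smooth2 U f -> smooth2 U g -> smooth2 U (fun x y => f x y + g x y).
Proof. intros HU Hf Hg n; now apply classC_plus. Qed.

Lemma smooth2_mult (U : R -> R -> Prop) (f g : R -> R -> R) :
  open2 U -> smooth2 U f -> smooth2 U g -> smooth2 U (fun x y => f x y * g x y).
Proof. intros HU Hf Hg n; now apply classC_mult. Qed.

Lemma smooth2_opp (U : R -> R -> Prop) (f : R -> R -> R) :
  open2 U -> smooth2 U f -> smooth2 U (fun x y => - f x y).
Proof.
intros HU Hf; apply (smooth2_ext U (fun x y => -1 * f x y)); auto.
- intros; ring.
- apply smooth2_mult; auto using smooth2_const.
Qed.

Lemma smooth2_inv (U : R -> R -> Prop) (f : R -> R -> R) :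
  open2 U -> (forall x y, U x y -> f x y <> 0) -> smooth2 U f ->
  smooth2 U (fun x y => / f x y).
Proof. intros HU H0 Hf n; now apply classC_inv. Qed.

Lemma smooth2_sqrt (U : R -> R -> Prop) (f : R -> R -> R) :
  open2 U -> (forall x y, U x y -> 0 < f x y) -> smooth2 U f ->
  smooth2 U (fun x y => sqrt (f x y)).
Proof. intros HU H0 Hf n; now apply classC_sqrt. Qed.

Lemma smooth2_D1 (U : R -> R -> Prop) (f : R -> R -> R) :
  smooth2 U f -> smooth2 U (D1 f).
Proof. intros H n; apply classC_D1, H. Qed.

Lemma smooth2_D2 (U : R -> R -> Prop) (f : R -> R -> R) :
  smooth2 U f -> smooth2 U (D2 f).
Proof. intros H n; apply classC_D2, H. Qed.

Lemma smooth2_ex1 (U : R -> R -> Prop) (f : R -> R -> R) (x y : R) :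
  smooth2 U f -> U x y -> ex_derive (fun z => f z y) x.
Proof. intros H Hxy; now apply (classC_ex1 U 0). Qed.

Lemma smooth2_ex2 (U : R -> R -> Prop) (f : R -> R -> R) (x y : R) :
  smooth2 U f -> U x y -> ex_derive (fun z => f x z) y.
Proof. intros H Hxy; now apply (classC_ex2 U 0). Qed.

Lemma smooth2_cont (U : R -> R -> Prop) (f : R -> R -> R) (x y : R) :
  smooth2 U f -> U x y -> continuity_2d_pt f x y.
Proof. intros H Hxy; now apply (classC_cont U 0). Qed.

Lemma smooth2_D1_D2 (U : R -> R -> Prop) (f : R -> R -> R) (x y : R) :
  open2 U -> smooth2 U f -> U x y -> D1 (D2 f) x y = D2 (D1 f) x y.
Proof.
intros HU Hf Hxy; apply Schwarz.
- destruct (HU x y Hxy) as [d Hd]; exists d; intros u v Hu Hv.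
  specialize (Hd u v Hu Hv); repeat split.
  + now apply (smooth2_ex1 U).
  + now apply (smooth2_ex2 U).
  + apply (smooth2_ex1 U (D2 f)); auto using smooth2_D2.
  + apply (smooth2_ex2 U (D1 f)); auto using smooth2_D1.
- apply (smooth2_cont U (D1 (D2 f))); auto using smooth2_D2, smooth2_D1.
- apply (smooth2_cont U (D2 (D1 f))); auto using smooth2_D2, smooth2_D1.
Qed.

(** * Smooth functions of one variable *)

Definition open1 (J : R -> Prop) : Prop := forall x, J x -> locally x J.

Definition smooth1 (J : R -> Prop) (f : R -> R) : Prop :=
  forall (n : nat) (s : R), J s -> ex_derive_n f n s.

Lemma smooth1_ex (J : R -> Prop) (f : R -> R) (s : R) :
  smooth1 J f -> J s -> ex_derive f s.
Proof. intros H Hs; exact (H 1%nat s Hs). Qed.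

Lemma smooth1_Derive (J : R -> Prop) (f : R -> R) :
  smooth1 J f -> smooth1 J (Derive f).
Proof.
intros H [|n] s Hs; [exact I|].
specialize (H (S (S n)) s Hs); simpl in *.
eapply ex_derive_ext; [|exact H].
intros t; change (Derive_n f (S n) t = Derive_n (Derive f) n t).
rewrite <- (Nat.add_1_r n), <- Derive_n_comp; reflexivity.
Qed.

(** Composing with an affine form is the only way in which functions of one
    variable enter functions of two variables below: it covers lifts along
    either coordinate as well as travelling waves. *)
Lemma smooth2_affine (U : R -> R -> Prop) (J : R -> Prop) (f : R -> R) (p q r : R) :
  open2 U -> smooth1 J f -> (forall x y, U x y -> J (p * x + q * y + r)) ->
  smooth2 U (fun x y => f (p * x + q * y + r)).
Proof.
intros HU Hf HJ n; revert f Hf; induction n as [|n IH]; intros f Hf;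
  assert (Hc : forall x y, U x y ->
            continuity_2d_pt (fun x y => f (p * x + q * y + r)) x y);
  try (intros x y Hxy; apply (continuity_1d_2d_pt_comp f);
    [ apply continuity_pt_filterlim, (ex_derive_continuous (V := R_NormedModule));
      apply (smooth1_ex J); auto
    | repeat apply continuity_2d_pt_plus; try apply continuity_2d_pt_mult;
      auto using continuity_2d_pt_const, continuity_2d_pt_id1, continuity_2d_pt_id2]).
- intros x y Hxy; split; auto.
- assert (Hd1 : forall x y, U x y ->
    is_derive (fun z => f (p * z + q * y + r)) x (p * Derive f (p * x + q * y + r))).
  { intros x y Hxy; apply (is_derive_comp f (fun z => p * z + q * y + r)).
    - apply Derive_correct, (smooth1_ex J); auto.
    - auto_derive; [trivial | ring]. }
  assert (Hd2 : forall x y, U x y ->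
    is_derive (fun z => f (p * x + q * z + r)) y (q * Derive f (p * x + q * y + r))).
  { intros x y Hxy; apply (is_derive_comp f (fun z => p * x + q * z + r)).
    - apply Derive_correct, (smooth1_ex J); auto.
    - auto_derive; [trivial | ring]. }
  apply classC_S; auto.
  + intros x y Hxy; eexists; now apply Hd1.
  + intros x y Hxy; eexists; now apply Hd2.
  + apply (classC_ext U n (fun x y => p * Derive f (p * x + q * y + r))); auto.
    * intros; symmetry; now apply is_derive_unique, Hd1.
    * apply classC_mult; auto using classC_const, smooth1_Derive.
  + apply (classC_ext U n (fun x y => q * Derive f (p * x + q * y + r))); auto.
    * intros; symmetry; now apply is_derive_unique, Hd2.
    * apply classC_mult; auto using classC_const, smooth1_Derive.
Qed.

Lemma smooth1_lift (U : R -> R -> Prop) (J : R -> Prop) (f : R -> R) :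
  open2 U -> smooth1 J f -> (forall x y, U x y -> J y) ->
  smooth2 U (fun _ y => f y).
Proof.
intros HU Hf HJ.
apply (smooth2_ext U (fun x y => f (0 * x + 1 * y + 0))); auto.
- intros; f_equal; ring.
- apply (smooth2_affine U J); auto.
  intros x y Hxy; replace (0 * x + 1 * y + 0) with y by ring; eauto.
Qed.

Lemma smooth2_slice (U : R -> R -> Prop) (f : R -> R -> R) (x : R) :
  smooth2 U f -> smooth1 (U x) (f x).
Proof.
intros Hf n; revert f Hf; induction n as [|n IH]; intros f Hf s Hs; [exact I|].
destruct n as [|n].
- now apply (smooth2_ex2 U).
- specialize (IH (D2 f) (smooth2_D2 U f Hf) s Hs); simpl in *.
  eapply ex_derive_ext; [|exact IH].
  intros t; change (Derive_n (Derive (f x)) n t = Derive_n (f x) (S n) t).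
  rewrite <- (Nat.add_1_r n), <- Derive_n_comp; reflexivity.
Qed.

Lemma smooth2_slice1 (U : R -> R -> Prop) (f : R -> R -> R) (y : R) :
  smooth2 U f -> smooth1 (fun x => U x y) (fun x => f x y).
Proof.
intros Hf n; revert f Hf; induction n as [|n IH]; intros f Hf s Hs; [exact I|].
destruct n as [|n].
- now apply (smooth2_ex1 U).
- specialize (IH (D1 f) (smooth2_D1 U f Hf) s Hs); simpl in *.
  eapply ex_derive_ext; [|exact IH].
  intros t; change (Derive_n (Derive (fun x => f x y)) n t = Derive_n (fun x => f x y) (S n) t).
  rewrite <- (Nat.add_1_r n), <- Derive_n_comp; reflexivity.
Qed.

Definition strip (J : R -> Prop) : R -> R -> Prop := fun _ y => J y.

Lemma open2_strip (J : R -> Prop) : open1 J -> open2 (strip J).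
Proof.
intros HJ x y Hy; destruct (HJ y Hy) as [d Hd].
exists d; intros u v _ Hv; apply Hd, Hv.
Qed.

(** One-variable closure properties are inherited from the two-variable ones
    through functions that ignore their first argument. *)
Lemma smooth1_strip (J : R -> Prop) (f : R -> R) :
  open1 J -> (smooth1 J f <-> smooth2 (strip J) (fun _ y => f y)).
Proof.
intros HJ; split.
- intros Hf; apply (smooth1_lift _ J); auto using open2_strip.
- intros Hf; exact (smooth2_slice (strip J) (fun _ y => f y) 0 Hf).
Qed.

Section OneVariable.

Context (J : R -> Prop) (HJ : open1 J).

Lemma smooth1_const (c : R) : smooth1 J (fun _ => c).
Proof. apply smooth1_strip; auto; apply smooth2_const; auto using open2_strip. Qed.

Lemma smooth1_id : smooth1 J (fun x => x).
Proof.
intros [|[|n]] s _; simpl; [exact I | apply ex_derive_id |].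
apply (ex_derive_ext (fun _ => match n with O => 1 | _ => 0 end)); [|apply ex_derive_const].
intros t; change (match n with O => 1 | _ => 0 end = Derive_n (fun x => x) (S n) t).
rewrite <- (Nat.add_1_r n), <- Derive_n_comp.
rewrite (Derive_n_ext _ (fun _ => 1)); [|intros; apply Derive_id].
destruct n; [reflexivity | now rewrite Derive_n_const].
Qed.

Lemma smooth1_plus (f g : R -> R) :
  smooth1 J f -> smooth1 J g -> smooth1 J (fun x => f x + g x).
Proof.
rewrite !smooth1_strip by auto; intros Hf Hg.
apply (smooth2_plus (strip J)); auto using open2_strip.
Qed.

Lemma smooth1_mult (f g : R -> R) :
  smooth1 J f -> smooth1 J g -> smooth1 J (fun x => f x * g x).
Proof.
rewrite !smooth1_strip by auto; intros Hf Hg.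
apply (smooth2_mult (strip J)); auto using open2_strip.
Qed.

Lemma smooth1_opp (f : R -> R) : smooth1 J f -> smooth1 J (fun x => - f x).
Proof.
rewrite !smooth1_strip by auto; intros Hf.
apply (smooth2_opp (strip J)); auto using open2_strip.
Qed.

Lemma smooth1_ext (f g : R -> R) :
  (forall x, J x -> f x = g x) -> smooth1 J f -> smooth1 J g.
Proof.
rewrite !smooth1_strip by auto; intros Hfg.
apply smooth2_ext; auto using open2_strip.
Qed.

End OneVariable.

Lemma smooth1_continuous (J : R -> Prop) (f : R -> R) (x : R) :
  smooth1 J f -> J x -> continuous f x.
Proof.
intros Hf Hx; apply (ex_derive_continuous (V := R_NormedModule)), (smooth1_ex J); auto.
Qed.


(** * Vectors of Minkowski space *)

Lemma pr1_vadd (x y : vec) : pr1 (vadd x y) = pr1 x + pr1 y.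
Proof. reflexivity. Qed.
Lemma pr2_vadd (x y : vec) : pr2 (vadd x y) = pr2 x + pr2 y.
Proof. reflexivity. Qed.
Lemma pr3_vadd (x y : vec) : pr3 (vadd x y) = pr3 x + pr3 y.
Proof. reflexivity. Qed.
Lemma pr1_vscal (c : R) (x : vec) : pr1 (vscal c x) = c * pr1 x.
Proof. reflexivity. Qed.
Lemma pr2_vscal (c : R) (x : vec) : pr2 (vscal c x) = c * pr2 x.
Proof. reflexivity. Qed.
Lemma pr3_vscal (c : R) (x : vec) : pr3 (vscal c x) = c * pr3 x.
Proof. reflexivity. Qed.

Lemma pr1_vzero : pr1 vzero = 0.
Proof. reflexivity. Qed.
Lemma pr2_vzero : pr2 vzero = 0.
Proof. reflexivity. Qed.
Lemma pr3_vzero : pr3 vzero = 0.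
Proof. reflexivity. Qed.

Lemma vec_eq (x y : vec) : pr1 x = pr1 y -> pr2 x = pr2 y -> pr3 x = pr3 y -> x = y.
Proof.
destruct x as [[x1 x2] x3], y as [[y1 y2] y3]; unfold pr1, pr2, pr3; simpl.
now intros -> -> ->.
Qed.

(** The Lorentzian cross product, dual to the determinant: the inner product
    of [cross x y] with [z] is [det3 x y z]. *)
Definition cross (x y : vec) : vec :=
  (- pr3 (wedge x y), pr2 (wedge x y), - pr1 (wedge x y)).

Lemma pr1_wedge (x y : vec) : pr1 (wedge x y) = pr2 x * pr3 y - pr3 x * pr2 y.
Proof. reflexivity. Qed.
Lemma pr2_wedge (x y : vec) : pr2 (wedge x y) = pr3 x * pr1 y - pr1 x * pr3 y.
Proof. reflexivity. Qed.
Lemma pr3_wedge (x y : vec) : pr3 (wedge x y) = pr1 x * pr2 y - pr2 x * pr1 y.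
Proof. reflexivity. Qed.

Lemma pr1_cross (x y : vec) : pr1 (cross x y) = pr2 x * pr1 y - pr1 x * pr2 y.
Proof. unfold cross, wedge, pr1, pr2, pr3; simpl; ring. Qed.
Lemma pr2_cross (x y : vec) : pr2 (cross x y) = pr3 x * pr1 y - pr1 x * pr3 y.
Proof. unfold cross, wedge, pr1, pr2, pr3; simpl; ring. Qed.
Lemma pr3_cross (x y : vec) : pr3 (cross x y) = pr3 x * pr2 y - pr2 x * pr3 y.
Proof. unfold cross, wedge, pr1, pr2, pr3; simpl; ring. Qed.

Lemma det3_expand (x y z : vec) :
  det3 x y z = pr1 x * (pr2 y * pr3 z - pr3 y * pr2 z)
             + pr2 x * (pr3 y * pr1 z - pr1 y * pr3 z)
             + pr3 x * (pr1 y * pr2 z - pr2 y * pr1 z).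
Proof. reflexivity. Qed.

Ltac vec_expand :=
  unfold normsq, inner;
  rewrite ?det3_expand, ?pr1_vadd, ?pr2_vadd, ?pr3_vadd, ?pr1_vscal, ?pr2_vscal, ?pr3_vscal,
    ?pr1_cross, ?pr2_cross, ?pr3_cross;
  rewrite ?pr1_vadd, ?pr2_vadd, ?pr3_vadd, ?pr1_vscal, ?pr2_vscal, ?pr3_vscal,
    ?pr1_cross, ?pr2_cross, ?pr3_cross;
  rewrite ?pr1_vadd, ?pr2_vadd, ?pr3_vadd, ?pr1_vscal, ?pr2_vscal, ?pr3_vscal,
    ?pr1_cross, ?pr2_cross, ?pr3_cross, ?pr1_vzero, ?pr2_vzero, ?pr3_vzero.

Ltac vec_ring := try apply vec_eq; vec_expand; ring.

Lemma inner_sym (x y : vec) : inner x y = inner y x.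
Proof. vec_ring. Qed.
Lemma inner_vadd_l (x y z : vec) : inner (vadd x y) z = inner x z + inner y z.
Proof. vec_ring. Qed.
Lemma inner_vadd_r (x y z : vec) : inner x (vadd y z) = inner x y + inner x z.
Proof. vec_ring. Qed.
Lemma inner_vscal_l (c : R) (x y : vec) : inner (vscal c x) y = c * inner x y.
Proof. vec_ring. Qed.
Lemma inner_vscal_r (c : R) (x y : vec) : inner x (vscal c y) = c * inner x y.
Proof. vec_ring. Qed.
Lemma inner_cross (x y z : vec) : inner (cross x y) z = det3 x y z.
Proof. vec_ring. Qed.

Lemma cross_vadd_l (x y z : vec) : cross (vadd x y) z = vadd (cross x z) (cross y z).
Proof. vec_ring. Qed.
Lemma cross_vadd_r (x y z : vec) : cross x (vadd y z) = vadd (cross x y) (cross x z).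
Proof. vec_ring. Qed.
Lemma cross_vscal_l (c : R) (x y : vec) : cross (vscal c x) y = vscal c (cross x y).
Proof. vec_ring. Qed.
Lemma cross_vscal_r (c : R) (x y : vec) : cross x (vscal c y) = vscal c (cross x y).
Proof. vec_ring. Qed.

Lemma cross_cross (w y : vec) :
  cross w (cross w y) = vadd (vscal (normsq w) y) (vscal (- inner w y) w).
Proof. vec_ring. Qed.

(** The relations that characterize the images of the basis (e1, e2, e3) under
    linear isometries. *)
Record null_frame (t n b : vec) : Prop := {
  frame_tt : inner t t = 0;
  frame_tn : inner t n = 0;
  frame_tb : inner t b = -1;
  frame_nn : inner n n = 1;
  frame_nb : inner n b = 0;
  frame_bb : inner b b = 0 }.

Lemma det3_sqr_gram (t n b : vec) :
  det3 t n b * det3 t n b =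
  - (inner t t * (inner n n * inner b b - inner n b * inner n b)
   - inner t n * (inner t n * inner b b - inner n b * inner t b)
   + inner t b * (inner t n * inner n b - inner n n * inner t b)).
Proof. vec_ring. Qed.

Lemma frame_det3_sqr (t n b : vec) :
  null_frame t n b -> det3 t n b * det3 t n b = 1.
Proof. intros [H1 H2 H3 H4 H5 H6]; rewrite det3_sqr_gram, H1, H2, H3, H4, H5, H6; ring. Qed.

(** Cramer's rule: the determinant of the frame times [y] is a combination of
    cross products of frame vectors, with these inner products as coefficients. *)
Lemma frame_orthogonal (t n b y : vec) :
  null_frame t n b -> inner y t = 0 -> inner y n = 0 -> inner y b = 0 -> y = vzero.
Proof.
intros Hf Ht Hn Hb; pose proof (frame_det3_sqr t n b Hf) as Hd.
assert (E : vscal (det3 t n b) y =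
  vadd (vadd (vscal (inner y t) (cross n b)) (vscal (inner y n) (cross b t)))
       (vscal (inner y b) (cross t n))) by vec_ring.
assert (E0 : vscal (det3 t n b) y = vzero).
{ rewrite E, Ht, Hn, Hb. vec_ring. }
replace y with (vscal (det3 t n b) (vscal (det3 t n b) y)).
- rewrite E0; vec_ring.
- apply vec_eq; vec_expand; rewrite <- Rmult_assoc;
    rewrite det3_expand in Hd; rewrite Hd; ring.
Qed.

Lemma frame_expand (t n b y : vec) :
  null_frame t n b ->
  y = vadd (vadd (vscal (- inner y b) t) (vscal (inner y n) n)) (vscal (- inner y t) b).
Proof.
intros Hf.
set (z := vadd (vadd (vscal (- inner y b) t) (vscal (inner y n) n)) (vscal (- inner y t) b)).
assert (H0 : vadd y (vscal (-1) z) = vzero).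
{ apply (frame_orthogonal t n b); auto; unfold z;
    rewrite ?inner_vadd_l, ?inner_vscal_l, ?inner_vadd_l, ?inner_vscal_l, ?inner_vadd_l, ?inner_vscal_l;
    rewrite ?(inner_sym n t), ?(inner_sym b t), ?(inner_sym b n);
    destruct Hf as [H1 H2 H3 H4 H5 H6]; rewrite ?H1, ?H2, ?H3, ?H4, ?H5, ?H6; ring. }
apply vec_eq.
- apply (f_equal pr1) in H0; revert H0; rewrite pr1_vadd, pr1_vscal; rewrite pr1_vzero; lra.
- apply (f_equal pr2) in H0; revert H0; rewrite pr2_vadd, pr2_vscal; rewrite pr2_vzero; lra.
- apply (f_equal pr3) in H0; revert H0; rewrite pr3_vadd, pr3_vscal; rewrite pr3_vzero; lra.
Qed.

Lemma frame_expand_eq (t n b y : vec) (p q r : R) :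
  null_frame t n b -> inner y b = - p -> inner y n = q -> inner y t = - r ->
  y = vadd (vadd (vscal p t) (vscal q n)) (vscal r b).
Proof.
intros Hf Hb Hn Ht; rewrite (frame_expand t n b y Hf), Hb, Hn, Ht.
now rewrite !Ropp_involutive.
Qed.

(** The orientation of the frame enters here as a sign, since the Gram relations
    leave it open while the cross product depends on it. *)
Lemma frame_cross_tn (t n b : vec) :
  null_frame t n b -> cross t n = vscal (- det3 t n b) t.
Proof.
intros Hf; rewrite (frame_expand_eq t n b (cross t n) (- det3 t n b) 0 0 Hf).
- vec_ring.
- rewrite inner_cross; ring.
- rewrite inner_cross; vec_ring.
- rewrite inner_cross; vec_ring.
Qed.

Lemma frame_cross_nb (t n b : vec) :
  null_frame t n b -> cross n b = vscal (- det3 t n b) b.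
Proof.
intros Hf; rewrite (frame_expand_eq t n b (cross n b) 0 0 (- det3 t n b) Hf).
- vec_ring.
- rewrite inner_cross; vec_ring.
- rewrite inner_cross; vec_ring.
- rewrite inner_cross; vec_ring.
Qed.

Lemma frame_cross_bt (t n b : vec) :
  null_frame t n b -> cross b t = vscal (det3 t n b) n.
Proof.
intros Hf; rewrite (frame_expand_eq t n b (cross b t) 0 (det3 t n b) 0 Hf).
- vec_ring.
- rewrite inner_cross; vec_ring.
- rewrite inner_cross; vec_ring.
- rewrite inner_cross; vec_ring.
Qed.

Lemma cross_anti (x y : vec) : cross x y = vscal (-1) (cross y x).
Proof. vec_ring. Qed.

(** * Differentiation of vector functions *)

Definition is_dvec (X : R -> vec) (s : R) (v : vec) : Prop :=
  is_derive (fun u => pr1 (X u)) s (pr1 v) /\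
  is_derive (fun u => pr2 (X u)) s (pr2 v) /\
  is_derive (fun u => pr3 (X u)) s (pr3 v).

Lemma is_dvec_unique (X : R -> vec) (s : R) (v : vec) : is_dvec X s v -> dvec X s = v.
Proof.
intros (H1 & H2 & H3); apply vec_eq; now apply is_derive_unique.
Qed.

Lemma is_dvec_const (c : vec) (s : R) : is_dvec (fun _ => c) s vzero.
Proof. split; [|split]; apply @is_derive_const. Qed.

Lemma is_dvec_eq (X : R -> vec) (s : R) (v w : vec) :
  v = w -> is_dvec X s v -> is_dvec X s w.
Proof. now intros ->. Qed.

Lemma is_dvec_ext_loc (X Y : R -> vec) (s : R) (v : vec) :
  locally s (fun u => X u = Y u) -> is_dvec X s v -> is_dvec Y s v.
Proof.
intros HXY (H1 & H2 & H3).
split; [|split]; (eapply is_derive_ext_loc; [|eassumption]);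
  revert HXY; apply filter_imp; now intros u ->.
Qed.

Lemma is_dvec_add (X Y : R -> vec) (s : R) (v w : vec) :
  is_dvec X s v -> is_dvec Y s w -> is_dvec (fun u => vadd (X u) (Y u)) s (vadd v w).
Proof.
intros (H1 & H2 & H3) (K1 & K2 & K3); split; [|split];
  now apply (is_derive_plus (V := R_NormedModule)).
Qed.

Lemma is_derive_Rmult (f g : R -> R) (s l m : R) :
  is_derive f s l -> is_derive g s m ->
  is_derive (fun u => f u * g u) s (l * g s + f s * m).
Proof. intros; apply (is_derive_mult (K := R_AbsRing)); auto; intros; apply Rmult_comm. Qed.

Lemma is_derive_Rplus (f g : R -> R) (s l m : R) :
  is_derive f s l -> is_derive g s m -> is_derive (fun u => f u + g u) s (l + m).
Proof. apply (is_derive_plus (V := R_NormedModule)). Qed.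

Lemma is_derive_Ropp (f : R -> R) (s l : R) :
  is_derive f s l -> is_derive (fun u => - f u) s (- l).
Proof. apply (is_derive_opp (V := R_NormedModule)). Qed.

Lemma is_derive_eq (f : R -> R) (s l m : R) : l = m -> is_derive f s l -> is_derive f s m.
Proof. now intros ->. Qed.

Lemma is_dvec_scal (f : R -> R) (X : R -> vec) (s l : R) (v : vec) :
  is_derive f s l -> is_dvec X s v ->
  is_dvec (fun u => vscal (f u) (X u)) s (vadd (vscal l (X s)) (vscal (f s) v)).
Proof.
intros Hf (H1 & H2 & H3); split; [|split]; now apply (is_derive_Rmult f).
Qed.

Lemma is_dvec_scalc (c : R) (X : R -> vec) (s : R) (v : vec) :
  is_dvec X s v -> is_dvec (fun u => vscal c (X u)) s (vscal c v).
Proof.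
intros H; eapply is_dvec_eq; [|apply (is_dvec_scal (fun _ => c) X s 0); [apply @is_derive_const | exact H]].
vec_ring.
Qed.

Lemma is_derive_inner (X Y : R -> vec) (s : R) (v w : vec) :
  is_dvec X s v -> is_dvec Y s w ->
  is_derive (fun u => inner (X u) (Y u)) s (inner v (Y s) + inner (X s) w).
Proof.
intros (H1 & H2 & H3) (K1 & K2 & K3); unfold inner.
eapply is_derive_eq; [|apply is_derive_Rplus; [apply is_derive_Ropp, is_derive_Rplus|];
  apply is_derive_Rmult; eassumption].
simpl; ring.
Qed.

Lemma is_dvec_cross (w : vec) (X : R -> vec) (s : R) (v : vec) :
  is_dvec X s v -> is_dvec (fun u => cross w (X u)) s (cross w v).
Proof.
intros (H1 & H2 & H3).
split; [|split];
[ apply (is_derive_ext (fun u => pr2 w * pr1 (X u) + - (pr1 w * pr2 (X u))));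
  [intros; rewrite pr1_cross; reflexivity|]
| apply (is_derive_ext (fun u => pr3 w * pr1 (X u) + - (pr1 w * pr3 (X u))));
  [intros; rewrite pr2_cross; reflexivity|]
| apply (is_derive_ext (fun u => pr3 w * pr2 (X u) + - (pr2 w * pr3 (X u))));
  [intros; rewrite pr3_cross; reflexivity|]];
(eapply is_derive_eq; [|apply is_derive_Rplus; [|apply is_derive_Ropp];
  apply is_derive_scal; eassumption]);
  rewrite ?pr1_cross, ?pr2_cross, ?pr3_cross; ring.
Qed.

Lemma is_derive_det3 (X Y Z : R -> vec) (s : R) (x y z : vec) :
  is_dvec X s x -> is_dvec Y s y -> is_dvec Z s z ->
  is_derive (fun u => det3 (X u) (Y u) (Z u)) s
    (det3 x (Y s) (Z s) + det3 (X s) y (Z s) + det3 (X s) (Y s) z).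
Proof.
intros (X1 & X2 & X3) (Y1 & Y2 & Y3) (Z1 & Z2 & Z3).
apply (is_derive_ext (fun u =>
  pr1 (X u) * (pr2 (Y u) * pr3 (Z u) + - (pr3 (Y u) * pr2 (Z u)))
  + pr2 (X u) * (pr3 (Y u) * pr1 (Z u) + - (pr1 (Y u) * pr3 (Z u)))
  + pr3 (X u) * (pr1 (Y u) * pr2 (Z u) + - (pr2 (Y u) * pr1 (Z u))))); [reflexivity|].
eapply is_derive_eq; [|apply is_derive_Rplus; [apply is_derive_Rplus|];
  (apply is_derive_Rmult; [|apply is_derive_Rplus; [|apply is_derive_Ropp]; apply is_derive_Rmult]);
  eassumption].
rewrite !det3_expand; simpl; ring.
Qed.

Lemma is_dvec_n (J : R -> Prop) (g : R -> vec) (k : nat) (s : R) :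
  smooth_on J g -> J s -> is_dvec (dvec_n k g) s (dvec_n (S k) g s).
Proof.
intros Hg Hs; destruct (Hg (S k) s Hs) as (H1 & H2 & H3).
split; [|split]; now apply Derive_correct.
Qed.

(** * Constancy on open intervals *)

Lemma open1_ooint (a b : Rbar) : open1 (ooint a b).
Proof. intros s [H1 H2]; apply filter_and; [now apply open_Rbar_gt | now apply open_Rbar_lt]. Qed.

Lemma ooint_convex (a b : Rbar) (x y z : R) :
  ooint a b x -> ooint a b y -> x <= z <= y -> ooint a b z.
Proof.
intros [H1 H2] [H3 H4] [H5 H6]; split.
- apply (Rbar_lt_le_trans a x z); simpl; auto.
- apply (Rbar_le_lt_trans z y b); simpl; auto.
Qed.

Lemma is_derive_zero_const (a b : Rbar) (f : R -> R) :
  (forall s, ooint a b s -> is_derive f s 0) ->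
  forall x y, ooint a b x -> ooint a b y -> f x = f y.
Proof.
intros Hf.
assert (H : forall x y, x <= y -> ooint a b x -> ooint a b y -> f x = f y).
{ intros x y Hxy Hx Hy; destruct (Req_dec x y) as [->|Hne]; [reflexivity|].
  apply (eq_is_derive f); [|lra].
  intros t Ht; apply Hf, (ooint_convex a b x y); auto. }
intros x y Hx Hy; destruct (Rle_dec x y); [|symmetry]; apply H; auto; lra.
Qed.

Lemma is_dvec_zero_const (a b : Rbar) (X : R -> vec) :
  (forall s, ooint a b s -> is_dvec X s vzero) ->
  forall x y, ooint a b x -> ooint a b y -> X x = X y.
Proof.
intros H x y Hx Hy; apply vec_eq;
  [ apply (is_derive_zero_const a b (fun s => pr1 (X s)))
  | apply (is_derive_zero_const a b (fun s => pr2 (X s)))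
  | apply (is_derive_zero_const a b (fun s => pr3 (X s))) ]; auto;
  intros s Hs; apply (H s Hs).
Qed.

Lemma derive_of_const (J : R -> Prop) (f : R -> R) (c s l : R) :
  open1 J -> J s -> (forall u, J u -> f u = c) -> is_derive f s l -> l = 0.
Proof.
intros HJ Hs Hc Hd.
rewrite <- (is_derive_unique f s l Hd).
rewrite (Derive_ext_loc f (fun _ => c)); [apply Derive_const|].
generalize (HJ s Hs); apply filter_imp; auto.
Qed.

Lemma derive_ext_unique (J : R -> Prop) (f g : R -> R) (s l m : R) :
  open1 J -> J s -> (forall u, J u -> f u = g u) ->
  is_derive f s l -> is_derive g s m -> l = m.
Proof.
intros HJ Hs Hc Hf Hg.
rewrite <- (is_derive_unique f s l Hf), <- (is_derive_unique g s m Hg).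
apply Derive_ext_loc; generalize (HJ s Hs); apply filter_imp; auto.
Qed.

Lemma ooint_inhabited (a b : Rbar) : Rbar_lt a b -> exists s, ooint a b s.
Proof.
intros Hab; destruct a as [x| |], b as [y| |]; simpl in Hab; try easy.
- exists ((x + y) / 2); split; simpl; lra.
- exists (x + 1); split; simpl; auto; lra.
- exists (y - 1); split; simpl; auto; lra.
- exists 0; split; simpl; auto.
Qed.


(** * Frenet equations *)

Definition natural_null (J : R -> Prop) (g : R -> vec) : Prop :=
  null_curve J g /\ flex_free J g /\ natural_parameter J g.

Definition comb (t n b : vec) (p q r : R) : vec :=
  vadd (vadd (vscal p t) (vscal q n)) (vscal r b).

Lemma smooth1_Derive_n (J : R -> Prop) (f : R -> R) (k : nat) :
  smooth1 J f -> smooth1 J (Derive_n f k).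
Proof.
intros Hf; induction k as [|k IH]; [exact Hf|].
exact (smooth1_Derive J (Derive_n f k) IH).
Qed.

Lemma smooth_on_dvec_n (J : R -> Prop) (g : R -> vec) (k : nat) :
  smooth_on J g ->
  smooth1 J (fun s => pr1 (dvec_n k g s)) /\
  smooth1 J (fun s => pr2 (dvec_n k g s)) /\
  smooth1 J (fun s => pr3 (dvec_n k g s)).
Proof.
intros Hg; split; [|split]; apply (smooth1_Derive_n J _ k);
  intros m s Hs; apply (Hg m s Hs).
Qed.

Lemma smooth1_inner (J : R -> Prop) (X Y : R -> vec) :
  open1 J ->
  smooth1 J (fun s => pr1 (X s)) -> smooth1 J (fun s => pr2 (X s)) ->
  smooth1 J (fun s => pr3 (X s)) ->
  smooth1 J (fun s => pr1 (Y s)) -> smooth1 J (fun s => pr2 (Y s)) ->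
  smooth1 J (fun s => pr3 (Y s)) -> smooth1 J (fun s => inner (X s) (Y s)).
Proof.
intros HJ X1 X2 X3 Y1 Y2 Y3; unfold inner.
apply smooth1_plus; auto; [apply smooth1_opp; auto; apply smooth1_plus; auto|];
  apply smooth1_mult; auto.
Qed.

Section Frenet.

Context (J : R -> Prop) (g : R -> vec) (HJ : open1 J) (Hg : natural_null J g).

Let Hsm : smooth_on J g := proj1 (proj1 Hg).

Lemma gram_tt (s : R) : J s -> inner (dvec_n 1 g s) (dvec_n 1 g s) = 0.
Proof. pose proof Hg as ((_ & H) & _); intros Hs; apply (H s Hs). Qed.

Lemma gram_nn (s : R) : J s -> inner (dvec_n 2 g s) (dvec_n 2 g s) = 1.
Proof.
pose proof Hg as (_ & _ & H); intros Hs; specialize (H s Hs).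
unfold omega, mnorm in H; fold (normsq (dvec_n 2 g s)).
assert (H1 : sqrt (normsq (dvec_n 2 g s)) = 1).
{ rewrite <- (sqrt_sqrt (sqrt (normsq (dvec_n 2 g s)))) by apply sqrt_pos.
  rewrite H; ring. }
destruct (Rle_dec 0 (normsq (dvec_n 2 g s))) as [Hp|Hp].
- rewrite <- (sqrt_sqrt _ Hp), H1; ring.
- rewrite sqrt_neg_0 in H1; lra.
Qed.

Lemma gram_derive (i j : nat) (c s : R) :
  (forall u, J u -> inner (dvec_n i g u) (dvec_n j g u) = c) -> J s ->
  inner (dvec_n (S i) g s) (dvec_n j g s) + inner (dvec_n i g s) (dvec_n (S j) g s) = 0.
Proof.
intros H Hs.
apply (derive_of_const J (fun u => inner (dvec_n i g u) (dvec_n j g u)) c s); auto.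
apply is_derive_inner; apply (is_dvec_n J); auto.
Qed.

Lemma gram_tn (s : R) : J s -> inner (dvec_n 1 g s) (dvec_n 2 g s) = 0.
Proof.
intros Hs; pose proof (gram_derive 1 1 0 s gram_tt Hs) as H.
rewrite (inner_sym (dvec_n 2 g s)) in H; lra.
Qed.

Lemma gram_tu (s : R) : J s -> inner (dvec_n 1 g s) (dvec_n 3 g s) = -1.
Proof.
intros Hs; pose proof (gram_derive 1 2 0 s gram_tn Hs) as H.
rewrite gram_nn in H; auto; lra.
Qed.

Lemma gram_nu (s : R) : J s -> inner (dvec_n 2 g s) (dvec_n 3 g s) = 0.
Proof.
intros Hs; pose proof (gram_derive 2 2 1 s gram_nn Hs) as H.
rewrite (inner_sym (dvec_n 3 g s)) in H; lra.
Qed.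

Lemma gram_uu (s : R) : inner (dvec_n 3 g s) (dvec_n 3 g s) = 4 * curvature_nat g s.
Proof. unfold curvature_nat, normsq; field. Qed.

Lemma frenet_b_eq (s : R) :
  frenet_b g s = vadd (dvec_n 3 g s) (vscal (2 * curvature_nat g s) (dvec_n 1 g s)).
Proof. unfold frenet_b, curvature_nat; do 2 f_equal; field. Qed.

Lemma frenet_frame (s : R) :
  J s -> null_frame (frenet_t g s) (frenet_n g s) (frenet_b g s).
Proof.
intros Hs; rewrite frenet_b_eq; unfold frenet_t, frenet_n.
pose proof (gram_tt s Hs); pose proof (gram_tn s Hs); pose proof (gram_nn s Hs).
pose proof (gram_tu s Hs); pose proof (gram_nu s Hs); pose proof (gram_uu s).
split; rewrite ?inner_vadd_r, ?inner_vadd_l, ?inner_vscal_r, ?inner_vscal_l, ?inner_vadd_r,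
  ?inner_vscal_r, ?(inner_sym (dvec_n 3 g s) (dvec_n 1 g s)),
  ?(inner_sym (dvec_n 2 g s) (dvec_n 1 g s)); nra.
Qed.

Lemma dvec_n3_frenet (s : R) :
  dvec_n 3 g s = comb (frenet_t g s) (frenet_n g s) (frenet_b g s)
                      (- 2 * curvature_nat g s) 0 1.
Proof. rewrite frenet_b_eq; unfold comb, frenet_t; vec_ring. Qed.

Lemma smooth1_curvature : smooth1 J (curvature_nat g).
Proof.
destruct (smooth_on_dvec_n J g 3 Hsm) as (H1 & H2 & H3).
apply smooth1_mult; auto using smooth1_const; apply smooth1_inner; auto.
Qed.

Lemma is_derive_curvature (k : nat) (s : R) :
  J s -> is_derive (Derive_n (curvature_nat g) k) s (Derive_n (curvature_nat g) (S k) s).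
Proof.
intros Hs; apply Derive_correct, (smooth1_ex J); auto.
apply smooth1_Derive_n, smooth1_curvature.
Qed.

Lemma is_dvec_frenet_t (s : R) : J s -> is_dvec (frenet_t g) s (frenet_n g s).
Proof. intros Hs; now apply (is_dvec_n J). Qed.

Lemma is_dvec_frenet_n (s : R) :
  J s -> is_dvec (frenet_n g) s
           (comb (frenet_t g s) (frenet_n g s) (frenet_b g s) (- 2 * curvature_nat g s) 0 1).
Proof. intros Hs; rewrite <- dvec_n3_frenet; now apply (is_dvec_n J). Qed.

Lemma dvec_n4_frenet (s : R) :
  J s -> dvec_n 4 g s = comb (frenet_t g s) (frenet_n g s) (frenet_b g s)
           (- 2 * Derive (curvature_nat g) s) (- 4 * curvature_nat g s) 0.
Proof.
intros Hs.
assert (H14 : inner (dvec_n 4 g s) (dvec_n 1 g s) = 0).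
{ pose proof (gram_derive 1 3 (-1) s gram_tu Hs) as H.
  rewrite gram_nu in H; auto; rewrite inner_sym; lra. }
assert (H24 : inner (dvec_n 4 g s) (dvec_n 2 g s) = - 4 * curvature_nat g s).
{ pose proof (gram_derive 2 3 0 s gram_nu Hs) as H.
  rewrite gram_uu in H; rewrite inner_sym; lra. }
assert (H34 : inner (dvec_n 4 g s) (dvec_n 3 g s) = 2 * Derive (curvature_nat g) s).
{ assert (H : Derive (curvature_nat g) s =
    1/4 * (inner (dvec_n 4 g s) (dvec_n 3 g s) + inner (dvec_n 3 g s) (dvec_n 4 g s))).
  { apply is_derive_unique, is_derive_scal, is_derive_inner; now apply (is_dvec_n J). }
  rewrite H, (inner_sym (dvec_n 3 g s)); field. }
apply frame_expand_eq; [now apply frenet_frame| | |].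
- rewrite frenet_b_eq, inner_vadd_r, inner_vscal_r, H34, H14; ring.
- exact H24.
- unfold frenet_t; rewrite H14; ring.
Qed.

Lemma is_dvec_frenet_b (s : R) :
  J s -> is_dvec (frenet_b g) s (vscal (- 2 * curvature_nat g s) (frenet_n g s)).
Proof.
intros Hs.
eapply (is_dvec_ext_loc (fun u => vadd (dvec_n 3 g u) (vscal (2 * curvature_nat g u) (frenet_t g u)))).
{ apply filter_forall; intros u; now rewrite frenet_b_eq. }
eapply is_dvec_eq; [|apply is_dvec_add; [now apply (is_dvec_n J)|
  apply is_dvec_scal; [apply is_derive_scal, (is_derive_curvature 0); auto
                      | now apply is_dvec_frenet_t]]].
rewrite dvec_n4_frenet by auto; unfold comb.
change (Derive_n (curvature_nat g) 1 s) with (Derive (curvature_nat g) s); vec_ring.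
Qed.

(** Every later differentiation of a vector field along the curve goes through
    this form of the Frenet equations, which reduces it to scalar components. *)
Lemma is_dvec_comb (p q r : R -> R) (s p' q' r' : R) :
  J s -> is_derive p s p' -> is_derive q s q' -> is_derive r s r' ->
  is_dvec (fun u => comb (frenet_t g u) (frenet_n g u) (frenet_b g u) (p u) (q u) (r u)) s
    (comb (frenet_t g s) (frenet_n g s) (frenet_b g s)
       (p' - 2 * curvature_nat g s * q s)
       (q' + p s - 2 * curvature_nat g s * r s)
       (r' + q s)).
Proof.
intros Hs Hp Hq Hr.
eapply is_dvec_eq; [|apply is_dvec_add; [apply is_dvec_add|]; apply is_dvec_scal;
  eauto using is_dvec_frenet_t, is_dvec_frenet_n, is_dvec_frenet_b].
unfold comb; vec_ring.
Qed.

Lemma inner_comb (s p q r p' q' r' : R) :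
  J s ->
  inner (comb (frenet_t g s) (frenet_n g s) (frenet_b g s) p q r)
        (comb (frenet_t g s) (frenet_n g s) (frenet_b g s) p' q' r') =
  q * q' - p * r' - r * p'.
Proof.
intros Hs; destruct (frenet_frame s Hs) as [H1 H2 H3 H4 H5 H6].
unfold comb; rewrite ?inner_vadd_l, ?inner_vadd_r, ?inner_vscal_l, ?inner_vscal_r.
rewrite (inner_sym (frenet_n g s) (frenet_t g s)), (inner_sym (frenet_b g s) (frenet_t g s)),
  (inner_sym (frenet_b g s) (frenet_n g s)), H1, H2, H3, H4, H5, H6; ring.
Qed.

Lemma smooth1_frenet (X : R -> vec) :
  X = frenet_t g \/ X = frenet_n g \/ X = frenet_b g ->
  smooth1 J (fun s => pr1 (X s)) /\ smooth1 J (fun s => pr2 (X s)) /\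
  smooth1 J (fun s => pr3 (X s)).
Proof.
destruct (smooth_on_dvec_n J g 1 Hsm) as (T1 & T2 & T3).
destruct (smooth_on_dvec_n J g 3 Hsm) as (U1 & U2 & U3).
assert (H2k : smooth1 J (fun s => 2 * curvature_nat g s)).
{ apply smooth1_mult; auto using smooth1_const, smooth1_curvature. }
intros [-> | [-> | ->]].
- now apply (smooth_on_dvec_n J g 1).
- now apply (smooth_on_dvec_n J g 2).
- split; [|split].
  + apply (smooth1_ext J HJ (fun s => pr1 (dvec_n 3 g s) + 2 * curvature_nat g s * pr1 (dvec_n 1 g s))).
    * intros s _; now rewrite frenet_b_eq, pr1_vadd, pr1_vscal.
    * apply smooth1_plus; auto; apply smooth1_mult; auto.
  + apply (smooth1_ext J HJ (fun s => pr2 (dvec_n 3 g s) + 2 * curvature_nat g s * pr2 (dvec_n 1 g s))).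
    * intros s _; now rewrite frenet_b_eq, pr2_vadd, pr2_vscal.
    * apply smooth1_plus; auto; apply smooth1_mult; auto.
  + apply (smooth1_ext J HJ (fun s => pr3 (dvec_n 3 g s) + 2 * curvature_nat g s * pr3 (dvec_n 1 g s))).
    * intros s _; now rewrite frenet_b_eq, pr3_vadd, pr3_vscal.
    * apply smooth1_plus; auto; apply smooth1_mult; auto.
Qed.

Definition orient (s : R) : R := det3 (frenet_t g s) (frenet_n g s) (frenet_b g s).

Lemma orient_sqr (s : R) : J s -> orient s * orient s = 1.
Proof. intros Hs; now apply frame_det3_sqr, frenet_frame. Qed.

Lemma is_derive_orient (s : R) : J s -> is_derive orient s 0.
Proof.
intros Hs; unfold orient.
eapply is_derive_eq; [|apply is_derive_det3;
  [now apply is_dvec_frenet_t | now apply is_dvec_frenet_n | now apply is_dvec_frenet_b]].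
unfold comb; vec_expand; ring.
Qed.

End Frenet.

Lemma orient_const (a b : Rbar) (g : R -> vec) (x y : R) :
  natural_null (ooint a b) g -> ooint a b x -> ooint a b y -> orient g x = orient g y.
Proof.
intros Hg; apply is_derive_zero_const; intros s Hs.
apply (is_derive_orient (ooint a b)); auto using open1_ooint.
Qed.

(** * The momentum *)

(** The travelling wave equation of the KdV equation is the vanishing of this
    expression, which is also the Euler-Lagrange expression of the action. *)
Definition wave (lam : R) (g : R -> vec) (s : R) : R :=
  Derive_n (curvature_nat g) 3 s + 6 * curvature_nat g s * Derive (curvature_nat g) s
  - lam * Derive (curvature_nat g) s.

(** The conserved quantity that belongs to the invariance of the action under
    translations. *)
Definition momentum (lam : R) (g : R -> vec) (s : R) : vec :=
  comb (frenet_t g s) (frenet_n g s) (frenet_b g s)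
    (Derive_n (curvature_nat g) 2 s + 2 * curvature_nat g s * curvature_nat g s
       - lam * curvature_nat g s)
    (- Derive (curvature_nat g) s)
    (curvature_nat g s - lam / 2).

Lemma is_dvec_momentum (J : R -> Prop) (lam : R) (g : R -> vec) (s : R) :
  open1 J -> natural_null J g -> J s ->
  is_dvec (momentum lam g) s (vscal (wave lam g s) (frenet_t g s)).
Proof.
intros HJ Hg Hs.
pose proof (is_derive_curvature J g HJ Hg 0 s Hs) as K0.
pose proof (is_derive_curvature J g HJ Hg 1 s Hs) as K1.
pose proof (is_derive_curvature J g HJ Hg 2 s Hs) as K2.
eapply is_dvec_eq; [|apply (is_dvec_comb J g HJ Hg); auto].
2:{ apply @is_derive_minus; [apply @is_derive_plus; [exact K2|]|].
    - apply is_derive_Rmult; [apply is_derive_scal|]; exact K0.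
    - apply is_derive_scal; exact K0. }
2:{ apply is_derive_Ropp; exact K1. }
2:{ apply (is_derive_minus (V := R_NormedModule)); [exact K0 | apply is_derive_const]. }
unfold comb, wave, minus, plus, opp, zero; simpl; vec_expand.
set (k := curvature_nat g) in *. 
apply vec_eq; vec_expand; field.
Qed.

Lemma smooth1_wave (J : R -> Prop) (g : R -> vec) (lam : R) :
  open1 J -> natural_null J g -> smooth1 J (wave lam g).
Proof.
intros HJ Hg; pose proof (smooth1_curvature J g HJ Hg) as Hk.
unfold wave; apply smooth1_plus; auto; [apply smooth1_plus; auto|].
- now apply smooth1_Derive_n.
- apply smooth1_mult; auto using smooth1_Derive; apply smooth1_mult; auto using smooth1_const.
- apply smooth1_opp; auto; apply smooth1_mult; auto using smooth1_const, smooth1_Derive.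
Qed.


(** * Smooth families of curves *)

Definition vsmooth2 (U : R -> R -> Prop) (V : R -> R -> vec) : Prop :=
  smooth2 U (fun x y => pr1 (V x y)) /\
  smooth2 U (fun x y => pr2 (V x y)) /\
  smooth2 U (fun x y => pr3 (V x y)).

Definition vD1 (V : R -> R -> vec) (x y : R) : vec := dvec (fun u => V u y) x.
Definition vD2 (V : R -> R -> vec) (x y : R) : vec := dvec (fun u => V x u) y.

Lemma vsmooth2_iff (U : R -> R -> Prop) (V : R -> R -> vec) :
  smooth2_on U V <-> vsmooth2 U V.
Proof.
split.
- intros H; split; [|split]; intros n x y Hxy; apply (H n x y Hxy).
- intros (H1 & H2 & H3) n x y Hxy; split; [|split]; [apply H1 | apply H2 | apply H3]; auto.
Qed.

Lemma vsmooth2_vD1 (U : R -> R -> Prop) (V : R -> R -> vec) :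
  vsmooth2 U V -> vsmooth2 U (vD1 V).
Proof.
intros (H1 & H2 & H3); split; [|split];
[ exact (smooth2_D1 U _ H1) | exact (smooth2_D1 U _ H2) | exact (smooth2_D1 U _ H3)].
Qed.

Lemma vsmooth2_vD2 (U : R -> R -> Prop) (V : R -> R -> vec) :
  vsmooth2 U V -> vsmooth2 U (vD2 V).
Proof.
intros (H1 & H2 & H3); split; [|split];
[ exact (smooth2_D2 U _ H1) | exact (smooth2_D2 U _ H2) | exact (smooth2_D2 U _ H3)].
Qed.

Lemma is_dvec_vD1 (U : R -> R -> Prop) (V : R -> R -> vec) (x y : R) :
  vsmooth2 U V -> U x y -> is_dvec (fun u => V u y) x (vD1 V x y).
Proof.
intros (H1 & H2 & H3) Hxy; split; [|split]; apply Derive_correct;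
[ exact (smooth2_ex1 U _ x y H1 Hxy) | exact (smooth2_ex1 U _ x y H2 Hxy)
| exact (smooth2_ex1 U _ x y H3 Hxy)].
Qed.

Lemma is_dvec_vD2 (U : R -> R -> Prop) (V : R -> R -> vec) (x y : R) :
  vsmooth2 U V -> U x y -> is_dvec (V x) y (vD2 V x y).
Proof.
intros (H1 & H2 & H3) Hxy; split; [|split]; apply Derive_correct;
[ exact (smooth2_ex2 U _ x y H1 Hxy) | exact (smooth2_ex2 U _ x y H2 Hxy)
| exact (smooth2_ex2 U _ x y H3 Hxy)].
Qed.

Lemma vD1_vD2 (U : R -> R -> Prop) (V : R -> R -> vec) (x y : R) :
  open2 U -> vsmooth2 U V -> U x y -> vD1 (vD2 V) x y = vD2 (vD1 V) x y.
Proof.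
intros HU (H1 & H2 & H3) Hxy; apply vec_eq;
[ exact (smooth2_D1_D2 U _ x y HU H1 Hxy) | exact (smooth2_D1_D2 U _ x y HU H2 Hxy)
| exact (smooth2_D1_D2 U _ x y HU H3 Hxy)].
Qed.

Lemma smooth2_inner (U : R -> R -> Prop) (V W : R -> R -> vec) :
  open2 U -> vsmooth2 U V -> vsmooth2 U W -> smooth2 U (fun x y => inner (V x y) (W x y)).
Proof.
intros HU (H1 & H2 & H3) (K1 & K2 & K3); unfold inner.
apply smooth2_plus; auto; [apply smooth2_opp; auto; apply smooth2_plus; auto|];
  apply smooth2_mult; auto.
Qed.

Lemma vsmooth2_scal (U : R -> R -> Prop) (f : R -> R -> R) (V : R -> R -> vec) :
  open2 U -> smooth2 U f -> vsmooth2 U V -> vsmooth2 U (fun x y => vscal (f x y) (V x y)).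
Proof. intros HU Hf (H1 & H2 & H3); split; [|split]; now apply smooth2_mult. Qed.

Lemma vsmooth2_add (U : R -> R -> Prop) (V W : R -> R -> vec) :
  open2 U -> vsmooth2 U V -> vsmooth2 U W -> vsmooth2 U (fun x y => vadd (V x y) (W x y)).
Proof. intros HU (H1 & H2 & H3) (K1 & K2 & K3); split; [|split]; now apply smooth2_plus. Qed.

Lemma vsmooth2_slice (U : R -> R -> Prop) (V : R -> R -> vec) (x : R) :
  vsmooth2 U V -> smooth_on (U x) (V x).
Proof.
intros (H1 & H2 & H3) n s Hs; split; [|split];
[ exact (smooth2_slice U _ x H1 n s Hs) | exact (smooth2_slice U _ x H2 n s Hs)
| exact (smooth2_slice U _ x H3 n s Hs)].
Qed.

Lemma smooth2_slice_continuous (U : R -> R -> Prop) (f : R -> R -> R) (x y : R) :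
  smooth2 U f -> U x y -> continuous (f x) y.
Proof.
intros Hf Hxy; apply (ex_derive_continuous (V := R_NormedModule)).
exact (smooth2_ex2 U f x y Hf Hxy).
Qed.

(** Orthogonal complements of null lines are positive semidefinite, with the
    null line as radical. *)
Lemma normsq_pos_of_wedge (x y : vec) :
  normsq x = 0 -> inner x y = 0 -> wedge x y <> vzero -> 0 < normsq y.
Proof.
intros Hx Hxy Hw; destruct (Rlt_dec 0 (normsq y)) as [|Hn]; [assumption|exfalso].
assert (Hz : forall c m, m * m = c * c * normsq y -> m = 0) by (intros; nra).
apply Hw, vec_eq; [apply (Hz (pr3 x)) | apply (Hz (pr2 x)) | apply (Hz (pr1 x))].
- transitivity (pr3 x * pr3 x * normsq y + pr3 y * pr3 y * normsq x
    - 2 * pr3 x * pr3 y * inner x y).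
  + unfold normsq, inner, wedge, pr1, pr2, pr3; simpl; ring.
  + rewrite Hx, Hxy; ring.
- transitivity (pr2 x * pr2 x * normsq y + 2 * pr1 y * pr3 y * normsq x
    + inner x y * inner x y - 2 * pr2 x * pr2 y * inner x y).
  + unfold normsq, inner, wedge, pr1, pr2, pr3; simpl; ring.
  + rewrite Hx, Hxy; ring.
- transitivity (pr1 x * pr1 x * normsq y + pr1 y * pr1 y * normsq x
    - 2 * pr1 x * pr1 y * inner x y).
  + unfold normsq, inner, wedge, pr1, pr2, pr3; simpl; ring.
  + rewrite Hx, Hxy; ring.
Qed.

Lemma normsq_dvec2_pos (J : R -> Prop) (g : R -> vec) (s : R) :
  open1 J -> null_curve J g -> flex_free J g -> J s -> 0 < normsq (dvec_n 2 g s).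
Proof.
intros HJ [Hsm Hnull] Hflex Hs.
apply (normsq_pos_of_wedge (dvec_n 1 g s)).
- apply (Hnull s Hs).
- assert (H : inner (dvec_n 2 g s) (dvec_n 1 g s) + inner (dvec_n 1 g s) (dvec_n 2 g s) = 0).
  { apply (derive_of_const J (fun u => inner (dvec_n 1 g u) (dvec_n 1 g u)) 0 s); auto.
    - intros u Hu; apply (Hnull u Hu).
    - apply is_derive_inner; apply (is_dvec_n J); auto. }
  rewrite (inner_sym (dvec_n 2 g s)) in H; lra.
- now apply Hflex.
Qed.

(** * The first variation of the action *)

Section FirstVariation.

Context (J : R -> Prop) (g : R -> vec) (HJ : open1 J) (Hg : natural_null J g)
  (delta : posreal) (V : R -> R -> vec).

Let U (e t : R) : Prop := Rabs e < delta /\ J t.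

Context (HV : vsmooth2 U V)
  (Hnull : forall e, Rabs e < delta -> null_curve J (V e) /\ flex_free J (V e))
  (HV0 : forall t, J t -> V 0 t = g t).

Let w (e t : R) : R := omega (V e) t.
Let X (t : R) : vec := vD1 V 0 t.
Let k : R -> R := curvature_nat g.
Let sigma (t : R) : R := 1/2 * inner (dvec_n 2 g t) (dvec_n 2 X t).

Lemma variation_open : open2 U.
Proof.
intros e t [He Ht]; destruct (HJ t Ht) as [d Hd].
assert (Hp : 0 < Rmin d (delta - Rabs e)) by (apply Rmin_pos; [apply cond_pos | lra]).
exists (mkposreal _ Hp); simpl; intros u v Hu Hv; split.
- pose proof (Rmin_r d (delta - Rabs e)).
  replace u with ((u - e) + e) by ring.
  pose proof (Rabs_triang (u - e) e); lra.
- apply Hd; pose proof (Rmin_l d (delta - Rabs e)).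
  change (Rabs (v - t) < d); lra.
Qed.

Let HU : open2 U := variation_open.

Lemma variation_zero (t : R) : J t -> U 0 t.
Proof. intros Ht; split; auto; rewrite Rabs_R0; apply cond_pos. Qed.

Lemma variation_normsq_pos (e t : R) : U e t -> 0 < normsq (dvec_n 2 (V e) t).
Proof.
intros [He Ht]; destruct (Hnull e He) as [H1 H2].
now apply (normsq_dvec2_pos J).
Qed.

Lemma variation_omega_pos (e t : R) : U e t -> 0 < w e t.
Proof.
intros H; unfold w, omega, mnorm.
now apply sqrt_lt_R0, sqrt_lt_R0, variation_normsq_pos.
Qed.

Lemma variation_omega_smooth : smooth2 U w.
Proof.
unfold w, omega, mnorm; apply smooth2_sqrt; auto.
- intros e t H; now apply sqrt_lt_R0, variation_normsq_pos.
- apply smooth2_sqrt; auto.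
  + intros e t H; now apply variation_normsq_pos.
  + apply (smooth2_inner U (vD2 (vD2 V)) (vD2 (vD2 V))); auto;
      now repeat apply vsmooth2_vD2.
Qed.

Lemma variation_dvec_n (n : nat) (t : R) : J t -> dvec_n n (V 0) t = dvec_n n g t.
Proof.
intros Ht; unfold dvec_n; f_equal; [f_equal|]; apply Derive_n_ext_loc;
  generalize (HJ t Ht); apply filter_imp; intros u Hu; now rewrite HV0.
Qed.

Lemma variation_omega_zero (t : R) : J t -> w 0 t = 1.
Proof.
intros Ht; unfold w, omega; rewrite variation_dvec_n by auto.
destruct Hg as (_ & _ & Hn); exact (Hn t Ht).
Qed.

Lemma variation_field_smooth : smooth_on J X.
Proof.
intros n t Ht.
apply (vsmooth2_slice U (vD1 V) 0 (vsmooth2_vD1 U V HV) n t).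
now apply variation_zero.
Qed.

Lemma is_dvec_field (n : nat) (t : R) : J t -> is_dvec (dvec_n n X) t (dvec_n (S n) X t).
Proof. intros Ht; apply (is_dvec_n J); auto using variation_field_smooth. Qed.

Lemma vD1_vD2_field (t : R) : J t -> vD1 (vD2 V) 0 t = dvec_n 1 X t.
Proof. intros Ht; apply (vD1_vD2 U); auto using variation_zero. Qed.

Lemma vD1_vD2_vD2_field (t : R) : J t -> vD1 (vD2 (vD2 V)) 0 t = dvec_n 2 X t.
Proof.
intros Ht; rewrite (vD1_vD2 U) by auto using variation_zero, vsmooth2_vD2.
unfold vD2 at 1; apply is_dvec_unique.
eapply is_dvec_ext_loc; [|apply (is_dvec_field 1 t Ht)].
generalize (HJ t Ht); apply filter_imp; intros u Hu; now rewrite vD1_vD2_field.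
Qed.

Lemma is_derive_omega (t : R) : J t -> is_derive (fun e => w e t) 0 (sigma t).
Proof.
intros Ht.
assert (Hn : is_derive (fun e => normsq (dvec_n 2 (V e) t)) 0 (4 * sigma t)).
{ assert (HX : is_dvec (fun e => dvec_n 2 (V e) t) 0 (dvec_n 2 X t)).
  { rewrite <- vD1_vD2_vD2_field by auto.
    apply (is_dvec_vD1 U (vD2 (vD2 V))); auto using variation_zero, vsmooth2_vD2. }
  eapply is_derive_eq; [|apply is_derive_inner; exact HX].
  unfold sigma; rewrite variation_dvec_n, (inner_sym (dvec_n 2 X t)) by auto; field. }
assert (H1 : normsq (dvec_n 2 (V 0) t) = 1).
{ rewrite variation_dvec_n by auto; now apply (gram_nn J). }
unfold w, omega, mnorm.
eapply is_derive_eq; [|apply is_derive_sqrt; [apply is_derive_sqrt; [exact Hn|]|]];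
  cbv beta; rewrite ?H1, ?sqrt_1; lra.
Qed.

(** Differentiation by arc length does not commute with the variation: the
    factor [/ omega] is one at the base curve and varies by [- sigma]. Iterating
    this step three times gives the variation of the curvature. *)
Lemma is_dvec_dnat (A : R -> R -> vec) (P B P' B' : R -> vec) :
  vsmooth2 U A ->
  (forall t, J t -> A 0 t = P t) -> (forall t, J t -> vD1 A 0 t = B t) ->
  (forall t, J t -> is_dvec P t (P' t)) -> (forall t, J t -> is_dvec B t (B' t)) ->
  let A' := fun e => dnat (V e) (A e) in
  vsmooth2 U A' /\ (forall t, J t -> A' 0 t = P' t) /\
  (forall t, J t -> vD1 A' 0 t = vadd (B' t) (vscal (- sigma t) (P' t))).
Proof.
intros HA HP HB HP' HB'.
assert (H0 : forall t, J t -> vD2 A 0 t = P' t).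
{ intros t Ht; apply is_dvec_unique; eapply is_dvec_ext_loc; [|now apply HP'].
  generalize (HJ t Ht); apply filter_imp; intros u Hu; now rewrite HP. }
split; [|split].
- apply (vsmooth2_scal U (fun e t => / w e t) (vD2 A)); auto using vsmooth2_vD2.
  apply smooth2_inv; auto using variation_omega_smooth.
  intros e t H; apply Rgt_not_eq; now apply variation_omega_pos.
- intros t Ht; change (vscal (/ w 0 t) (vD2 A 0 t) = P' t).
  rewrite variation_omega_zero, H0, Rinv_1 by auto; vec_ring.
- intros t Ht; apply is_dvec_unique.
  eapply is_dvec_eq; [|apply (is_dvec_scal (fun e => / w e t) (fun e => vD2 A e t) 0);
    [apply (is_derive_inv (fun e => w e t)); [now apply is_derive_omega|]
    |apply (is_dvec_vD1 U); auto using variation_zero, vsmooth2_vD2]].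
  + rewrite variation_omega_zero by auto; rewrite H0 by auto.
    rewrite (vD1_vD2 U) by auto using variation_zero.
    assert (E : vD2 (vD1 A) 0 t = B' t).
    { apply is_dvec_unique; eapply is_dvec_ext_loc; [|now apply HB'].
      generalize (HJ t Ht); apply filter_imp; intros u Hu; now rewrite HB. }
    rewrite E; apply vec_eq; vec_expand; field.
  + apply Rgt_not_eq, variation_omega_pos; now apply variation_zero.
Qed.

Lemma smooth1_sigma : smooth1 J sigma.
Proof.
destruct (smooth_on_dvec_n J g 2 (proj1 (proj1 Hg))) as (N1 & N2 & N3).
destruct (smooth_on_dvec_n J X 2 variation_field_smooth) as (X1 & X2 & X3).
apply smooth1_mult; auto using smooth1_const; apply smooth1_inner; auto.
Qed.

Lemma is_derive_sigma (n : nat) (t : R) :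
  J t -> is_derive (Derive_n sigma n) t (Derive_n sigma (S n) t).
Proof.
intros Ht; apply Derive_correct, (smooth1_ex J); auto.
apply smooth1_Derive_n, smooth1_sigma.
Qed.

Definition natural_third (e t : R) : vec := dnat (V e) (dnat (V e) (dnat (V e) (V e))) t.

Lemma variation_third :
  vsmooth2 U natural_third /\ (forall t, J t -> natural_third 0 t = dvec_n 3 g t) /\
  (forall t, J t -> vD1 natural_third 0 t =
    vadd (vadd (dvec_n 3 X t) (vscal (- 3 * sigma t) (dvec_n 3 g t)))
         (vadd (vscal (- Derive_n sigma 2 t) (dvec_n 1 g t))
               (vscal (- 3 * Derive_n sigma 1 t) (dvec_n 2 g t)))).
Proof.
assert (Hgd : forall n t, J t -> is_dvec (dvec_n n g) t (dvec_n (S n) g t)).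
{ intros n t Ht; apply (is_dvec_n J); auto; apply Hg. }
assert (Hsc : forall m n t, J t ->
  is_dvec (fun u => vscal (- Derive_n sigma m u) (dvec_n n g u)) t
    (vadd (vscal (- Derive_n sigma (S m) t) (dvec_n n g t))
          (vscal (- Derive_n sigma m t) (dvec_n (S n) g t)))).
{ intros m n t Ht; apply (is_dvec_scal (fun u => - Derive_n sigma m u)); auto.
  now apply is_derive_Ropp, is_derive_sigma. }
set (S1 := fun t => vadd (dvec_n 1 X t) (vscal (- sigma t) (dvec_n 1 g t))).
set (S1' := fun t => vadd (dvec_n 2 X t)
  (vadd (vscal (- Derive_n sigma 1 t) (dvec_n 1 g t)) (vscal (- sigma t) (dvec_n 2 g t)))).
destruct (is_dvec_dnat V g X (dvec_n 1 g) (dvec_n 1 X)) as (A1 & A2 & A3); auto.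
{ intros t Ht; exact (Hgd 0%nat t Ht). }
{ intros t Ht; exact (is_dvec_field 0 t Ht). }
destruct (is_dvec_dnat (fun e => dnat (V e) (V e)) (dvec_n 1 g) S1 (dvec_n 2 g) S1')
  as (B1 & B2 & B3); auto.
{ intros t Ht; apply is_dvec_add; [now apply is_dvec_field | now apply (Hsc 0%nat)]. }
set (S2 := fun t => vadd (S1' t) (vscal (- sigma t) (dvec_n 2 g t))).
set (S2' := fun t => vadd
  (vadd (dvec_n 3 X t)
    (vadd (vadd (vscal (- Derive_n sigma 2 t) (dvec_n 1 g t))
                (vscal (- Derive_n sigma 1 t) (dvec_n 2 g t)))
          (vadd (vscal (- Derive_n sigma 1 t) (dvec_n 2 g t))
                (vscal (- sigma t) (dvec_n 3 g t)))))
  (vadd (vscal (- Derive_n sigma 1 t) (dvec_n 2 g t)) (vscal (- sigma t) (dvec_n 3 g t)))).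
destruct (is_dvec_dnat (fun e => dnat (V e) (dnat (V e) (V e))) (dvec_n 2 g) S2 (dvec_n 3 g) S2')
  as (C1 & C2 & C3); auto.
{ intros t Ht; apply is_dvec_add; [apply is_dvec_add; [now apply is_dvec_field|];
    apply is_dvec_add; [now apply (Hsc 1%nat) | now apply (Hsc 0%nat)] | now apply (Hsc 0%nat)]. }
split; [exact C1|]; split; [exact C2|].
intros t Ht; etransitivity; [exact (C3 t Ht)|]; unfold S2'; vec_ring.
Qed.

Definition action_density (lam e t : R) : R := (2 * curvature (V e) t + lam) * omega (V e) t.

Lemma density_smooth (lam : R) : smooth2 U (action_density lam).
Proof.
destruct variation_third as (H & _ & _).
apply smooth2_mult; auto using variation_omega_smooth.
apply smooth2_plus; auto using smooth2_const.
apply smooth2_mult; auto using smooth2_const.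
apply (smooth2_mult U (fun _ _ => 1/4) (fun e t => inner (natural_third e t) (natural_third e t)));
  auto using smooth2_const, smooth2_inner.
Qed.

Lemma density_variation (lam t : R) :
  J t -> D1 (action_density lam) 0 t =
    inner (dvec_n 3 g t) (dvec_n 3 X t) + Derive_n sigma 2 t + (lam - 10 * k t) * sigma t.
Proof.
intros Ht; destruct variation_third as (H1 & H2 & H3).
assert (Hd : is_dvec (fun e => natural_third e t) 0 (vD1 natural_third 0 t)).
{ apply (is_dvec_vD1 U); auto using variation_zero. }
apply is_derive_unique.
eapply is_derive_eq; [|apply (is_derive_Rmult (fun e => 2 * (1/4 * inner (natural_third e t) (natural_third e t)) + lam));
  [apply is_derive_Rplus; [apply is_derive_scal, is_derive_scal, is_derive_inner; exact Hd | apply @is_derive_const]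
  | now apply is_derive_omega]].
cbv beta; change (omega (V 0) t) with (w 0 t).
rewrite H2, H3, variation_omega_zero by auto.
rewrite !inner_vadd_l, !inner_vadd_r, !inner_vscal_l, !inner_vscal_r.
rewrite (inner_sym (dvec_n 3 X t)), (inner_sym (dvec_n 3 g t) (dvec_n 1 g t)),
  (inner_sym (dvec_n 3 g t) (dvec_n 2 g t)).
rewrite (gram_tu J g HJ Hg), (gram_nu J g HJ Hg), gram_uu by auto.
change (@zero R_NormedModule) with 0; fold k; field.
Qed.

Lemma variation_field_orthogonal (t : R) : J t -> inner (dvec_n 1 g t) (dvec_n 1 X t) = 0.
Proof.
intros Ht.
assert (H : inner (dvec_n 1 X t) (vD2 V 0 t) + inner (vD2 V 0 t) (dvec_n 1 X t) = 0).
{ apply (derive_of_const (fun e => Rabs e < delta) (fun e => inner (vD2 V e t) (vD2 V e t)) 0 0).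
  - intros e He; destruct (variation_open e t (conj He Ht)) as [d Hd].
    exists d; intros u Hu; apply (Hd u t Hu).
    rewrite Rminus_diag, Rabs_R0; apply cond_pos.
  - rewrite Rabs_R0; apply cond_pos.
  - intros e He; destruct (Hnull e He) as [[_ H] _]; exact (proj2 (H t Ht)).
  - rewrite <- vD1_vD2_field by auto.
    apply (is_derive_inner (fun e => vD2 V e t) (fun e => vD2 V e t) 0);
      apply (is_dvec_vD1 U (vD2 V)); auto using variation_zero, vsmooth2_vD2. }
assert (E : vD2 V 0 t = dvec_n 1 g t) by (exact (variation_dvec_n 1 t Ht)).
rewrite E, (inner_sym (dvec_n 1 X t)) in H; lra.
Qed.

(** What is integrated out when the derivatives are moved off the variation
    field. The momentum pairs with [X] itself because, modulo the tangent, it is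
    the coefficient of [X'] that remains. *)
Definition boundary_term (lam t : R) : R :=
  inner (momentum lam g t) (X t) + inner (dvec_n 3 g t) (dvec_n 2 X t)
  - inner (dvec_n 4 g t) (dvec_n 1 X t) + Derive_n sigma 1 t
  + (1/2 * lam - 5 * k t) * inner (dvec_n 2 g t) (dvec_n 1 X t).

Lemma is_dvec_dvec_n4 (t : R) : J t ->
  is_dvec (dvec_n 4 g) t (comb (frenet_t g t) (frenet_n g t) (frenet_b g t)
    (- 2 * Derive_n k 2 t + 8 * k t * k t) (- 6 * Derive k t) (- 4 * k t)).
Proof.
intros Ht.
eapply (is_dvec_ext_loc (fun u => comb (frenet_t g u) (frenet_n g u) (frenet_b g u)
  (- 2 * Derive k u) (- 4 * k u) 0)).
{ generalize (HJ t Ht); apply filter_imp; intros u Hu; symmetry; now apply (dvec_n4_frenet J). }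
eapply is_dvec_eq; [|apply (is_dvec_comb J g HJ Hg); auto;
  [apply is_derive_scal, (is_derive_curvature J g HJ Hg 1 t Ht)
  |apply is_derive_scal, (is_derive_curvature J g HJ Hg 0 t Ht)
  |apply @is_derive_const]].
change (@zero R_NormedModule) with 0; fold k.
change (Derive_n k 1 t) with (Derive k t); unfold comb; vec_ring.
Qed.

(** The products of [X'] with [n] and [b] cancel against the momentum, and the
    product with [t] vanishes since the varied curves are null. *)
Lemma is_derive_boundary (lam t : R) : J t ->
  is_derive (boundary_term lam) t
    (D1 (action_density lam) 0 t + wave lam g t * inner (frenet_t g t) (X t)).
Proof.
intros Ht.
pose proof (is_dvec_field 0 t Ht) as X0.
pose proof (is_dvec_field 1 t Ht) as X1.
pose proof (is_dvec_field 2 t Ht) as X2.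
assert (Hgd : forall n, is_dvec (dvec_n n g) t (dvec_n (S n) g t)).
{ intros n; apply (is_dvec_n J); auto; apply Hg. }
unfold boundary_term.
eapply is_derive_eq; [|apply is_derive_Rplus; [apply is_derive_Rplus; [apply (is_derive_minus (V := R_NormedModule)); [apply is_derive_Rplus|]|]|]].
2:{ apply is_derive_inner; [now apply (is_dvec_momentum J) | exact X0]. }
2:{ apply is_derive_inner; [apply Hgd | exact X2]. }
2:{ apply is_derive_inner; [now apply is_dvec_dvec_n4 | exact X1]. }
2:{ now apply is_derive_sigma. }
2:{ apply is_derive_Rmult; [|apply is_derive_inner; [apply Hgd | exact X1]].
    apply (is_derive_minus (V := R_NormedModule)); [apply @is_derive_const|].
    apply is_derive_scal, (is_derive_curvature J g HJ Hg 0 t Ht). }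
rewrite density_variation by auto.
pose proof (variation_field_orthogonal t Ht) as Ho.
fold k; change (Derive_n k 1 t) with (Derive k t).
change (minus ?x ?y) with (x - y); change (@zero R_NormedModule) with 0.
unfold momentum; fold k; rewrite (dvec_n4_frenet J g HJ Hg t Ht); fold k.
change (sigma t) with (1/2 * inner (dvec_n 2 g t) (dvec_n 2 X t)).
rewrite (dvec_n3_frenet g t); fold k.
unfold comb; rewrite !inner_vadd_l, !inner_vscal_l.
unfold frenet_t, frenet_n in *; rewrite Ho.
change (dvec_n 0 X t) with (X t).
field.
Qed.

End FirstVariation.

Lemma compact_complement_locally (K : R -> Prop) (x : R) :
  compact K -> ~ K x -> locally x (fun u => ~ K u).
Proof.
intros HK Hx; destruct (compact_P2 K HK x Hx) as [d Hd].
exists d; intros u Hu; apply (Hd u); exact Hu.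
Qed.

Lemma dvec_n_locally_zero (X : R -> vec) (n : nat) (x : R) :
  locally x (fun u => X u = vzero) -> dvec_n n X x = vzero.
Proof.
intros H.
assert (H0 : forall f : R -> R, locally x (fun u => f u = 0) -> Derive_n f n x = 0).
{ intros f Hf; rewrite (Derive_n_ext_loc f (fun _ => 0) n x Hf).
  destruct n; [reflexivity | now rewrite Derive_n_const]. }
apply vec_eq; apply H0; revert H; apply filter_imp; now intros u ->.
Qed.

Lemma inner_zero_r (x : vec) : inner x vzero = 0.
Proof. vec_ring. Qed.

Lemma boundary_zero (J : R -> Prop) (g : R -> vec) (V : R -> R -> vec)
    (delta : posreal) (K : R -> Prop) (lam t : R) :
  open1 J -> (forall u, J u -> V 0 u = g u) -> compact K ->
  (forall e u, Rabs e < delta -> J u -> ~ K u -> V e u = g u) ->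
  J t -> ~ K t -> boundary_term g V lam t = 0.
Proof.
intros HJ HV0 HK Hout Ht HKt.
assert (HX : locally t (fun u => vD1 V 0 u = vzero)).
{ generalize (filter_and _ _ (HJ t Ht) (compact_complement_locally K t HK HKt)).
  apply filter_imp; intros u [Hu HKu].
  apply is_dvec_unique; eapply is_dvec_ext_loc; [|apply (is_dvec_const (g u))].
  exists delta; intros e He; symmetry; apply Hout; auto.
  rewrite <- (Rminus_0_r e); exact He. }
unfold boundary_term.
assert (Hs : Derive_n (fun t => 1/2 * inner (dvec_n 2 g t) (dvec_n 2 (fun t => vD1 V 0 t) t)) 1 t = 0).
{ simpl; rewrite (Derive_ext_loc _ (fun _ => 0)); [apply Derive_const|].
  generalize (locally_locally _ _ HX).
  apply filter_imp; intros u Hu; rewrite (dvec_n_locally_zero (fun t => vD1 V 0 t) 2 u Hu), inner_zero_r; ring. }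
rewrite Hs, (dvec_n_locally_zero (fun t => vD1 V 0 t) 1 t HX), (dvec_n_locally_zero (fun t => vD1 V 0 t) 2 t HX).
rewrite (locally_singleton _ _ HX), !inner_zero_r; ring.
Qed.

(** The boundary term vanishes at both ends because they lie off the compact
    set that carries the variation. *)
Theorem first_variation (J : R -> Prop) (g : R -> vec) (lam : R)
    (V : R -> R -> vec) (K : R -> Prop) (c d : R) :
  open1 J -> natural_null J g -> admissible_variation J g V K ->
  c < d -> (forall t, c <= t <= d -> J t) -> (forall t, K t -> c < t < d) ->
  is_derive (fun eps => action lam (V eps) c d) 0
    (- RInt (fun t => wave lam g t * inner (frenet_t g t) (vD1 V 0 t)) c d).
Proof.
intros HJ Hg (delta & HV & Hnull & HV0 & HK & HKJ & Hout) Hcd HcdJ HKcd.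
apply vsmooth2_iff in HV.
set (U := fun e t : R => Rabs e < delta /\ J t) in *.
pose proof (density_smooth J g HJ Hg delta V HV Hnull HV0 lam) as HF; fold U in HF.
pose proof (variation_open J HJ delta) as HU; fold U in HU.
assert (H0 : forall t, J t -> U 0 t) by (intros; now apply variation_zero).
assert (HcdJ' : forall t, Rmin c d <= t <= Rmax c d -> J t).
{ intros t Ht; rewrite Rmin_left, Rmax_right in Ht by lra; auto. }
assert (HXs : smooth1 J (fun t => wave lam g t * inner (frenet_t g t) (vD1 V 0 t))).
{ apply smooth1_mult; auto; [now apply smooth1_wave|].
  destruct (smooth_on_dvec_n J g 1 (proj1 (proj1 Hg))) as (T1 & T2 & T3).
  destruct (smooth_on_dvec_n J (fun t => vD1 V 0 t) 0) as (X1 & X2 & X3).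
  { exact (variation_field_smooth J delta V HV). }
  now apply smooth1_inner. }
assert (Hint : is_RInt (fun t => D1 (action_density V lam) 0 t
    + wave lam g t * inner (frenet_t g t) (vD1 V 0 t)) c d
    (boundary_term g V lam d - boundary_term g V lam c)).
{ apply (is_RInt_derive (boundary_term g V lam)).
  - intros t Ht; apply (is_derive_boundary J g HJ Hg delta V HV Hnull HV0); auto.
  - intros t Ht; apply (continuous_plus (V := R_NormedModule)).
    + apply (smooth2_slice_continuous U (D1 (action_density V lam))); auto using smooth2_D1.
    + apply (smooth1_continuous J); auto. }
assert (HI : ex_RInt (fun t => wave lam g t * inner (frenet_t g t) (vD1 V 0 t)) c d).
{ apply (ex_RInt_continuous (V := R_CompleteNormedModule)); intros t Ht; apply (smooth1_continuous J); auto. }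
assert (HD : ex_RInt (fun t => D1 (action_density V lam) 0 t) c d).
{ apply (ex_RInt_continuous (V := R_CompleteNormedModule)); intros t Ht.
  apply (smooth2_slice_continuous U (D1 (action_density V lam))); auto using smooth2_D1. }
rewrite !(boundary_zero J g V delta K lam) in Hint; auto;
  try (apply HcdJ; lra);
  try (intros HKx; apply HKcd in HKx; lra).
apply (is_RInt_unique (V := R_CompleteNormedModule)) in Hint.
rewrite (RInt_plus (V := R_CompleteNormedModule)) in Hint by auto.
eapply is_derive_eq; [|apply (is_derive_RInt_param (action_density V lam) c d 0)].
- unfold plus in Hint; simpl in Hint. unfold D1 in Hint. lra.
- assert (Hl : locally 0 (fun e => Rabs e < delta)).
  { exists delta; intros e He; rewrite <- (Rminus_0_r e); exact He. }
  revert Hl; apply filter_imp; intros e He t Ht.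
  apply (smooth2_ex1 U _ e t HF); split; auto.
- intros t Ht; apply (smooth2_cont U (D1 (action_density V lam))); auto using smooth2_D1.
- assert (Hl : locally 0 (fun e => Rabs e < delta)).
  { exists delta; intros e He; rewrite <- (Rminus_0_r e); exact He. }
  revert Hl; apply filter_imp; intros e He.
  apply (ex_RInt_continuous (V := R_CompleteNormedModule)); intros t Ht.
  apply (smooth2_slice_continuous U (action_density V lam)); auto; split; auto.
Qed.

Lemma wave_zero_critical (J : R -> Prop) (g : R -> vec) (lam : R) :
  open1 J -> natural_null J g -> (forall t, J t -> wave lam g t = 0) ->
  critical_point lam J g.
Proof.
intros HJ Hg Hw V K HV c d Hcd HcdJ HKcd.
eapply is_derive_eq; [|now apply (first_variation J g lam V K)].
rewrite (RInt_ext _ (fun _ => 0)).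
- rewrite RInt_const; unfold scal; simpl; unfold mult; simpl; ring.
- intros t Ht; rewrite Rmin_left, Rmax_right in Ht by lra.
  rewrite Hw by (apply HcdJ; lra); apply Rmult_0_l.
Qed.

(** * Compactly supported variations *)

(** The derivatives of [exp (- / x)] on the positive axis are combinations of
    these functions; carrying the whole family makes the induction for
    smoothness go through. *)
Definition flat (k : nat) (x : R) : R :=
  if Rle_dec x 0 then 0 else (/ x) ^ k * exp (- / x).

Lemma flat_nonpos (k : nat) (x : R) : x <= 0 -> flat k x = 0.
Proof. intros H; unfold flat; destruct (Rle_dec x 0); [reflexivity | lra]. Qed.

Lemma flat_pos_eq (k : nat) (x : R) : 0 < x -> flat k x = (/ x) ^ k * exp (- / x).
Proof. intros H; unfold flat; destruct (Rle_dec x 0); [lra | reflexivity]. Qed.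

Lemma flat_pos (k : nat) (x : R) : 0 < x -> 0 < flat k x.
Proof.
intros H; rewrite flat_pos_eq by auto; apply Rmult_lt_0_compat; [|apply exp_pos].
now apply pow_lt, Rinv_0_lt_compat.
Qed.

Lemma pow_le_exp (n : nat) (y : R) : 0 <= y -> y ^ n <= INR n ^ n * exp y.
Proof.
intros Hy; destruct n as [|n]; [simpl; pose proof (exp_ineq1_le y); lra|].
set (m := INR (S n)).
assert (Hm : 0 < m) by (apply lt_0_INR; lia).
assert (E : y ^ S n = m ^ S n * (y / m) ^ S n).
{ rewrite <- Rpow_mult_distr; f_equal; field; lra. }
rewrite E; apply Rmult_le_compat_l; [now apply pow_le, Rlt_le|].
assert (E2 : exp y = exp (y / m) ^ S n).
{ assert (H : forall n z, exp (INR n * z) = exp z ^ n).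
  { intros k z; induction k as [|k IH].
    - simpl; rewrite Rmult_0_l; apply exp_0.
    - rewrite S_INR, Rmult_plus_distr_r, exp_plus, IH, Rmult_1_l; simpl; ring. }
  rewrite <- H; f_equal; fold m; field; lra. }
rewrite E2; apply pow_incr; split.
- apply Rdiv_le_0_compat; lra.
- pose proof (exp_ineq1_le (y / m)); lra.
Qed.

Lemma flat_le_sqr (k : nat) (x : R) :
  Rabs (flat k x) <= INR (k + 2) ^ (k + 2) * (x * x).
Proof.
assert (Hc : 0 <= INR (k + 2) ^ (k + 2)) by (apply pow_le, pos_INR).
destruct (Rle_dec x 0) as [Hx|Hx].
- rewrite flat_nonpos, Rabs_R0 by auto; nra.
- rewrite Rabs_pos_eq by (apply Rlt_le, flat_pos; lra).
  rewrite flat_pos_eq by lra.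
  assert (Hi : 0 < / x) by (apply Rinv_0_lt_compat; lra).
  pose proof (pow_le_exp (k + 2) (/ x) (Rlt_le _ _ Hi)) as H.
  assert (E : (/ x) ^ k = (/ x) ^ (k + 2) * (x * x)).
  { rewrite pow_add; simpl; field; lra. }
  rewrite E, exp_Ropp.
  pose proof (exp_pos (/ x)) as He.
  replace ((/ x) ^ (k + 2) * (x * x) * / exp (/ x))
    with ((/ x) ^ (k + 2) * / exp (/ x) * (x * x)) by ring.
  apply Rmult_le_compat_r; [nra|].
  apply (Rmult_le_reg_r (exp (/ x))); auto.
  rewrite Rmult_assoc, Rinv_l, Rmult_1_r by lra; exact H.
Qed.

Lemma is_derive_flat_at_zero (f : R -> R) (c : R) :
  (forall x, Rabs (f x) <= c * (x * x)) -> is_derive f 0 0.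
Proof.
intros H; apply is_derive_Reals; intros eps Heps.
assert (Hc : 0 <= c) by (specialize (H 1); pose proof (Rabs_pos (f 1)); lra).
assert (Hd : 0 < eps / (c + 1)) by (apply Rdiv_lt_0_compat; lra).
exists (mkposreal _ Hd); simpl; intros h Hh0 Hh.
assert (Hf0 : f 0 = 0).
{ specialize (H 0); rewrite !Rmult_0_r in H.
  pose proof (Rabs_pos (f 0)); apply Rabs_eq_0; lra. }
rewrite Rplus_0_l, Hf0, !Rminus_0_r; unfold Rdiv; rewrite Rabs_mult, Rabs_inv.
assert (Hh1 : 0 < Rabs h) by now apply Rabs_pos_lt.
apply (Rmult_lt_reg_r (Rabs h)); auto.
rewrite Rmult_assoc, Rinv_l, Rmult_1_r by lra.
eapply Rle_lt_trans; [apply H|].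
replace (h * h) with (Rabs h * Rabs h) by (rewrite <- Rabs_mult; apply Rabs_pos_eq; nra).
apply (Rmult_lt_compat_r (c + 1)) in Hh; [|lra].
unfold Rdiv in Hh; rewrite (Rmult_assoc eps), Rinv_l, Rmult_1_r in Hh by lra.
nra.
Qed.

Lemma is_derive_flat (k : nat) (x : R) :
  is_derive (flat k) x (flat (k + 2) x + - INR k * flat (k + 1) x).
Proof.
destruct (total_order_T x 0) as [[Hx|Hx]|Hx].
- rewrite !flat_nonpos by lra.
  apply (is_derive_ext_loc (fun _ => 0)).
  + generalize (open_lt 0 x Hx); apply filter_imp; intros u Hu.
    now rewrite flat_nonpos by lra.
  + eapply is_derive_eq; [|apply @is_derive_const]; change (@zero R_NormedModule) with 0; ring.
- subst x; rewrite !flat_nonpos by lra.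
  eapply is_derive_eq; [|exact (is_derive_flat_at_zero _ _ (flat_le_sqr k))]; ring.
- rewrite !flat_pos_eq by auto.
  apply (is_derive_ext_loc (fun u => (/ u) ^ k * exp (- / u))).
  + generalize (open_gt 0 x Hx); apply filter_imp; intros u Hu.
    now rewrite flat_pos_eq.
  + auto_derive; [repeat split; lra|].
    rewrite !pow_add; destruct k as [|k]; simpl; field; lra.
Qed.

Lemma smooth1_flat (J : R -> Prop) (k : nat) : open1 J -> smooth1 J (flat k).
Proof.
intros HJ; apply smooth1_strip; auto; intros n; revert k.
assert (HU := open2_strip J HJ).
assert (Hc : forall k x y, continuity_2d_pt (fun _ y => flat k y) x y).
{ intros k x y; apply (continuity_1d_2d_pt_comp (flat k) (fun _ y => y)).
  - apply continuity_pt_filterlim, (ex_derive_continuous (V := R_NormedModule)).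
    eexists; apply is_derive_flat.
  - apply continuity_2d_pt_id2. }
induction n as [|n IH]; intros k.
- intros x y _; split; auto.
- apply classC_S; auto.
  + intros; apply ex_derive_const.
  + intros x y _; eexists; apply is_derive_flat.
  + apply (classC_ext (strip J) n (fun _ _ => 0)); auto using classC_const.
    intros; unfold D1; now rewrite Derive_const.
  + apply (classC_ext (strip J) n (fun _ y => flat (k + 2) y + - INR k * flat (k + 1) y)); auto.
    * intros x y _; symmetry; apply is_derive_unique, is_derive_flat.
    * apply classC_plus; auto; apply classC_mult; auto using classC_const.
Qed.

Definition bump (p q x : R) : R := flat 0 (x - p) * flat 0 (q - x).

Lemma bump_zero (p q x : R) : x <= p \/ q <= x -> bump p q x = 0.
Proof. intros [H|H]; unfold bump; rewrite ?(flat_nonpos 0 (x - p)), ?(flat_nonpos 0 (q - x)) by lra; ring. Qed.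

Lemma bump_pos (p q x : R) : p < x < q -> 0 < bump p q x.
Proof. intros H; apply Rmult_lt_0_compat; apply flat_pos; lra. Qed.

Lemma smooth1_bump (J : R -> Prop) (p q : R) : open1 J -> smooth1 J (bump p q).
Proof.
intros HJ; apply smooth1_mult; auto; apply smooth1_strip; auto.
- apply (smooth2_ext _ (fun x y => flat 0 (0 * x + 1 * y + - p))); auto using open2_strip.
  + intros; f_equal; ring.
  + apply (smooth2_affine _ (fun _ => True)); auto using open2_strip.
    apply smooth1_flat; intros x _; apply filter_forall; auto.
- apply (smooth2_ext _ (fun x y => flat 0 (0 * x + (-1) * y + q))); auto using open2_strip.
  + intros; f_equal; ring.
  + apply (smooth2_affine _ (fun _ => True)); auto using open2_strip.
    apply smooth1_flat; intros x _; apply filter_forall; auto.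
Qed.

(** The variation field attached to a function [eta]. Its derivative is
    everywhere tangent to the curve, so that the straight-line variation
    [g + eps X] stays null: no correction is needed to satisfy the nonlinear
    constraint, and the support of [eta] is respected. *)
Definition tangential_field (g : R -> vec) (eta : R -> R) (s : R) : vec :=
  comb (frenet_t g s) (frenet_n g s) (frenet_b g s)
    (Derive_n eta 2 s + 2 * curvature_nat g s * eta s) (- Derive eta s) (eta s).

Definition stretch (g : R -> vec) (eta : R -> R) (s : R) : R :=
  Derive_n eta 3 s + 4 * curvature_nat g s * Derive eta s
  + 2 * Derive (curvature_nat g) s * eta s.

Section StraightVariation.

Context (J : R -> Prop) (g : R -> vec) (HJ : open1 J) (Hg : natural_null J g)
  (eta : R -> R) (Heta : smooth1 J eta).

Lemma is_dvec_tangential_field (s : R) :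
  J s -> is_dvec (tangential_field g eta) s (vscal (stretch g eta s) (frenet_t g s)).
Proof.
intros Hs.
assert (He : forall n, is_derive (Derive_n eta n) s (Derive_n eta (S n) s)).
{ intros n; apply Derive_correct, (smooth1_ex J); auto using smooth1_Derive_n. }
pose proof (is_derive_curvature J g HJ Hg 0 s Hs) as Hk.
eapply is_dvec_eq; [|apply (is_dvec_comb J g HJ Hg); auto;
  [apply is_derive_Rplus; [apply (He 2%nat)|apply is_derive_Rmult; [apply is_derive_scal, Hk | apply (He 0%nat)]]
  |apply is_derive_Ropp, (He 1%nat) | apply (He 0%nat)]].
change (Derive_n eta 0 s) with (eta s); change (Derive_n eta 1 s) with (Derive eta s).
change (Derive_n (curvature_nat g) 0 s) with (curvature_nat g s).
change (Derive_n (curvature_nat g) 1 s) with (Derive (curvature_nat g) s).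
unfold comb, stretch; vec_ring.
Qed.

Lemma smooth1_stretch : smooth1 J (stretch g eta).
Proof.
pose proof (smooth1_curvature J g HJ Hg) as Hk.
unfold stretch; apply smooth1_plus; auto; [apply smooth1_plus; auto|].
- now apply smooth1_Derive_n.
- apply smooth1_mult; auto using smooth1_Derive; apply smooth1_mult; auto using smooth1_const.
- apply smooth1_mult; auto; apply smooth1_mult; auto using smooth1_const, smooth1_Derive.
Qed.

Lemma smooth_on_tangential_field : smooth_on J (tangential_field g eta).
Proof.
pose proof (smooth1_curvature J g HJ Hg) as Hk.
destruct (smooth1_frenet J g HJ Hg (frenet_t g)) as (T1 & T2 & T3); auto.
destruct (smooth1_frenet J g HJ Hg (frenet_n g)) as (N1 & N2 & N3); auto.
destruct (smooth1_frenet J g HJ Hg (frenet_b g)) as (B1 & B2 & B3); auto.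
assert (P : smooth1 J (fun s => Derive_n eta 2 s + 2 * curvature_nat g s * eta s)).
{ apply smooth1_plus; auto; [now apply smooth1_Derive_n|].
  apply smooth1_mult; auto; apply smooth1_mult; auto using smooth1_const. }
assert (Q : smooth1 J (fun s => - Derive eta s)) by (apply smooth1_opp; auto using smooth1_Derive).
assert (H : forall tt nn bb : R -> R, smooth1 J tt -> smooth1 J nn -> smooth1 J bb ->
  smooth1 J (fun s => (Derive_n eta 2 s + 2 * curvature_nat g s * eta s) * tt s
    + - Derive eta s * nn s + eta s * bb s)).
{ intros tt nn bb Htt Hnn Hbb.
  apply smooth1_plus; auto; [apply smooth1_plus; auto|]; apply smooth1_mult; auto. }
intros n s Hs; split; [|split];
[ exact (H _ _ _ T1 N1 B1 n s Hs) | exact (H _ _ _ T2 N2 B2 n s Hs)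
| exact (H _ _ _ T3 N3 B3 n s Hs) ].
Qed.

Let V (e s : R) : vec := vadd (g s) (vscal e (tangential_field g eta s)).

Lemma straight_smooth (U : R -> R -> Prop) :
  open2 U -> (forall e s, U e s -> J s) -> vsmooth2 U V.
Proof.
intros HU HUJ.
assert (He : smooth2 U (fun e _ => e)).
{ apply (smooth2_ext U (fun e s => 1 * e + 0 * s + 0)); auto; [intros; ring|].
  apply (smooth2_affine U (fun _ => True) (fun x => x)); auto.
  apply smooth1_id. }
assert (H : forall f h : R -> R, smooth1 J f -> smooth1 J h -> smooth2 U (fun e s => f s + e * h s)).
{ intros f h Hf Hh; apply smooth2_plus; auto; [now apply (smooth1_lift U J)|].
  apply smooth2_mult; auto; now apply (smooth1_lift U J). }
destruct (smooth_on_dvec_n J g 0 (proj1 (proj1 Hg))) as (G1 & G2 & G3).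
destruct (smooth_on_dvec_n J (tangential_field g eta) 0 smooth_on_tangential_field) as (F1 & F2 & F3).
split; [|split]; [exact (H _ _ G1 F1) | exact (H _ _ G2 F2) | exact (H _ _ G3 F3)].
Qed.

Lemma straight_velocity (e s : R) :
  J s -> dvec_n 1 (V e) s = vscal (1 + e * stretch g eta s) (frenet_t g s).
Proof.
intros Hs; apply is_dvec_unique.
eapply is_dvec_eq; [|apply is_dvec_add; [apply (is_dvec_n J g 0); auto; apply Hg|];
  apply is_dvec_scalc, is_dvec_tangential_field; auto].
unfold frenet_t; vec_ring.
Qed.

Lemma straight_acceleration (e s : R) :
  J s -> dvec_n 2 (V e) s =
    vadd (vscal (e * Derive (stretch g eta) s) (frenet_t g s))
         (vscal (1 + e * stretch g eta s) (frenet_n g s)).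
Proof.
intros Hs; apply (is_dvec_unique (dvec_n 1 (V e))).
eapply (is_dvec_ext_loc (fun u => vscal (1 + e * stretch g eta u) (frenet_t g u))).
{ generalize (HJ s Hs); apply filter_imp; intros u Hu; now rewrite straight_velocity. }
eapply is_dvec_eq; [|apply (is_dvec_scal (fun u => 1 + e * stretch g eta u));
  [apply is_derive_Rplus; [apply @is_derive_const|];
   apply is_derive_scal, Derive_correct, (smooth1_ex J); auto using smooth1_stretch
  |apply (is_dvec_frenet_t J); auto]].
change (@zero R_NormedModule) with 0; vec_ring.
Qed.

Lemma straight_null (e : R) :
  (forall s, J s -> 0 < 1 + e * stretch g eta s) ->
  null_curve J (V e) /\ flex_free J (V e).
Proof.
intros Hpos; split; [split|].
- exact (vsmooth2_slice (strip J) V e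
    (straight_smooth (strip J) (open2_strip J HJ) (fun _ _ H => H))).
- intros s Hs; rewrite straight_velocity by auto.
  pose proof (Hpos s Hs) as Hp; set (r := 1 + e * stretch g eta s) in *.
  pose proof Hg as ((_ & H) & _); destruct (H s Hs) as ((H0 & _ & H2) & H1).
  fold (frenet_t g s) in *; set (t := frenet_t g s) in *.
  assert (Hn : normsq (vscal r t) = 0).
  { unfold normsq in *; rewrite inner_vscal_l, inner_vscal_r, H1; ring. }
  split; [split; [|split]|exact Hn].
  + intros E.
    assert (Hi : inner (vscal r t) (vadd e1 e3) = 0).
    { rewrite E, inner_sym; apply inner_zero_r. }
    rewrite inner_vscal_l in Hi; nra.
  + lra.
  + rewrite inner_vscal_l; nra.
- intros s Hs; rewrite straight_velocity, straight_acceleration by auto.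
  pose proof (Hpos s Hs) as Hp; set (r := 1 + e * stretch g eta s) in *.
  pose proof Hg as (_ & H & _); specialize (H s Hs).
  fold (frenet_t g s) (frenet_n g s) in H.
  intros E; apply H.
  assert (E2 : wedge (vscal r (frenet_t g s))
     (vadd (vscal (e * Derive (stretch g eta) s) (frenet_t g s)) (vscal r (frenet_n g s)))
     = vscal (r * r) (wedge (frenet_t g s) (frenet_n g s))).
  { apply vec_eq; rewrite ?pr1_vscal, ?pr2_vscal, ?pr3_vscal, ?pr1_wedge, ?pr2_wedge, ?pr3_wedge;
      vec_expand; ring. }
  rewrite E2 in E.
  assert (Hr : r * r <> 0) by nra.
  apply vec_eq; apply (Rmult_eq_reg_l (r * r)); auto;
    [ apply (f_equal pr1) in E | apply (f_equal pr2) in E | apply (f_equal pr3) in E];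
    rewrite ?pr1_vscal, ?pr2_vscal, ?pr3_vscal in E; rewrite E;
    rewrite ?pr1_vzero, ?pr2_vzero, ?pr3_vzero; ring.
Qed.

End StraightVariation.

Lemma bounded_on_segment (f : R -> R) (p q : R) :
  p <= q -> (forall x, p <= x <= q -> continuous f x) ->
  exists M, 0 < M /\ forall x, p <= x <= q -> Rabs (f x) <= M.
Proof.
intros Hpq Hf.
destruct (continuity_ab_maj (fun x => Rabs (f x)) p q Hpq) as (m & Hm & _).
- intros x Hx; apply continuity_pt_filterlim.
  apply (continuous_comp f Rabs); [now apply Hf | apply (continuous_abs (K := R_AbsRing))].
- exists (Rabs (f m) + 1); split; [pose proof (Rabs_pos (f m)); lra|].
  intros x Hx; specialize (Hm x Hx); lra.
Qed.

Lemma stretch_bump_zero (g : R -> vec) (p q s : R) :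
  s < p \/ q < s -> stretch g (bump p q) s = 0 /\ tangential_field g (bump p q) s = vzero.
Proof.
intros Hs.
assert (H : locally s (fun u => bump p q u = 0)).
{ destruct Hs as [Hs|Hs]; [generalize (open_lt p s Hs) | generalize (open_gt q s Hs)];
    apply filter_imp; intros u Hu; apply bump_zero; lra. }
assert (Hn : forall n, Derive_n (bump p q) n s = 0).
{ intros n; rewrite (Derive_n_ext_loc _ (fun _ => 0) n s H).
  destruct n; [reflexivity | now rewrite Derive_n_const]. }
pose proof (Hn 0%nat) as H0; pose proof (Hn 1%nat) as H1.
change (bump p q s = 0) in H0; change (Derive (bump p q) s = 0) in H1.
unfold stretch, tangential_field; rewrite !Hn, H0, H1; split; [ring|].
unfold comb; vec_ring.
Qed.

(** The velocity is multiplied by [1 + e * stretch], which stays positive for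
    small [e]: the stretch is bounded on the segment and zero off it. *)
Lemma bump_variation (J : R -> Prop) (g : R -> vec) (p q : R) :
  open1 J -> natural_null J g -> p <= q -> (forall x, p <= x <= q -> J x) ->
  admissible_variation J g (fun e s => vadd (g s) (vscal e (tangential_field g (bump p q) s)))
    (fun x => p <= x <= q).
Proof.
intros HJ Hg Hpq HpqJ.
assert (Hb : smooth1 J (bump p q)) by now apply smooth1_bump.
destruct (bounded_on_segment (stretch g (bump p q)) p q Hpq) as (M & HM & HMb).
{ intros x Hx; apply (smooth1_continuous J); auto; now apply smooth1_stretch. }
assert (Hpos : forall e s, Rabs e < / M -> 0 < 1 + e * stretch g (bump p q) s).
{ intros e s He.
  destruct (Rlt_dec s p) as [Hs|Hs].
  { rewrite (proj1 (stretch_bump_zero g p q s (or_introl Hs))); lra. }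
  destruct (Rlt_dec q s) as [Hs'|Hs'].
  { rewrite (proj1 (stretch_bump_zero g p q s (or_intror Hs'))); lra. }
  assert (Hs2 : p <= s <= q) by lra; specialize (HMb s Hs2).
  assert (Rabs (e * stretch g (bump p q) s) < 1).
  { rewrite Rabs_mult.
    apply Rle_lt_trans with (Rabs e * M); [apply Rmult_le_compat_l; auto using Rabs_pos|].
    apply (Rmult_lt_compat_r M) in He; auto; rewrite Rinv_l in He; lra. }
  apply Rabs_def2 in H; lra. }
exists (mkposreal _ (Rinv_0_lt_compat M HM)); simpl.
split; [|split; [|split; [|split; [|split]]]].
- apply vsmooth2_iff, (straight_smooth J); auto.
  + exact (variation_open J HJ (mkposreal _ (Rinv_0_lt_compat M HM))).
  + tauto.
- intros e He; apply straight_null; auto.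
- intros t Ht; apply vec_eq; vec_expand; ring.
- apply compact_P3.
- exact HpqJ.
- intros e t He Ht HKt; rewrite (proj2 (stretch_bump_zero g p q t ltac:(lra))).
  vec_ring.
Qed.

Lemma locally_segment (P : R -> Prop) (x : R) :
  locally x P -> exists d : posreal, forall y, x - d <= y <= x + d -> P y.
Proof.
intros [d Hd]; assert (Hd2 : 0 < d / 2) by (pose proof (cond_pos d); lra).
exists (mkposreal _ Hd2); simpl; intros y Hy; apply Hd.
change (Rabs (y - x) < d); apply Rabs_def1; lra.
Qed.

(** A bump at a point where the wave expression has a sign would produce a
    nonzero first variation. *)
Lemma critical_wave_nonpos (J : R -> Prop) (g : R -> vec) (lam sg s0 : R) :
  open1 J -> natural_null J g -> critical_point lam J g -> J s0 ->
  ~ 0 < sg * wave lam g s0.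
Proof.
intros HJ Hg Hcrit Hs0 Hpos.
assert (Hws := smooth1_wave J g lam HJ Hg).
assert (Hl : locally s0 (fun u => J u /\ 0 < sg * wave lam g u)).
{ apply filter_and; [now apply HJ|].
  assert (Hc : continuous (fun u => sg * wave lam g u) s0).
  { apply (smooth1_continuous J); auto.
    apply smooth1_mult; auto using smooth1_const. }
  exact (Hc _ (open_gt 0 _ Hpos)). }
destruct (locally_segment _ s0 Hl) as [d Hd]; pose proof (cond_pos d) as Hdp.
set (p := s0 - d / 2); set (q := s0 + d / 2).
set (V := fun e s => vadd (g s) (vscal e (tangential_field g (bump p q) s))).
assert (Hpq : p <= q) by (unfold p, q; lra).
assert (HV : admissible_variation J g V (fun x => p <= x <= q)).
{ apply bump_variation; auto; intros x Hx; apply Hd; unfold p, q in Hx; lra. }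
assert (Hcd : s0 - d < s0 + d) by lra.
assert (HJcd : forall t, s0 - d <= t <= s0 + d -> J t) by (intros; now apply Hd).
assert (HK : forall t, p <= t <= q -> s0 - d < t < s0 + d) by (unfold p, q; intros; lra).
pose proof (first_variation J g lam V _ _ _ HJ Hg HV Hcd HJcd HK) as H1.
pose proof (Hcrit V _ HV _ _ Hcd HJcd HK) as H2.
assert (H0 := is_derive_unique _ _ _ H2); rewrite (is_derive_unique _ _ _ H1) in H0.
set (h := fun t => wave lam g t * bump p q t).
assert (Hh : forall t, s0 - d <= t <= s0 + d ->
  wave lam g t * inner (frenet_t g t) (vD1 V 0 t) = - h t).
{ intros t Ht.
  assert (E : vD1 V 0 t = tangential_field g (bump p q) t).
  { apply is_dvec_unique.
    eapply is_dvec_eq; [|apply is_dvec_add; [apply is_dvec_const|];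
      apply (is_dvec_scal (fun e => e)); [apply @is_derive_id | apply is_dvec_const]].
    change (@one R_AbsRing) with 1.
    vec_ring. }
  rewrite E; unfold h, tangential_field.
  replace (frenet_t g t) with (comb (frenet_t g t) (frenet_n g t) (frenet_b g t) 1 0 0) at 1
    by (unfold comb; vec_ring).
  rewrite (inner_comb J) by auto; ring. }
assert (Hcont : forall t, s0 - d <= t <= s0 + d -> continuous h t).
{ intros t Ht; apply (smooth1_continuous J); auto.
  apply smooth1_mult; auto using smooth1_bump. }
rewrite (RInt_ext _ (fun t => - h t)) in H0.
2:{ intros t Ht; rewrite Rmin_left, Rmax_right in Ht by lra; apply Hh; lra. }
assert (Hex : forall x y, s0 - d <= x -> x <= y -> y <= s0 + d -> ex_RInt h x y).
{ intros x y H3 H4 H5; apply (ex_RInt_continuous (V := R_CompleteNormedModule)).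
  intros t; rewrite Rmin_left, Rmax_right by lra; intros Ht; apply Hcont; lra. }
rewrite (RInt_opp (V := R_CompleteNormedModule)) in H0 by (apply Hex; lra).
assert (Hp1 : s0 - d <= p) by (unfold p; lra).
assert (Hq1 : q <= s0 + d) by (unfold q; lra).
rewrite <- (RInt_Chasles (V := R_CompleteNormedModule) h (s0 - d) p (s0 + d)) in H0
  by (apply Hex; lra).
rewrite <- (RInt_Chasles (V := R_CompleteNormedModule) h p q (s0 + d)) in H0
  by (apply Hex; lra).
assert (Z : forall x y, x <= y -> y <= p \/ q <= x -> RInt h x y = 0).
{ intros x y Hxy Hout; rewrite (RInt_ext _ (fun _ => 0)).
  - rewrite RInt_const; apply Rmult_0_r.
  - intros t; rewrite Rmin_left, Rmax_right by lra; intros Ht; unfold h.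
    rewrite bump_zero by lra; apply Rmult_0_r. }
rewrite (Z (s0 - d) p), (Z q (s0 + d)) in H0 by lra.
unfold plus, opp in H0; simpl in H0.
assert (Hgt : 0 < RInt (fun t => scal sg (h t)) p q).
{ apply RInt_gt_0.
  - unfold p, q; lra.
  - intros t Ht; unfold scal; simpl; unfold mult, h; simpl; rewrite <- Rmult_assoc.
    apply Rmult_lt_0_compat; [apply Hd; unfold p, q in Ht; lra | now apply bump_pos].
  - intros t Ht.
    apply (continuous_scal_r (V := R_NormedModule) sg h t).
    apply Hcont; unfold p, q in Ht; lra. }
rewrite (RInt_scal (V := R_CompleteNormedModule)) in Hgt by (apply Hex; lra).
unfold scal in Hgt; simpl in Hgt; unfold mult in Hgt; simpl in Hgt.
replace (RInt h p q) with 0 in Hgt by lra; lra.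
Qed.

Theorem critical_iff_wave (J : R -> Prop) (g : R -> vec) (lam : R) :
  open1 J -> natural_null J g ->
  critical_point lam J g <-> (forall t, J t -> wave lam g t = 0).
Proof.
intros HJ Hg; split; [|now apply wave_zero_critical].
intros Hcrit t Ht.
pose proof (critical_wave_nonpos J g lam 1 t HJ Hg Hcrit Ht).
pose proof (critical_wave_nonpos J g lam (-1) t HJ Hg Hcrit Ht).
lra.
Qed.

(** * Congruence curves are travelling waves *)

Lemma open2_travelling (J : R -> Prop) (lam : R) :
  open1 J -> open2 (fun s t => J (s - lam * t)).
Proof.
intros HJ s t Hst; destruct (HJ _ Hst) as [d Hd].
pose proof (cond_pos d) as Hdp; pose proof (Rabs_pos lam) as Hl.
assert (Hp : 0 < d / (2 + Rabs lam)) by (apply Rdiv_lt_0_compat; lra).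
exists (mkposreal _ Hp); simpl; intros u v Hu Hv; apply Hd.
change (Rabs (u - lam * v - (s - lam * t)) < d).
replace (u - lam * v - (s - lam * t)) with ((u - s) + - lam * (v - t)) by ring.
eapply Rle_lt_trans; [apply Rabs_triang|].
rewrite Rabs_mult, Rabs_Ropp.
assert (Rabs lam * Rabs (v - t) <= Rabs lam * (d / (2 + Rabs lam))).
{ apply Rmult_le_compat_l; lra. }
assert (E : (1 + Rabs lam) * (d / (2 + Rabs lam)) < d).
{ apply (Rmult_lt_reg_r (2 + Rabs lam)); [lra|].
  replace ((1 + Rabs lam) * (d / (2 + Rabs lam)) * (2 + Rabs lam)) with ((1 + Rabs lam) * d)
    by (field; lra).
  nra. }
lra.
Qed.

Lemma dvec_n_ext (J : R -> Prop) (X Y : R -> vec) (n : nat) (s : R) :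
  open1 J -> (forall u, J u -> X u = Y u) -> J s -> dvec_n n X s = dvec_n n Y s.
Proof.
intros HJ HXY Hs; unfold dvec_n; f_equal; [f_equal|]; apply Derive_n_ext_loc;
  generalize (HJ s Hs); apply filter_imp; intros u Hu; now rewrite HXY.
Qed.

(** The curvature of a solution of the flow evolves by the KdV equation; along
    a congruence solution its time derivative is also [- lam] times its space
    derivative. Comparing the two at time zero gives the wave equation. *)
Theorem congruence_wave (J : R -> Prop) (g : R -> vec) (lam : R) :
  open1 J -> natural_null J g -> congruence_curve lam J g ->
  forall s, J s -> wave lam g s = 0.
Proof.
intros HJ Hg (Gam & (HS & _ & Hflow) & H0 & Hk) s Hs.
set (U := fun s t => J (s - lam * t)) in *.
apply vsmooth2_iff in HS.
assert (HU : open2 U) by now apply open2_travelling.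
assert (HU0 : forall u, J u -> U u 0).
{ intros u Hu; unfold U; rewrite Rmult_0_r, Rminus_0_r; exact Hu. }
set (k := curvature_nat g) in *.
assert (K : forall n u, J u -> is_derive (Derive_n k n) u (Derive_n k (S n) u)).
{ intros n u Hu; now apply (is_derive_curvature J g HJ Hg). }
assert (Hd : forall n u, J u -> dvec_n n (fun s => Gam s 0) u = dvec_n n g u).
{ intros n u Hu; apply (dvec_n_ext J); auto. }
set (cb := fun p q r u => comb (frenet_t g u) (frenet_n g u) (frenet_b g u) (p u) (q u) (r u)).
assert (Y0 : forall u, J u -> vD2 Gam u 0 = cb (fun u => 2 * k u) (fun _ => 0) (fun _ => 2) u).
{ intros u Hu; unfold vD2; rewrite Hflow by exact (HU0 u Hu).
  unfold cb, curvature_nat, frenet_t, frenet_b; rewrite !Hd by auto.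
  unfold k, curvature_nat, comb; vec_ring. }
(* exchanging partial derivatives, three space derivatives of the flow field
   give the time derivative of the third derivative of the curve *)
assert (step : forall F Y Y', vsmooth2 U F -> (forall u, J u -> vD2 F u 0 = Y u) ->
  (forall u, J u -> is_dvec Y u (Y' u)) ->
  vsmooth2 U (vD1 F) /\ forall u, J u -> vD2 (vD1 F) u 0 = Y' u).
{ intros F Y Y' HF HY HY'; split; [now apply vsmooth2_vD1|].
  intros u Hu; rewrite <- (vD1_vD2 U) by auto; apply is_dvec_unique.
  eapply is_dvec_ext_loc; [|now apply HY'].
  generalize (HJ u Hu); apply filter_imp; intros v Hv; now rewrite HY. }
destruct (step Gam _ (cb (fun u => 2 * Derive k u) (fun u => - 2 * k u) (fun _ => 0)) HS Y0)
  as (S1 & Y1).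
{ intros u Hu; eapply is_dvec_eq; [|apply (is_dvec_comb J g HJ Hg); auto;
    [apply is_derive_scal, (K 0%nat u Hu) | apply @is_derive_const | apply @is_derive_const]].
  unfold cb; change (@zero R_NormedModule) with 0; fold k.
  change (Derive_n k 1 u) with (Derive k u); unfold comb; vec_ring. }
destruct (step _ _ (cb (fun u => 2 * Derive_n k 2 u + 4 * (k u * k u)) (fun _ => 0)
    (fun u => - 2 * k u)) S1 Y1) as (S2 & Y2).
{ intros u Hu; eapply is_dvec_eq; [|apply (is_dvec_comb J g HJ Hg); auto;
    [apply is_derive_scal, (K 1%nat u Hu) | apply is_derive_scal, (K 0%nat u Hu)
    | apply @is_derive_const]].
  unfold cb; change (@zero R_NormedModule) with 0; fold k.
  change (Derive_n k 1 u) with (Derive k u); unfold comb; vec_ring. }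
destruct (step _ _ (cb (fun u => 2 * Derive_n k 3 u + 8 * k u * Derive k u)
    (fun u => 2 * Derive_n k 2 u + 8 * (k u * k u))
    (fun u => - 2 * Derive k u)) S2 Y2) as (S3 & Y3).
{ intros u Hu; eapply is_dvec_eq; [|apply (is_dvec_comb J g HJ Hg); auto;
    [apply is_derive_Rplus; [apply is_derive_scal, (K 2%nat u Hu)
                            |apply is_derive_scal, is_derive_Rmult; apply (K 0%nat u Hu)]
    | apply @is_derive_const | apply is_derive_scal, (K 0%nat u Hu)]].
  unfold cb; change (@zero R_NormedModule) with 0; fold k.
  change (Derive_n k 1 u) with (Derive k u); change (Derive_n k 0 u) with (k u);
  unfold comb; vec_ring. }
assert (D1k : is_derive (fun t => curvature_nat (fun s => Gam s t) s) 0
   (1/4 * (2 * inner (dvec_n 3 g s) (cb (fun u => 2 * Derive_n k 3 u + 8 * k u * Derive k u)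
    (fun u => 2 * Derive_n k 2 u + 8 * (k u * k u))
    (fun u => - 2 * Derive k u) s)))).
{ rewrite <- Y3 by auto.
  assert (HX : is_dvec (fun t => vD1 (vD1 (vD1 Gam)) s t) 0 (vD2 (vD1 (vD1 (vD1 Gam))) s 0)).
  { apply (is_dvec_vD2 U); auto. }
  eapply is_derive_eq; [|apply is_derive_scal, (is_derive_inner _ _ 0 _ _ HX HX)].
  replace (vD1 (vD1 (vD1 Gam)) s 0) with (dvec_n 3 g s) by (symmetry; exact (Hd 3%nat s Hs)).
  rewrite (inner_sym (vD2 (vD1 (vD1 (vD1 Gam))) s 0)); simpl; field. }
assert (D2k : is_derive (fun t => k (s - lam * t)) 0 (- lam * Derive k s)).
{ apply (is_derive_comp k (fun t => s - lam * t)).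
  - rewrite Rmult_0_r, Rminus_0_r; exact (K 0%nat s Hs).
  - auto_derive; [trivial | ring]. }
assert (E : 1/4 * (2 * inner (dvec_n 3 g s) (cb (fun u => 2 * Derive_n k 3 u + 8 * k u * Derive k u)
    (fun u => 2 * Derive_n k 2 u + 8 * (k u * k u))
    (fun u => - 2 * Derive k u) s)) = - lam * Derive k s).
{ apply (derive_ext_unique (fun t => U s t) _ _ 0 _ _) with (4 := D1k) (5 := D2k); auto.
  intros t Ht; apply (locally_2d_1d_const_x U), HU; exact Ht. }
unfold cb in E; rewrite (dvec_n3_frenet g s), (inner_comb J) in E by auto.
unfold wave; fold k in E; fold k; lra.
Qed.

(** * One-parameter groups of Lorentz motions *)

(** The coefficients of the exponential [1 + S M + C M^2] of an endomorphism
    [M] with [M^3 = c M]; the primitive [D] of [C] serves to integrate the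
    exponential once more. According to the sign of [c] they are circular,
    polynomial or hyperbolic. *)
Record exp_coefficients (c : R) (S C D : R -> R) : Prop := {
  expc_S0 : S 0 = 0;
  expc_C0 : C 0 = 0;
  expc_D0 : D 0 = 0;
  expc_dS : forall t, is_derive S t (1 + c * C t);
  expc_dC : forall t, is_derive C t (S t);
  expc_dD : forall t, is_derive D t (C t);
  expc_S_odd : forall t, S (- t) = - S t;
  expc_C_even : forall t, C (- t) = C t;
  expc_bqS : by_quadratures m_infty p_infty S;
  expc_bqC : by_quadratures m_infty p_infty C }.

Lemma bq_ext (a b : Rbar) (f g : R -> R) :
  by_quadratures a b f -> (forall x, ooint a b x -> g x = f x) -> by_quadratures a b g.
Proof. intros Hf Hfg; apply (bq_restrict a b a b f); auto. Qed.

Lemma ooint_all (x : R) : ooint m_infty p_infty x.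
Proof. split; simpl; auto. Qed.

Lemma bq_line_comp (f g : R -> R) :
  by_quadratures m_infty p_infty f -> by_quadratures m_infty p_infty g ->
  by_quadratures m_infty p_infty (fun x => g (f x)).
Proof.
intros Hf Hg; apply (bq_comp m_infty p_infty m_infty p_infty); auto using ooint_all.
Qed.

Lemma bq_line_scal (k : R) (f : R -> R) :
  by_quadratures m_infty p_infty f -> by_quadratures m_infty p_infty (fun x => k * f x).
Proof. intros Hf; apply bq_mult; auto using bq_const. Qed.

Lemma exp_coefficients_exist (c : R) : exists S C D, exp_coefficients c S C D.
Proof.
destruct (total_order_T c 0) as [[Hc|Hc]|Hc].
- set (k := sqrt (- c)).
  assert (Hk : 0 < k) by (apply sqrt_lt_R0; lra).
  assert (Hkc : c = - (k * k)) by (unfold k; rewrite sqrt_sqrt; lra).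
  exists (fun t => / k * sin (k * t)), (fun t => / (k * k) * (1 - cos (k * t))),
    (fun t => / (k * k) * (t - / k * sin (k * t))).
  split; try intros t.
  + rewrite Rmult_0_r, sin_0; ring.
  + rewrite Rmult_0_r, cos_0; ring.
  + rewrite Rmult_0_r, sin_0; ring.
  + auto_derive; [trivial | rewrite Hkc; field; lra].
  + auto_derive; [trivial | field; lra].
  + auto_derive; [trivial | field; lra].
  + replace (k * - t) with (- (k * t)) by ring; rewrite sin_neg; ring.
  + replace (k * - t) with (- (k * t)) by ring; now rewrite cos_neg.
  + apply bq_line_scal, (bq_line_comp (fun t => k * t) sin); [apply bq_line_scal|]; constructor.
  + apply bq_line_scal, bq_minus; [constructor|].
    apply (bq_line_comp (fun t => k * t) cos); [apply bq_line_scal|]; constructor.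
- subst c; exists (fun t => t), (fun t => / 2 * (t * t)), (fun t => / 6 * (t * (t * t))).
  split; try intros t; try ring; try (auto_derive; [trivial | field]).
  + constructor.
  + apply bq_line_scal, bq_mult; constructor.
- set (k := sqrt c).
  assert (Hk : 0 < k) by (apply sqrt_lt_R0; lra).
  assert (Hkc : c = k * k) by (unfold k; rewrite sqrt_sqrt; lra).
  set (S := fun t => / (2 * k) * (exp (k * t) - exp (- k * t))).
  exists S, (fun t => / (2 * (k * k)) * (exp (k * t) + exp (- k * t) - 2)),
    (fun t => / (k * k) * (S t - t)).
  assert (B : forall r, by_quadratures m_infty p_infty (fun t => exp (r * t))).
  { intros r; apply (bq_line_comp (fun t => r * t) exp); [apply bq_line_scal|]; constructor. }
  split; unfold S; try intros t.
  + rewrite !Rmult_0_r; ring.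
  + rewrite !Rmult_0_r, exp_0; ring.
  + rewrite !Rmult_0_r; ring.
  + auto_derive; [trivial | rewrite Hkc; field; lra].
  + auto_derive; [trivial | field; lra].
  + auto_derive; [trivial | field; lra].
  + replace (k * - t) with (- k * t) by ring; replace (- k * - t) with (k * t) by ring; ring.
  + replace (k * - t) with (- k * t) by ring; replace (- k * - t) with (k * t) by ring; ring.
  + apply bq_line_scal, bq_minus; auto.
  + apply bq_line_scal, bq_minus; [apply bq_plus; auto | constructor].
Qed.

Section OneParameterGroup.

Context (w : vec) (S C D : R -> R) (HE : exp_coefficients (normsq w) S C D).

(** The exponential of [t] times the cross product with [w]. *)
Definition turn (t : R) (x : vec) : vec :=
  vadd x (vadd (vscal (S t) (cross w x)) (vscal (C t) (cross w (cross w x)))).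

Lemma expc_first_integral (t : R) : S t * S t = 2 * C t + normsq w * (C t * C t).
Proof.
set (f := fun t => S t * S t + - (2 * C t + normsq w * (C t * C t))).
assert (H : f t = f 0).
{ apply (is_derive_zero_const m_infty p_infty); auto using ooint_all.
  intros s _; destruct HE as [_ _ _ HS HC _ _ _ _ _].
  eapply is_derive_eq; [|apply is_derive_Rplus; [apply is_derive_Rmult; apply HS|
    apply is_derive_Ropp, is_derive_Rplus; [apply is_derive_scal, HC
      |apply is_derive_scal, is_derive_Rmult; apply HC]]].
  simpl; ring. }
unfold f in H; rewrite (expc_S0 _ _ _ _ HE), (expc_C0 _ _ _ _ HE) in H; lra.
Qed.

Lemma cross_cross_cross (x : vec) :
  cross w (cross w (cross w x)) = vscal (normsq w) (cross w x).
Proof. rewrite (cross_cross w (cross w x)); vec_ring. Qed.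

Lemma inner_cross_skew (x y : vec) : inner (cross w x) y = - inner x (cross w y).
Proof. vec_ring. Qed.

Lemma turn_inner (t : R) (x y : vec) : inner (turn t x) (turn t y) = inner x y.
Proof.
unfold turn; rewrite !inner_vadd_l, !inner_vadd_r, !inner_vscal_l, !inner_vscal_r.
rewrite !inner_cross_skew, !cross_cross_cross, ?cross_vscal_r, !inner_vscal_r.
replace (S t * (S t * - inner x (cross w (cross w y))))
  with (- (S t * S t) * inner x (cross w (cross w y))) by ring.
rewrite expc_first_integral; ring.
Qed.

Lemma turn_neg (t : R) (x : vec) : turn (- t) (turn t x) = x.
Proof.
pose proof (expc_first_integral t) as H.
unfold turn; rewrite (expc_S_odd _ _ _ _ HE), (expc_C_even _ _ _ _ HE).
rewrite ?cross_vadd_r, ?cross_vscal_r, ?cross_vadd_r, ?cross_vscal_r, ?cross_cross_cross, ?cross_vscal_r.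
set (y := cross w x); set (z := cross w y).
assert (Hz : cross w z = vscal (normsq w) y) by apply cross_cross_cross.
replace (cross w (vscal (normsq w) y)) with (vscal (normsq w) z) by (symmetry; apply cross_vscal_r).
apply vec_eq; rewrite ?pr1_vadd, ?pr2_vadd, ?pr3_vadd, ?pr1_vscal, ?pr2_vscal, ?pr3_vscal,
  ?pr1_vadd, ?pr2_vadd, ?pr3_vadd, ?pr1_vscal, ?pr2_vscal, ?pr3_vscal.
- transitivity (pr1 x + (2 * C t + normsq w * (C t * C t) - S t * S t) * pr1 z); [ring | rewrite H; ring].
- transitivity (pr2 x + (2 * C t + normsq w * (C t * C t) - S t * S t) * pr2 z); [ring | rewrite H; ring].
- transitivity (pr3 x + (2 * C t + normsq w * (C t * C t) - S t * S t) * pr3 z); [ring | rewrite H; ring].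
Qed.

Lemma turn_zero_param (x : vec) : turn 0 x = x.
Proof. unfold turn; rewrite (expc_S0 _ _ _ _ HE), (expc_C0 _ _ _ _ HE); vec_ring. Qed.

Lemma turn_vadd (t : R) (x y : vec) : turn t (vadd x y) = vadd (turn t x) (turn t y).
Proof. unfold turn; rewrite !cross_vadd_r; vec_ring. Qed.

Lemma turn_vscal (t c : R) (x : vec) : turn t (vscal c x) = vscal c (turn t x).
Proof. unfold turn; rewrite !cross_vscal_r; vec_ring. Qed.

Lemma is_dvec_turn_along (th : R -> R) (X : R -> vec) (s th' : R) (x : vec) :
  is_derive th s th' -> is_dvec X s x ->
  is_dvec (fun u => turn (th u) (X u)) s
    (turn (th s) (vadd (vscal th' (cross w (X s))) x)).
Proof.
intros Hth HX; unfold turn.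
eapply is_dvec_eq; [|apply is_dvec_add; [exact HX|];
  apply is_dvec_add; apply is_dvec_scal;
  [apply (is_derive_comp S th); [apply (expc_dS _ _ _ _ HE) | exact Hth]
  |apply is_dvec_cross, HX
  |apply (is_derive_comp C th); [apply (expc_dC _ _ _ _ HE) | exact Hth]
  |do 2 apply is_dvec_cross; exact HX]].
rewrite !cross_vadd_r, !cross_vscal_r, cross_cross_cross.
unfold scal; simpl; unfold mult; simpl.
apply vec_eq; rewrite ?pr1_vadd, ?pr2_vadd, ?pr3_vadd, ?pr1_vscal, ?pr2_vscal, ?pr3_vscal,
  ?pr1_vadd, ?pr2_vadd, ?pr3_vadd, ?pr1_vscal, ?pr2_vscal, ?pr3_vscal; ring.
Qed.

Lemma is_dvec_turn (X : R -> vec) (t : R) (x : vec) :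
  is_dvec X t x ->
  is_dvec (fun u => turn u (X u)) t (turn t (vadd (cross w (X t)) x)).
Proof.
intros HX; eapply is_dvec_eq;
  [|exact (is_dvec_turn_along (fun u => u) X t _ x (is_derive_id t) HX)].
f_equal; f_equal; change (@one R_AbsRing) with 1; vec_ring.
Qed.

Lemma is_dvec_turn_const (t : R) (X : R -> vec) (s : R) (x : vec) :
  is_dvec X s x -> is_dvec (fun u => turn t (X u)) s (turn t x).
Proof.
intros HX; apply is_dvec_add; [exact HX|].
apply is_dvec_add; apply is_dvec_scalc; repeat apply is_dvec_cross; exact HX.
Qed.

Lemma null_orthogonal_timelike (x : vec) :
  normsq x = 0 -> inner x (vadd e1 e3) = 0 -> x = vzero.
Proof.
unfold normsq, inner; rewrite pr1_vadd, pr2_vadd, pr3_vadd.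
unfold e1, e3; change (pr1 (1, 0, 0)) with 1; change (pr2 (1, 0, 0)) with 0;
  change (pr3 (1, 0, 0)) with 0; change (pr1 (0, 0, 1)) with 0;
  change (pr2 (0, 0, 1)) with 0; change (pr3 (0, 0, 1)) with 1.
intros H1 H2; assert (H3 : pr3 x = - pr1 x) by lra; rewrite H3 in H1.
assert (pr1 x = 0) by nra; assert (pr2 x = 0) by nra.
apply vec_eq; rewrite ?pr1_vzero, ?pr2_vzero, ?pr3_vzero; lra.
Qed.

(** A turned null vector cannot leave the future cone, since along the group
    its product with a timelike vector would have to vanish first. *)
Lemma turn_future (t : R) (x : vec) :
  normsq x = 0 -> future_directed x -> future_directed (turn t x).
Proof.
intros Hx (Hx0 & _ & Hx1).
assert (Hn : forall u, normsq (turn u x) = 0) by (intros u; unfold normsq; now rewrite turn_inner).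
assert (H0 : forall u, turn u x <> vzero).
{ intros u E; apply Hx0; rewrite <- (turn_neg u x), E.
  unfold turn; vec_ring. }
split; [apply H0|]; split; [rewrite Hn; lra|].
destruct (Rlt_dec (inner (turn t x) (vadd e1 e3)) 0) as [|Hge]; [assumption|exfalso].
set (f := fun u => inner (turn u x) (vadd e1 e3)).
destruct (IVT_gen f 0 t 0) as (u & _ & Hu).
- intros u; apply continuity_pt_filterlim, (ex_derive_continuous (V := R_NormedModule)).
  eexists; apply is_derive_inner; [|apply is_dvec_const].
  apply is_dvec_turn, is_dvec_const.
- assert (f 0 < 0) by (unfold f; now rewrite turn_zero_param).
  assert (0 <= f t) by (unfold f; lra).
  rewrite Rmin_left, Rmax_right by lra; lra.
- apply (H0 u), null_orthogonal_timelike; auto.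
Qed.

Lemma smooth1_exp_coefficients : smooth1 (fun _ => True) S /\ smooth1 (fun _ => True) C /\
  smooth1 (fun _ => True) D.
Proof.
assert (HT : open1 (fun _ => True)) by (intros x _; apply filter_forall; auto).
assert (HU := open2_strip _ HT).
assert (Hc : forall f l, (forall t, is_derive f t (l t)) ->
  forall x y, continuity_2d_pt (fun _ y => f y) x y).
{ intros f l Hf x y; apply (continuity_1d_2d_pt_comp f (fun _ y => y)).
  - apply continuity_pt_filterlim, (ex_derive_continuous (V := R_NormedModule)).
    eexists; apply Hf.
  - apply continuity_2d_pt_id2. }
assert (Hstep : forall n f l, (forall t, is_derive f t (l t)) ->
  classC (strip (fun _ => True)) n (fun _ y => l y) ->
  classC (strip (fun _ => True)) (Datatypes.S n) (fun _ y => f y)).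
{ intros n f l Hf Hl; apply classC_S.
  - intros; now apply (Hc f l).
  - intros; apply ex_derive_const.
  - intros x y _; eexists; apply Hf.
  - apply (classC_ext _ n (fun _ _ => 0)); auto using classC_const.
    intros; unfold D1; now rewrite Derive_const.
  - apply (classC_ext _ n (fun _ y => l y)); auto.
    intros; symmetry; apply is_derive_unique, Hf. }
assert (HSC : forall n, classC (strip (fun _ => True)) n (fun _ y => S y) /\
  classC (strip (fun _ => True)) n (fun _ y => C y)).
{ induction n as [|n [IHS IHC]].
  - split; intros x y _; split; auto;
      [apply (Hc S _ (expc_dS _ _ _ _ HE)) | apply (Hc C _ (expc_dC _ _ _ _ HE))].
  - split; [apply (Hstep n S _ (expc_dS _ _ _ _ HE)) | now apply (Hstep n C _ (expc_dC _ _ _ _ HE))].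
    apply classC_plus; auto using classC_const; apply classC_mult; auto using classC_const. }
split; [|split]; apply smooth1_strip; auto; intros n; try apply HSC.
destruct n as [|n].
- intros x y _; split; auto; apply (Hc D _ (expc_dD _ _ _ _ HE)).
- apply (Hstep n D _ (expc_dD _ _ _ _ HE)), HSC.
Qed.

End OneParameterGroup.

(** * Travelling waves are congruence curves *)

Lemma vsmooth2_slice1 (U : R -> R -> Prop) (V : R -> R -> vec) (y : R) :
  vsmooth2 U V -> smooth_on (fun x => U x y) (fun x => V x y).
Proof.
intros (H1 & H2 & H3) n s Hs; split; [|split];
[ exact (smooth2_slice1 U _ y H1 n s Hs) | exact (smooth2_slice1 U _ y H2 n s Hs)
| exact (smooth2_slice1 U _ y H3 n s Hs)].
Qed.

Lemma vsmooth2_cross (U : R -> R -> Prop) (w : vec) (V : R -> R -> vec) :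
  open2 U -> vsmooth2 U V -> vsmooth2 U (fun x y => cross w (V x y)).
Proof.
intros HU (H1 & H2 & H3).
assert (H : forall p q f h, smooth2 U f -> smooth2 U h ->
  smooth2 U (fun x y => p * f x y + - (q * h x y))).
{ intros p q f h Hf Hh; apply smooth2_plus; auto; [|apply smooth2_opp; auto];
    apply smooth2_mult; auto using smooth2_const. }
split; [|split].
- exact (smooth2_ext U _ _ HU (fun x y _ => eq_sym (pr1_cross w (V x y))) (H (pr2 w) (pr1 w) _ _ H1 H2)).
- exact (smooth2_ext U _ _ HU (fun x y _ => eq_sym (pr2_cross w (V x y))) (H (pr3 w) (pr1 w) _ _ H1 H3)).
- exact (smooth2_ext U _ _ HU (fun x y _ => eq_sym (pr3_cross w (V x y))) (H (pr3 w) (pr2 w) _ _ H2 H3)).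
Qed.

Lemma is_dvec_affine (X : R -> vec) (p q s : R) (x : vec) :
  is_dvec X (p * s + q) x -> is_dvec (fun u => X (p * u + q)) s (vscal p x).
Proof.
intros (H1 & H2 & H3).
assert (Hl : is_derive (fun u => p * u + q) s p) by (auto_derive; [trivial | ring]).
split; [|split]; 
[ apply (is_derive_comp (fun v => pr1 (X v)) (fun u => p * u + q))
| apply (is_derive_comp (fun v => pr2 (X v)) (fun u => p * u + q))
| apply (is_derive_comp (fun v => pr3 (X v)) (fun u => p * u + q)) ]; auto.
Qed.

Lemma wedge_zero_normsq (x y : vec) :
  normsq x = 0 -> x <> vzero -> inner x y = 0 -> wedge x y = vzero -> normsq y = 0.
Proof.
intros Hx H0 Hxy Hw; destruct (Req_dec (normsq y) 0) as [|Hn]; [assumption|exfalso].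
assert (W1 : pr1 (wedge x y) = 0) by (now rewrite Hw).
assert (W2 : pr2 (wedge x y) = 0) by (now rewrite Hw).
assert (W3 : pr3 (wedge x y) = 0) by (now rewrite Hw).
assert (Hz : forall c, c * c * normsq y = 0 -> c = 0).
{ intros c Hc; apply Rmult_integral in Hc; destruct Hc as [Hc|Hc]; [nra | contradiction]. }
apply H0, vec_eq; apply Hz.
- transitivity (pr3 (wedge x y) * pr3 (wedge x y) - pr1 y * pr1 y * normsq x
    + 2 * pr1 x * pr1 y * inner x y).
  + rewrite pr3_wedge; unfold normsq, inner; ring.
  + rewrite W3, Hx, Hxy; ring.
- transitivity (pr2 (wedge x y) * pr2 (wedge x y) - 2 * pr1 y * pr3 y * normsq x
    - inner x y * inner x y + 2 * pr2 x * pr2 y * inner x y).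
  + rewrite pr2_wedge; unfold normsq, inner; ring.
  + rewrite W2, Hx, Hxy; ring.
- transitivity (pr1 (wedge x y) * pr1 (wedge x y) - pr3 y * pr3 y * normsq x
    + 2 * pr3 x * pr3 y * inner x y).
  + rewrite pr1_wedge; unfold normsq, inner; ring.
  + rewrite W1, Hx, Hxy; ring.
Qed.

Section Travelling.

Context (a b : Rbar) (g : R -> vec) (lam : R) (Hg : natural_null (ooint a b) g)
  (Hw : forall s, ooint a b s -> wave lam g s = 0).

Let J := ooint a b.
Let HJ : open1 J := open1_ooint a b.
Let k := curvature_nat g.

(** The momentum is the axis of the Lorentz motions along which the curve
    slides. *)
Definition axis (s : R) : vec := vscal (- 2 * orient g s) (momentum lam g s).

(** The flow field along the curve, plus [lam] times the velocity to make up
    for the shift of the parameter. *)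
Definition drift (s : R) : vec :=
  comb (frenet_t g s) (frenet_n g s) (frenet_b g s) (2 * k s + lam) 0 2.

Lemma axis_const (x y : R) : J x -> J y -> axis x = axis y.
Proof.
intros Hx Hy; unfold axis; rewrite (orient_const a b g x y) by auto; f_equal.
apply (is_dvec_zero_const a b (momentum lam g)); auto.
intros s Hs; eapply is_dvec_eq; [|apply (is_dvec_momentum J); auto].
rewrite Hw by auto; vec_ring.
Qed.

Lemma axis_cross (s : R) :
  J s -> cross (axis s) (frenet_t g s) =
    comb (frenet_t g s) (frenet_n g s) (frenet_b g s) (2 * Derive k s) (lam - 2 * k s) 0.
Proof.
intros Hs; pose proof (frenet_frame J g HJ Hg s Hs) as Hf.
pose proof (orient_sqr J g HJ Hg s Hs) as Ho; unfold orient in Ho.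
unfold axis, momentum, orient; fold k.
set (t := frenet_t g s) in *; set (n := frenet_n g s) in *; set (bb := frenet_b g s) in *.
unfold comb; rewrite !cross_vscal_l, !cross_vadd_l, !cross_vscal_l.
rewrite (cross_anti n t), (frame_cross_tn t n bb Hf), (frame_cross_bt t n bb Hf).
replace (cross t t) with vzero by vec_ring.
set (o := det3 t n bb) in *.
transitivity (vadd (vscal (o * o * (2 * Derive k s)) t) (vscal (o * o * (lam - 2 * k s)) n)).
- apply vec_eq; vec_expand; field.
- rewrite Ho; vec_ring.
Qed.

Lemma is_dvec_drift (s : R) : J s -> is_dvec drift s (cross (axis s) (frenet_t g s)).
Proof.
intros Hs; rewrite axis_cross by auto.
pose proof (is_derive_curvature J g HJ Hg 0 s Hs) as K0.
eapply is_dvec_eq; [|apply (is_dvec_comb J g HJ Hg (fun u => 2 * k u + lam) (fun _ => 0) (fun _ => 2)); auto;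
  [apply is_derive_Rplus; [apply is_derive_scal, K0 | apply @is_derive_const]
  | apply @is_derive_const | apply @is_derive_const]].
change (@zero R_NormedModule) with 0; fold k.
change (Derive_n k 1 s) with (Derive k s); unfold comb; vec_ring.
Qed.

(** The drift is the restriction of an infinitesimal rigid motion, because its
    derivative is the cross product of the constant axis with the velocity. The
    corresponding rigid motions, composed with the shift of the parameter, give
    the solution of the flow. *)
Theorem wave_congruence : Rbar_lt a b -> congruence_curve lam J g.
Proof.
intros Hab.
destruct (ooint_inhabited a b Hab) as [s0 Hs0].
set (w := axis s0).
destruct (exp_coefficients_exist (normsq w)) as (S & C & D & HE).
set (E := turn w S C).
set (v := vadd (drift s0) (vscal (-1) (cross w (g s0)))).
assert (Hgd : forall n s, J s -> is_dvec (dvec_n n g) s (dvec_n (Datatypes.S n) g s)).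
{ intros n s Hs; apply (is_dvec_n J); auto; apply Hg. }
assert (Hv : forall s, J s -> vadd (cross w (g s)) v = drift s).
{ intros s Hs.
  assert (H : vadd (drift s) (vscal (-1) (cross w (g s))) = v).
  { apply (is_dvec_zero_const a b (fun s => vadd (drift s) (vscal (-1) (cross w (g s))))); auto.
    intros u Hu; eapply is_dvec_eq; [|apply is_dvec_add;
      [now apply is_dvec_drift | apply is_dvec_scalc, is_dvec_cross, (Hgd 0%nat u Hu)]].
    unfold w; rewrite (axis_const s0 u Hs0 Hu); unfold frenet_t; vec_ring. }
  rewrite <- H; vec_ring. }
set (T := fun t => vadd (vscal t v) (vadd (vscal (C t) (cross w v)) (vscal (D t) (cross w (cross w v))))).
assert (HT : forall t, is_dvec T t (E t v)).
{ intros t; unfold T, E, turn.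
  eapply is_dvec_eq; [|apply is_dvec_add; [|apply is_dvec_add]; apply is_dvec_scal;
    [apply @is_derive_id | apply is_dvec_const | apply (expc_dC _ _ _ _ HE) | apply is_dvec_const
    |apply (expc_dD _ _ _ _ HE) | apply is_dvec_const]].
  change (@one R_AbsRing) with 1; vec_ring. }
set (Gam := fun s t => vadd (E t (g (s - lam * t))) (T t)).
set (U := fun s t => J (s - lam * t)).
assert (HU : open2 U) by now apply open2_travelling.
assert (Hsh : forall X t s x, is_dvec X (s - lam * t) x ->
  is_dvec (fun u => E t (X (u - lam * t))) s (E t x)).
{ intros X t s x HX; apply is_dvec_turn_const.
  eapply (is_dvec_ext_loc (fun u => X (1 * u + - lam * t))).
  { apply filter_forall; intros u; f_equal; ring. }
  eapply is_dvec_eq; [|apply is_dvec_affine;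
    replace (1 * s + - lam * t) with (s - lam * t) by ring; exact HX].
  vec_ring. }
assert (HG : forall n t s, U s t ->
  dvec_n (Datatypes.S n) (fun u => Gam u t) s = E t (dvec_n (Datatypes.S n) g (s - lam * t))).
{ induction n as [|n IH]; intros t s Hs.
  - apply is_dvec_unique; unfold Gam.
    eapply is_dvec_eq; [|apply is_dvec_add; [apply Hsh, (Hgd 0%nat _ Hs)|apply is_dvec_const]].
    vec_ring.
  - apply (is_dvec_unique (dvec_n (Datatypes.S n) (fun u => Gam u t))).
    eapply is_dvec_ext_loc; [|apply (Hsh (dvec_n (Datatypes.S n) g)), (Hgd _ _ Hs)].
    assert (Hl := locally_2d_1d_const_y _ _ _ (HU s t Hs)).
    revert Hl; apply filter_imp; intros u Hu; symmetry; now apply IH. }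
assert (Hk : forall s t, U s t ->
  curvature_nat (fun u => Gam u t) s = k (s - lam * t)).
{ intros s t Hs; unfold k, curvature_nat; rewrite (HG 2%nat t s Hs).
  unfold normsq, E; now rewrite (turn_inner w S C D HE). }
assert (HSm : vsmooth2 U Gam).
{ destruct (smooth1_exp_coefficients w S C D HE) as (SS & SC & SD).
  assert (Lt : forall f, smooth1 (fun _ => True) f -> smooth2 U (fun _ t => f t)).
  { intros f Hf; apply (smooth1_lift U (fun _ => True)); auto. }
  assert (Lc : forall x, vsmooth2 U (fun _ _ => x)).
  { intros x; split; [|split]; now apply smooth2_const. }
  assert (Lg : vsmooth2 U (fun s t => g (s - lam * t))).
  { destruct (smooth_on_dvec_n J g 0 (proj1 (proj1 Hg))) as (G1 & G2 & G3).
    assert (L : forall f, smooth1 J f -> smooth2 U (fun s t => f (s - lam * t))).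
    { intros f Hf; apply (smooth2_ext U (fun s t => f (1 * s + - lam * t + 0))); auto.
      - intros; f_equal; ring.
      - apply (smooth2_affine U J); auto.
        intros x y Hxy; replace (1 * x + - lam * y + 0) with (x - lam * y) by ring; exact Hxy. }
    split; [|split]; [exact (L _ G1) | exact (L _ G2) | exact (L _ G3)]. }
  assert (Lid : smooth1 (fun _ => True) (fun t => t)) by apply smooth1_id.
  assert (Lcr : forall V, vsmooth2 U V -> vsmooth2 U (fun s t => cross w (V s t))).
  { intros V HV; now apply vsmooth2_cross. }
  assert (Lsc : forall f V, smooth1 (fun _ => True) f -> vsmooth2 U V ->
    vsmooth2 U (fun s t => vscal (f t) (V s t))).
  { intros f V Hf HV; apply (vsmooth2_scal U (fun _ t => f t)); auto. }
  pose proof (Lcr _ Lg) as Lg1; pose proof (Lcr _ Lg1) as Lg2.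
  pose proof (Lsc _ _ SS Lg1) as A1; pose proof (Lsc _ _ SC Lg2) as A2.
  pose proof (Lsc _ _ Lid (Lc v)) as B0; pose proof (Lsc _ _ SC (Lc (cross w v))) as B1.
  pose proof (Lsc _ _ SD (Lc (cross w (cross w v)))) as B2.
  exact (vsmooth2_add U _ _ HU
    (vsmooth2_add U _ _ HU Lg (vsmooth2_add U _ _ HU A1 A2))
    (vsmooth2_add U _ _ HU B0 (vsmooth2_add U _ _ HU B1 B2))). }
exists Gam; split; [split; [|split]|split].
- now apply vsmooth2_iff.
- intros t.
  assert (HUt : forall s, U s t -> J (s - lam * t)) by auto.
  assert (Hnull : forall s, U s t -> normsq (dvec_n 1 (fun u => Gam u t) s) = 0).
  { intros s Hs; rewrite (HG 0%nat t s Hs); unfold normsq, E; rewrite (turn_inner w S C D HE).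
    apply (gram_tt J g Hg); auto. }
  assert (Hfut : forall s, U s t -> future_directed (dvec_n 1 (fun u => Gam u t) s)).
  { intros s Hs; rewrite (HG 0%nat t s Hs).
    pose proof Hg as ((_ & H) & _); destruct (H _ Hs) as (H1 & H2).
    now apply (turn_future w S C D HE). }
  assert (Hnn : forall s, U s t -> normsq (dvec_n 2 (fun u => Gam u t) s) = 1).
  { intros s Hs; rewrite (HG 1%nat t s Hs); unfold normsq, E; rewrite (turn_inner w S C D HE).
    apply (gram_nn J g Hg); auto. }
  split; [split|split].
  + exact (vsmooth2_slice1 U Gam t HSm).
  + intros s Hs; auto.
  + intros s Hs Hz.
    assert (H0 : normsq (dvec_n 2 (fun u => Gam u t) s) = 0); [|rewrite Hnn in H0 by auto; lra].
    apply (wedge_zero_normsq (dvec_n 1 (fun u => Gam u t) s)); auto.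
    * now destruct (Hfut s Hs).
    * rewrite (HG 0%nat t s Hs), (HG 1%nat t s Hs); unfold E; rewrite (turn_inner w S C D HE).
      apply (gram_tn J g HJ Hg); auto.
  + intros s Hs; unfold omega, mnorm; rewrite Hnn by auto; now rewrite !sqrt_1.
- intros s t Hs.
  apply is_dvec_unique.
  assert (Hgt : is_dvec (fun u => g (s - lam * u)) t (vscal (- lam) (frenet_t g (s - lam * t)))).
  { eapply (is_dvec_ext_loc (fun u => g (- lam * u + s))).
    { apply filter_forall; intros u; f_equal; ring. }
    apply is_dvec_affine.
    replace (- lam * t + s) with (s - lam * t) by ring; exact (Hgd 0%nat _ Hs). }
  eapply is_dvec_eq; [|apply is_dvec_add; [apply (is_dvec_turn w S C D HE), Hgt | apply HT]].
  rewrite Hk by auto; unfold frenet_t at 2, frenet_b.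
  rewrite (HG 0%nat t s Hs), (HG 2%nat t s Hs).
  replace (normsq (E t (dvec_n 3 g (s - lam * t)))) with (normsq (dvec_n 3 g (s - lam * t)))
    by (unfold normsq, E; now rewrite (turn_inner w S C D HE)).
  assert (Ladd : forall x y, vadd (E t x) (E t y) = E t (vadd x y)) by (intros; symmetry; apply turn_vadd).
  assert (Lsc : forall c x, vscal c (E t x) = E t (vscal c x)) by (intros; symmetry; apply turn_vscal).
  rewrite !Lsc, !Ladd, !Lsc, !Ladd; f_equal.
  transitivity (vadd (drift (s - lam * t)) (vscal (- lam) (frenet_t g (s - lam * t)))).
  + rewrite <- (Hv _ Hs); vec_ring.
  + unfold drift, comb, frenet_b, frenet_t; vec_ring.
- intros s Hs; unfold Gam, T; rewrite Rmult_0_r, Rminus_0_r.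
  unfold E; rewrite (turn_zero_param w S C D HE), (expc_C0 _ _ _ _ HE), (expc_D0 _ _ _ _ HE); vec_ring.
- exact Hk.
Qed.
End Travelling.

(** * Functions obtained by quadratures *)

(** Continuity is carried along because it is what makes primitives exist. *)
Definition quad (a b : Rbar) (f : R -> R) : Prop :=
  by_quadratures a b f /\ forall x, ooint a b x -> continuous f x.

Lemma quad_const (a b : Rbar) (c : R) : quad a b (fun _ => c).
Proof. split; [constructor | intros; apply continuous_const]. Qed.

Lemma quad_plus (a b : Rbar) (f g : R -> R) :
  quad a b f -> quad a b g -> quad a b (fun x => f x + g x).
Proof.
intros [H1 H2] [K1 K2]; split; [now apply bq_plus|].
intros x Hx; apply (continuous_plus (V := R_NormedModule)); auto.
Qed.

Lemma quad_mult (a b : Rbar) (f g : R -> R) :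
  quad a b f -> quad a b g -> quad a b (fun x => f x * g x).
Proof.
intros [H1 H2] [K1 K2]; split; [now apply bq_mult|].
intros x Hx; apply (continuous_mult (K := R_AbsRing)); auto.
Qed.

Lemma quad_inv (a b : Rbar) (f : R -> R) :
  quad a b f -> (forall x, ooint a b x -> f x <> 0) -> quad a b (fun x => / f x).
Proof.
intros [H1 H2] H0; split.
- apply (bq_ext a b (fun x => 1 / f x)).
  + apply bq_div; auto; constructor.
  + intros; unfold Rdiv; ring.
- intros x Hx; apply (continuous_comp f Rinv); auto.
  apply continuity_pt_filterlim, continuity_pt_inv; [apply continuity_pt_id | now apply H0].
Qed.

Lemma quad_ext (a b : Rbar) (f g : R -> R) :
  (forall x, ooint a b x -> f x = g x) -> quad a b f -> quad a b g.
Proof.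
intros Hfg [H1 H2]; split.
- apply (bq_ext a b f); auto; intros; symmetry; auto.
- intros x Hx; apply (continuous_ext_loc g f x); auto.
  generalize (open1_ooint a b x Hx); apply filter_imp; auto.
Qed.

Lemma quad_comp (a b c d : Rbar) (f g : R -> R) :
  quad a b f -> quad c d g -> (forall x, ooint a b x -> ooint c d (f x)) ->
  quad a b (fun x => g (f x)).
Proof.
intros [H1 H2] [K1 K2] H; split; [now apply (bq_comp a b c d)|].
intros x Hx; apply (continuous_comp f g); auto.
Qed.

Lemma quad_restrict (a b : Rbar) (f : R -> R) :
  quad m_infty p_infty f -> quad a b f.
Proof.
intros [H1 H2]; split; [|auto using ooint_all].
apply (bq_restrict m_infty p_infty a b f); auto using ooint_all.
Qed.

Lemma quad_sqrt (a b : Rbar) (f : R -> R) :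
  quad a b f -> (forall x, ooint a b x -> 0 < f x) -> quad a b (fun x => sqrt (f x)).
Proof.
intros Hf H0; apply (quad_comp a b 0 p_infty f sqrt); auto.
- split.
  + apply (bq_inverse 0 p_infty 0 p_infty (fun x => x * x)).
    * apply bq_mult; constructor.
    * intros x y [Hx _] [Hy _] E; simpl in Hx, Hy; nra.
    * intros y [Hy _]; simpl in Hy; split; [split; simpl; auto; now apply sqrt_lt_R0|].
      apply sqrt_sqrt; lra.
  + intros x [Hx _]; simpl in Hx; apply continuity_pt_filterlim, continuity_pt_sqrt; lra.
- intros x Hx; split; simpl; auto.
Qed.

Lemma quad_line_exp : quad m_infty p_infty exp.
Proof.
split; [constructor|]; intros x _; apply (ex_derive_continuous (V := R_NormedModule)).
auto_derive; trivial.
Qed.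

Lemma quad_line_sin : quad m_infty p_infty sin.
Proof.
split; [constructor|]; intros x _; apply (ex_derive_continuous (V := R_NormedModule)).
auto_derive; trivial.
Qed.

Lemma quad_line_cos : quad m_infty p_infty cos.
Proof.
split; [constructor|]; intros x _; apply (ex_derive_continuous (V := R_NormedModule)).
auto_derive; trivial.
Qed.

Lemma quad_id (a b : Rbar) : quad a b (fun x => x).
Proof. split; [constructor | intros; apply continuous_id]. Qed.

Lemma primitive_exists (a b : Rbar) (f : R -> R) (s0 : R) :
  ooint a b s0 -> (forall x, ooint a b x -> continuous f x) ->
  exists F, F s0 = 0 /\ forall x, ooint a b x -> is_derive F x (f x).
Proof.
intros Hs0 Hf; exists (fun x => RInt f s0 x); split; [apply (RInt_point (V := R_CompleteNormedModule))|].
intros x Hx; apply (is_derive_RInt f _ s0 x); auto.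
generalize (open1_ooint a b x Hx); apply filter_imp; intros y Hy.
apply (RInt_correct (V := R_CompleteNormedModule)), (ex_RInt_continuous (V := R_CompleteNormedModule)); intros z Hz.
apply Hf; destruct (Rle_dec s0 y).
- rewrite Rmin_left, Rmax_right in Hz by lra; now apply (ooint_convex a b s0 y).
- rewrite Rmin_right, Rmax_left in Hz by lra; apply (ooint_convex a b y s0); auto.
Qed.

Lemma quad_primitive (a b : Rbar) (f F : R -> R) :
  quad a b f -> (forall x, ooint a b x -> is_derive F x (f x)) -> quad a b F.
Proof.
intros [H1 H2] HF; split; [now apply (bq_primitive a b f)|].
intros x Hx; apply (ex_derive_continuous (V := R_NormedModule)); eexists; eauto.
Qed.

Lemma ooint_IVT (a b : Rbar) (f : R -> R) (x y v : R) :
  (forall s, ooint a b s -> continuous f s) -> ooint a b x -> ooint a b y ->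
  f x <= v <= f y -> exists s, ooint a b s /\ f s = v.
Proof.
intros Hf Hx Hy Hv.
assert (Hxy : forall s, Rmin x y <= s <= Rmax x y -> ooint a b s).
{ intros s Hs; destruct (Rle_dec x y).
  - rewrite Rmin_left, Rmax_right in Hs by lra; now apply (ooint_convex a b x y).
  - rewrite Rmin_right, Rmax_left in Hs by lra; apply (ooint_convex a b y x); auto. }
(* clamping extends the restriction of f continuously to the whole line *)
set (cl := fun s => Rmax (Rmin x y) (Rmin (Rmax x y) s)).
assert (Hm : Rmin x y <= Rmax x y) by (apply Rle_trans with x; [apply Rmin_l | apply Rmax_l]).
assert (Hcl : forall s, Rmin x y <= cl s <= Rmax x y).
{ intros s; unfold cl; split; [apply Rmax_l|].
  apply Rmax_lub; [exact Hm | apply Rmin_l]. }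
assert (Hcl2 : forall s, Rmin x y <= s <= Rmax x y -> cl s = s).
{ intros s Hs; unfold cl; rewrite (Rmin_right (Rmax x y)), Rmax_right by lra; lra. }
assert (Hx2 : Rmin x y <= x <= Rmax x y) by (split; [apply Rmin_l | apply Rmax_l]).
assert (Hy2 : Rmin x y <= y <= Rmax x y) by (split; [apply Rmin_r | apply Rmax_r]).
assert (Hclc : forall s, continuous cl s).
{ intros s; apply continuity_pt_filterlim; intros e He.
  exists e; split; [exact He|]; intros z [_ Hz].
  eapply Rle_lt_trans; [|exact Hz]; simpl; unfold Rdist, cl.
  unfold Rmax, Rmin, Rabs; repeat destruct Rle_dec; repeat destruct Rcase_abs; lra. }
destruct (IVT_gen (fun s => f (cl s)) x y v) as (s & Hs & E).
- intros s; apply continuity_pt_filterlim.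
  apply (continuous_comp cl f); auto.
- rewrite !Hcl2 by auto; rewrite Rmin_left, Rmax_right by lra; exact Hv.
- exists (cl s); split; auto.
Qed.

Lemma nonvanishing_sign (a b : Rbar) (f : R -> R) (s0 : R) :
  ooint a b s0 -> (forall s, ooint a b s -> continuous f s) ->
  (forall s, ooint a b s -> f s <> 0) ->
  exists e, e * e = 1 /\ forall s, ooint a b s -> 0 < e * f s.
Proof.
intros Hs0 Hf H0.
assert (H : forall x y, ooint a b x -> ooint a b y -> f x < 0 -> ~ 0 < f y).
{ intros x y Hx Hy Hx1 Hy1.
  destruct (ooint_IVT a b f x y 0 Hf Hx Hy) as (s & Hs & E); [lra|].
  now apply (H0 s). }
destruct (Rlt_dec (f s0) 0) as [Hn|Hn].
- exists (-1); split; [ring|]; intros s Hs.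
  pose proof (H s0 s Hs0 Hs Hn); pose proof (H0 s Hs); lra.
- exists 1; split; [ring|]; intros s Hs; rewrite Rmult_1_l.
  destruct (Rlt_dec 0 (f s)) as [|Hs1]; [assumption|exfalso].
  pose proof (H0 s Hs); pose proof (H0 s0 Hs0); apply (H s s0); auto; lra.
Qed.

Lemma ooint_open_neighbours (a b : Rbar) (s : R) :
  ooint a b s -> exists x y, x < s < y /\ ooint a b x /\ ooint a b y.
Proof.
intros Hs; destruct (locally_segment _ s (open1_ooint a b s Hs)) as [d Hd].
pose proof (cond_pos d); exists (s - d), (s + d); split; [lra|]; split; apply Hd; lra.
Qed.

(** The solution is the inverse of a primitive of the reciprocal speed. That
    primitive lives on the range of the solution, an open interval on which the
    speed is positive. *)
Lemma quad_autonomous (a b : Rbar) (th p : R -> R) (s0 : R) :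
  ooint a b s0 -> quad m_infty p_infty p ->
  (forall s, ooint a b s -> 0 < p (th s)) ->
  (forall s, ooint a b s -> is_derive th s (sqrt (p (th s)))) ->
  quad a b th.
Proof.
intros Hs0 Hp Hpos Hth.
assert (Hc : forall s, ooint a b s -> continuous th s).
{ intros s Hs; apply (ex_derive_continuous (V := R_NormedModule)); eexists; eauto. }
assert (Hinc : forall x y, ooint a b x -> ooint a b y -> x < y -> th x < th y).
{ intros x y Hx Hy Hxy.
  apply (incr_function_le th x y (fun s => sqrt (p (th s)))); try (simpl; lra); try auto.
  - intros s H1 H2; apply Hth, (ooint_convex a b x y); auto.
  - intros s H1 H2; apply sqrt_lt_R0, Hpos, (ooint_convex a b x y); auto. }
set (E := fun v => exists s, ooint a b s /\ th s = v).
set (c := Glb_Rbar E); set (d := Lub_Rbar E).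
assert (Hglb : is_glb_Rbar E c) by apply Glb_Rbar_correct.
assert (Hlub : is_lub_Rbar E d) by apply Lub_Rbar_correct.
assert (Hin : forall s, ooint a b s -> ooint c d (th s)).
{ intros s Hs; destruct (ooint_open_neighbours a b s Hs) as (x & y & Hxy & Hx & Hy).
  split.
  - apply Rbar_le_lt_trans with (th x); [|apply Hinc; auto; lra].
    apply (proj1 Hglb); now exists x.
  - apply Rbar_lt_le_trans with (th y); [apply Hinc; auto; lra|].
    apply (proj1 Hlub); now exists y. }
assert (Hout : forall v, ooint c d v -> E v).
{ intros v [Hv1 Hv2].
  assert (H1 : exists x, ooint a b x /\ th x <= v).
  { destruct (Classical_Prop.classic (exists x, ooint a b x /\ th x <= v)) as [|Hn]; [assumption|].
    exfalso; apply (Rbar_lt_not_le _ _ Hv1), (proj2 Hglb).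
    intros u (x & Hx & <-); simpl; apply Rnot_lt_le; intros Hlt; apply Hn.
    exists x; split; auto; lra. }
  assert (H2 : exists x, ooint a b x /\ v <= th x).
  { destruct (Classical_Prop.classic (exists x, ooint a b x /\ v <= th x)) as [|Hn]; [assumption|].
    exfalso; apply (Rbar_lt_not_le _ _ Hv2), (proj2 Hlub).
    intros u (x & Hx & <-); simpl; apply Rnot_lt_le; intros Hlt; apply Hn.
    exists x; split; auto; lra. }
  destruct H1 as (x & Hx & Hxv), H2 as (y & Hy & Hyv).
  apply (ooint_IVT a b th x y v); auto. }
assert (Hpcd : forall v, ooint c d v -> 0 < p v).
{ intros v Hv; destruct (Hout v Hv) as (s & Hs & <-); auto. }
assert (Hr : quad c d (fun v => / sqrt (p v))).
{ apply quad_inv; [apply quad_sqrt; auto using quad_restrict|].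
  intros v Hv; apply Rgt_not_eq, sqrt_lt_R0; auto. }
destruct (primitive_exists c d (fun v => / sqrt (p v)) (th s0)) as (F & HF0 & HF); auto.
{ apply Hr. }
assert (HFth : forall s, ooint a b s -> F (th s) - s = - s0).
{ intros s Hs.
  rewrite <- (Rminus_0_l s0), <- HF0.
  apply (is_derive_zero_const a b (fun s => F (th s) - s)); auto.
  intros u Hu; eapply is_derive_eq; [|apply (is_derive_minus (V := R_NormedModule));
    [apply (is_derive_comp F th); [apply HF; auto | apply Hth; auto] | apply @is_derive_id]].
  unfold minus, plus, opp, scal, one; simpl; unfold mult; simpl.
  field; apply Rgt_not_eq, sqrt_lt_R0; auto. }
split; [|exact Hc].
apply (bq_inverse a b c d (fun v => F v + s0)).
- apply bq_plus; [|constructor]; apply (bq_primitive c d _ F (proj1 Hr)); auto.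
- intros x y Hx Hy Exy.
  assert (HFinc : forall x y, ooint c d x -> ooint c d y -> x < y -> F x < F y).
  { intros u v Hu Hv Huv.
    apply (incr_function_le F u v (fun s => / sqrt (p s))); try (simpl; lra).
    - intros s H1 H2; apply HF, (ooint_convex c d u v); auto.
    - intros s H1 H2; apply Rinv_0_lt_compat, sqrt_lt_R0, Hpcd, (ooint_convex c d u v); auto. }
  destruct (Rtotal_order x y) as [Hlt|[Heq|Hlt]]; auto; exfalso.
  + pose proof (HFinc x y Hx Hy Hlt); lra.
  + pose proof (HFinc y x Hy Hx Hlt); lra.
- intros s Hs; split; auto; specialize (HFth s Hs); lra.
Qed.

(** * Travelling wave profiles by quadratures *)

Lemma is_derive_Rminus (f g : R -> R) (s l m : R) :
  is_derive f s l -> is_derive g s m -> is_derive (fun u => f u - g u) s (l - m).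
Proof. apply (is_derive_minus (V := R_NormedModule)). Qed.

Lemma continuous_of_derive (f : R -> R) (s l : R) : is_derive f s l -> continuous f s.
Proof. intros H; apply (ex_derive_continuous (V := R_NormedModule)); now exists l. Qed.

(** Uniqueness for a linear second order equation, by Gronwall's inequality
    for the energy [u^2 + v^2]. *)
Lemma linear_ode_unique (a b : Rbar) (u v q : R -> R) (s0 s : R) :
  (forall x, ooint a b x -> is_derive u x (v x)) ->
  (forall x, ooint a b x -> is_derive v x (q x * u x)) ->
  (forall x, ooint a b x -> continuous q x) ->
  ooint a b s0 -> ooint a b s -> u s0 = 0 -> v s0 = 0 -> u s = 0.
Proof.
intros Hu Hv Hq Hs0 Hs Hu0 Hv0.
set (m := Rmin s0 s); set (M := Rmax s0 s).
assert (HmM : m <= M) by (unfold m, M; apply Rle_trans with s0; [apply Rmin_l | apply Rmax_l]).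
assert (Hin : forall x, m <= x <= M -> ooint a b x).
{ intros x Hx; unfold m, M in Hx; destruct (Rle_dec s0 s).
  - rewrite Rmin_left, Rmax_right in Hx by lra; now apply (ooint_convex a b s0 s).
  - rewrite Rmin_right, Rmax_left in Hx by lra; apply (ooint_convex a b s s0); auto. }
destruct (bounded_on_segment q m M HmM) as (B & HB & HBq); [auto|].
set (e := fun x => u x * u x + v x * v x).
assert (He : forall x, ooint a b x -> is_derive e x (2 * u x * v x * (1 + q x))).
{ intros x Hx; eapply is_derive_eq; [|apply is_derive_Rplus; apply is_derive_Rmult; auto].
  simpl; ring. }
assert (Hbound : forall x, m <= x <= M -> Rabs (2 * u x * v x * (1 + q x)) <= (1 + B) * e x).
{ intros x Hx; specialize (HBq x Hx); rewrite Rabs_mult.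
  assert (H1 : Rabs (1 + q x) <= 1 + B).
  { eapply Rle_trans; [apply Rabs_triang|]; rewrite Rabs_R1; lra. }
  assert (H2 : Rabs (2 * u x * v x) <= e x).
  { unfold e; apply Rabs_le; split.
    - pose proof (Rle_0_sqr (u x + v x)) as H; unfold Rsqr in H; lra.
    - pose proof (Rle_0_sqr (u x - v x)) as H; unfold Rsqr in H; lra. }
  rewrite Rmult_comm; apply Rmult_le_compat; auto using Rabs_pos. }
assert (He0 : e s0 = 0) by (unfold e; rewrite Hu0, Hv0; ring).
(* weighted by an exponential decreasing away from s0, the energy decreases *)
assert (Hsg : exists sg, sg * (s - s0) = Rabs (s - s0)).
{ destruct (Rle_dec 0 (s - s0)).
  - exists 1; rewrite Rabs_pos_eq; lra.
  - exists (-1); rewrite Rabs_left; lra. }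
destruct Hsg as (sg & Hsg).
set (L := - sg * (1 + B)).
set (f := fun x => e x * exp (L * x)).
assert (Hf : forall x, ooint a b x ->
  is_derive f x ((2 * u x * v x * (1 + q x) + L * e x) * exp (L * x))).
{ intros x Hx; eapply is_derive_eq; [|apply is_derive_Rmult; [now apply He|]].
  2:{ apply (is_derive_comp exp (fun y => L * y)); [apply is_derive_exp|].
      auto_derive; [trivial | reflexivity]. }
  unfold scal; simpl; unfold mult; simpl; ring. }
destruct (MVT_gen f s0 s (fun x => (2 * u x * v x * (1 + q x) + L * e x) * exp (L * x)))
  as (c & Hc & E); fold m M.
{ intros x Hx; apply Hf, Hin; lra. }
{ intros x Hx; apply continuity_pt_filterlim; eapply continuous_of_derive, Hf, Hin; lra. }
fold m M in Hc; specialize (Hbound c Hc).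
assert (Hec : forall x, 0 <= e x) by (intros x; unfold e; nra).
assert (Hfs : f s <= 0).
{ assert (E0 : f s0 = 0) by (unfold f; rewrite He0; ring).
  rewrite E0, Rminus_0_r in E; rewrite E.
  replace ((2 * u c * v c * (1 + q c) + L * e c) * exp (L * c) * (s - s0))
    with ((2 * u c * v c * (1 + q c) * (s - s0) - (1 + B) * e c * (sg * (s - s0))) * exp (L * c))
    by (unfold L; ring).
  rewrite Hsg.
  assert (H1 : 2 * u c * v c * (1 + q c) * (s - s0) <= (1 + B) * e c * Rabs (s - s0)).
  { eapply Rle_trans; [apply Rle_abs|]; rewrite Rabs_mult.
    apply Rmult_le_compat_r; auto using Rabs_pos. }
  pose proof (exp_pos (L * c)); nra. }
unfold f in Hfs; pose proof (exp_pos (L * s)).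
assert (Hes : e s <= 0) by nra.
unfold e in Hes; nra.
Qed.

Section Profile.

Context (a b : Rbar) (k k1 : R -> R) (lam c1 o : R) (Ho : ooint a b o)
  (Hk : forall s, ooint a b s -> is_derive k s (k1 s))
  (Hk1 : forall s, ooint a b s -> is_derive k1 s (c1 + lam * k s - 3 * (k s * k s))).

Let kc (s : R) (Hs : ooint a b s) : continuous k s := continuous_of_derive k s _ (Hk s Hs).

(** Energy conservation makes the profile a motion in a cubic potential. *)
Definition cubic (c2 x : R) : R := - 2 * (x * (x * x)) + lam * (x * x) + 2 * c1 * x + c2.

(** The quotient of the cubic by the linear factor of a root [r]. *)
Definition cofactor (r x : R) : R :=
  - 2 * (x * x) + (lam - 2 * r) * x + (2 * c1 + lam * r - 2 * (r * r)).

Lemma profile_energy : exists c2, forall s, ooint a b s -> k1 s * k1 s = cubic c2 (k s).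
Proof.
exists (k1 o * k1 o - cubic 0 (k o)); intros s Hs.
assert (H : k1 s * k1 s - cubic 0 (k s) = k1 o * k1 o - cubic 0 (k o)).
{ apply (is_derive_zero_const a b (fun s => k1 s * k1 s - cubic 0 (k s))); auto.
  intros x Hx; pose proof (Hk x Hx) as D; pose proof (Hk1 x Hx) as D1.
  unfold cubic; eapply is_derive_eq; [|apply is_derive_Rminus;
    [apply is_derive_Rmult; exact D1 |
     apply is_derive_Rplus; [apply is_derive_Rplus; [apply is_derive_Rplus|]|]]].
  2:{ apply is_derive_scal, is_derive_Rmult; [exact D | apply is_derive_Rmult; exact D]. }
  2:{ apply is_derive_scal, is_derive_Rmult; exact D. }
  2:{ apply is_derive_scal; exact D. }
  2:{ apply @is_derive_const. }
  change (@zero R_NormedModule) with 0; simpl; ring. }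
unfold cubic in *; lra.
Qed.

Lemma cofactor_spec (c2 r x : R) : cubic c2 r = 0 -> cubic c2 x = (x - r) * cofactor r x.
Proof.
intros H; transitivity (cubic c2 x - cubic c2 r); [rewrite H; ring|].
unfold cubic, cofactor; ring.
Qed.

Lemma quad_line_cofactor (r : R) : quad m_infty p_infty (cofactor r).
Proof.
unfold cofactor; repeat first [apply quad_plus | apply quad_mult]; auto using quad_const, quad_id.
Qed.

Lemma quad_line_cubic (c2 : R) : quad m_infty p_infty (cubic c2).
Proof.
unfold cubic; repeat first [apply quad_plus | apply quad_mult]; auto using quad_const, quad_id.
Qed.

(** Here the sign of [k1] is constant, so [k1] is the square root of the cubic
    up to that sign. *)
Lemma profile_monotone :
  (forall s, ooint a b s -> k1 s <> 0) -> quad a b k /\ quad a b k1.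
Proof.
intros H0; destruct profile_energy as [c2 Hc2].
destruct (nonvanishing_sign a b k1 o Ho) as (e & He & Hpos); auto.
{ intros s Hs; exact (continuous_of_derive k1 s _ (Hk1 s Hs)). }
set (p := fun y => cubic c2 (e * y)).
assert (Hp : quad m_infty p_infty p).
{ apply (quad_comp m_infty p_infty m_infty p_infty (fun y => e * y) (cubic c2));
    auto using quad_line_cubic, ooint_all, quad_mult, quad_const, quad_id. }
assert (Hpk : forall s, ooint a b s -> p (e * k s) = (e * k1 s) * (e * k1 s)).
{ intros s Hs; unfold p; rewrite <- (Rmult_assoc e e), He, Rmult_1_l, <- Hc2 by auto.
  transitivity (e * e * (k1 s * k1 s)); [rewrite He; ring | ring]. }
assert (Hq : quad a b (fun s => e * k s)).
{ apply (quad_autonomous a b (fun s => e * k s) p o); auto.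
  - intros s Hs; rewrite Hpk by auto; specialize (Hpos s Hs); nra.
  - intros s Hs; rewrite Hpk, sqrt_square by (auto; apply Rlt_le, Hpos; auto).
    apply is_derive_scal; auto. }
assert (Hqk : quad a b k).
{ apply (quad_ext a b (fun s => e * (e * k s))).
  - intros s Hs; rewrite <- Rmult_assoc, He; ring.
  - apply quad_mult; auto using quad_const. }
split; auto.
apply (quad_ext a b (fun s => e * sqrt (p (e * k s)))).
- intros s Hs; rewrite Hpk, sqrt_square by (auto; apply Rlt_le, Hpos; auto).
  rewrite <- Rmult_assoc, He; ring.
- apply quad_mult; auto using quad_const.
  apply quad_sqrt.
  + apply (quad_comp a b m_infty p_infty (fun s => e * k s) p); auto using ooint_all.
  + intros s Hs; rewrite Hpk by auto; specialize (Hpos s Hs); nra.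
Qed.

(** When all critical values coincide with [r], the square root of the
    distance to [r], taken with a change of sign at the critical point, is
    monotone. It is smooth because it equals [k1 / sqrt (cofactor r k)] up to
    sign. *)
Lemma profile_one_critical_value (c2 r : R) :
  (forall s, ooint a b s -> k1 s * k1 s = cubic c2 (k s)) -> cubic c2 r = 0 ->
  (forall s, ooint a b s -> cofactor r (k s) <> 0) -> quad a b k /\ quad a b k1.
Proof.
intros Hc2 Hr H0.
assert (Hqd : forall x s l, is_derive k s l -> k s = x ->
   is_derive (fun s => cofactor r (k s)) s ((- 4 * x + (lam - 2 * r)) * l)).
{ intros x s l Hl <-; unfold cofactor; eapply is_derive_eq;
    [|apply is_derive_Rplus; [apply is_derive_Rplus|]].
  2:{ apply is_derive_scal, is_derive_Rmult; exact Hl. }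
  2:{ apply is_derive_scal; exact Hl. }
  2:{ apply @is_derive_const. }
  change (@zero R_NormedModule) with 0; ring. }
destruct (nonvanishing_sign a b (fun s => cofactor r (k s)) o Ho) as (e & He & Hpos); auto.
{ intros s Hs; eapply continuous_of_derive, Hqd; [apply Hk; auto | reflexivity]. }
set (q := fun s => e * cofactor r (k s)).
change (forall s, ooint a b s -> 0 < q s) in Hpos.
set (y := fun s => e * k1 s * / sqrt (q s)).
assert (Hs0 : forall s, ooint a b s -> 0 < sqrt (q s)) by (intros; apply sqrt_lt_R0; auto).
assert (Hss : forall s, ooint a b s -> sqrt (q s) * sqrt (q s) = q s).
{ intros s Hs; apply sqrt_sqrt, Rlt_le; auto. }
assert (Hy2 : forall s, ooint a b s -> k s = r + e * (y s * y s)).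
{ intros s Hs; unfold y.
  transitivity (r + e * (e * e * (k1 s * k1 s) * / (sqrt (q s) * sqrt (q s)))).
  - rewrite Hss, He, Hc2, (cofactor_spec c2 r) by auto.
    pose proof (Hpos s Hs) as Hp; unfold q; cbv beta in Hp.
    assert (cofactor r (k s) <> 0) by auto.
    assert (e <> 0) by (intros Z; rewrite Z in He; lra).
    field; auto.
  - specialize (Hs0 s Hs); field; lra. }
set (p := fun x => / 4 * (e * cofactor r (r + e * (x * x)))).
assert (Hp : quad m_infty p_infty p).
{ apply quad_mult; auto using quad_const; apply quad_mult; auto using quad_const.
  apply (quad_comp m_infty p_infty m_infty p_infty (fun x => r + e * (x * x)) (cofactor r));
    auto using quad_line_cofactor, ooint_all, quad_plus, quad_mult, quad_const, quad_id. }
assert (Hpy : forall s, ooint a b s -> p (y s) = (/ 2 * sqrt (q s)) * (/ 2 * sqrt (q s))).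
{ intros s Hs; unfold p; rewrite <- Hy2 by auto.
  transitivity (/ 4 * (sqrt (q s) * sqrt (q s))); [rewrite Hss by auto; reflexivity | field]. }
assert (Hyd : forall s, ooint a b s -> is_derive y s (sqrt (p (y s)))).
{ intros s Hs; rewrite Hpy, sqrt_square by (auto; specialize (Hs0 s Hs); auto; lra).
  pose proof (Hk s Hs) as D; pose proof (Hk1 s Hs) as D1.
  pose proof (Hqd (k s) s _ D eq_refl) as Dq.
  assert (Dq2 : is_derive q s (e * ((- 4 * k s + (lam - 2 * r)) * k1 s))) by now apply is_derive_scal.
  pose proof (is_derive_sqrt q s _ Dq2 (Hpos s Hs)) as Ds.
  assert (Hn : sqrt (q s) <> 0) by (specialize (Hs0 s Hs); lra).
  pose proof (is_derive_inv _ s _ Ds Hn) as Di.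
  unfold y; eapply is_derive_eq; [|apply is_derive_Rmult; [apply is_derive_scal; exact D1 | exact Di]].
  simpl; unfold y in Hy2; clear Ds Di Dq2.
  pose proof (Hss s Hs) as Hq2; pose proof (Hc2 s Hs) as HE; rewrite (cofactor_spec c2 r) in HE by auto.
  set (z := sqrt (q s)) in *.
  apply (Rmult_eq_reg_r (2 * (z * z * z)));
    [|repeat apply Rmult_integral_contrapositive_currified; lra].
  transitivity (2 * e * (c1 + lam * k s - 3 * (k s * k s)) * (z * z)
     - e * e * (- 4 * k s + (lam - 2 * r)) * (k1 s * k1 s)); [field; lra|].
  transitivity (z * z * (z * z)); [|field].
  rewrite HE, Hq2; unfold q, cofactor; ring. }
assert (Hqy : quad a b y) by (apply (quad_autonomous a b y p o); auto; intros s Hs;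
  rewrite Hpy by auto; specialize (Hs0 s Hs); nra).
assert (Hqk : quad a b k).
{ apply (quad_ext a b (fun s => r + e * (y s * y s))); [intros; symmetry; auto|].
  auto using quad_plus, quad_mult, quad_const. }
split; auto.
apply (quad_ext a b (fun s => e * y s * sqrt (q s))).
- intros s Hs; unfold y.
  transitivity (e * e * k1 s); [specialize (Hs0 s Hs); field; lra | rewrite He; ring].
- assert (Hqq : quad a b q).
  { apply quad_mult; auto using quad_const.
    apply (quad_comp a b m_infty p_infty k (cofactor r)); auto using quad_line_cofactor, ooint_all. }
  apply quad_mult; auto using quad_mult, quad_const, quad_sqrt.
Qed.

(** Let [r3] be the third root of the cubic. It lies below the two critical
    values, so the phase with derivative [sqrt (2 (k - r3))] increases; in terms
    of it the profile and its derivative, suitably normalized, rotate uniformly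
    and are therefore a cosine and a sine. *)
Lemma profile_two_critical_values (c2 r0 r1 s0 s1 : R) :
  (forall s, ooint a b s -> k1 s * k1 s = cubic c2 (k s)) ->
  ooint a b s0 -> ooint a b s1 -> k s0 = r0 -> k s1 = r1 -> k1 s0 = 0 -> k1 s1 = 0 ->
  cofactor r0 r0 <> 0 -> r0 < r1 -> quad a b k /\ quad a b k1.
Proof.
intros Hc2 Hs0 Hs1 Hr0 Hr1 Hz0 Hz1 Hnd Hlt.
set (r3 := lam / 2 - r0 - r1).
assert (P0 : cubic c2 r0 = 0) by (rewrite <- Hr0, <- Hc2, Hz0 by auto; ring).
assert (P1 : cubic c2 r1 = 0) by (rewrite <- Hr1, <- Hc2, Hz1 by auto; ring).
assert (Q1 : cofactor r0 r1 = 0).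
{ rewrite (cofactor_spec c2 r0) in P1 by auto.
  apply Rmult_integral in P1; destruct P1; [lra | assumption]. }
assert (HQ : forall x, cofactor r0 x = - 2 * ((x - r1) * (x - r3))).
{ intros x; transitivity (cofactor r0 x - cofactor r0 r1); [rewrite Q1; ring|].
  unfold cofactor, r3; field. }
assert (HP : forall x, cubic c2 x = - 2 * ((x - r0) * ((x - r1) * (x - r3)))).
{ intros x; rewrite (cofactor_spec c2 r0), HQ by auto; ring. }
assert (Hnn : forall s, ooint a b s -> 0 <= cubic c2 (k s)).
{ intros s Hs; rewrite <- Hc2 by auto; nra. }
(* the cubic is nonnegative along the profile, and negative just above r0
   unless the third root lies below r0 *)
assert (H30 : r3 < r0).
{ destruct (Rlt_dec r3 r0) as [|Hn]; [assumption|exfalso].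
  assert (Hne : r3 <> r0) by (intros E; apply Hnd; rewrite HQ, E; ring).
  set (m := (r0 + Rmin r1 r3) / 2).
  assert (Hm : r0 < m /\ m < r1 /\ m < r3).
  { unfold m, Rmin; destruct Rle_dec; lra. }
  destruct (ooint_IVT a b k s0 s1 m kc Hs0 Hs1) as (s & Hs & Es); [lra|].
  pose proof (Hnn s Hs) as Hneg; rewrite Es, HP in Hneg.
  assert (0 < (m - r0) * ((r1 - m) * (r3 - m))) by (repeat apply Rmult_lt_0_compat; lra).
  lra. }
assert (Hlow : forall s, ooint a b s -> r0 <= k s).
{ intros s Hs; destruct (Rle_dec r0 (k s)) as [|Hn]; [assumption|exfalso].
  set (m := (Rmax (k s) r3 + r0) / 2).
  assert (Hm : k s < m /\ m < r0 /\ r3 < m).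
  { unfold m, Rmax; destruct Rle_dec; lra. }
  destruct (ooint_IVT a b k s s0 m kc Hs Hs0) as (u & Hu & Eu); [lra|].
  pose proof (Hnn u Hu) as Hneg; rewrite Eu, HP in Hneg.
  assert (0 < (r0 - m) * ((r1 - m) * (m - r3))) by (repeat apply Rmult_lt_0_compat; lra).
  lra. }
set (psi := fun s => sqrt (2 * (k s - r3))).
assert (Hpos : forall s, ooint a b s -> 0 < 2 * (k s - r3)).
{ intros s Hs; specialize (Hlow s Hs); lra. }
assert (Hpsi : forall s, ooint a b s -> 0 < psi s) by (intros; apply sqrt_lt_R0; auto).
assert (Hpsi2 : forall s, ooint a b s -> psi s * psi s = 2 * (k s - r3)).
{ intros s Hs; apply sqrt_sqrt, Rlt_le; auto. }
assert (Hpsid : forall s, ooint a b s -> is_derive psi s (k1 s / psi s)).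
{ intros s Hs; specialize (Hpsi s Hs).
  eapply is_derive_eq; [|apply is_derive_sqrt; [|now apply Hpos]].
  2:{ apply is_derive_scal, is_derive_Rminus; [now apply Hk | apply @is_derive_const]. }
  change (@zero R_NormedModule) with 0; change (sqrt _) with (psi s); field; lra. }
destruct (primitive_exists a b psi s1 Hs1) as (phi & Hphi0 & Hphi).
{ intros s Hs; eapply continuous_of_derive, Hpsid; auto. }
set (A := (r0 + r1) / 2); set (B := (r1 - r0) / 2).
assert (HB : 0 < B) by (unfold B; lra).
set (cc := fun s => / B * (k s - A)); set (dd := fun s => / B * k1 s * / psi s).
assert (Hcc : forall s, ooint a b s -> is_derive cc s (psi s * dd s)).
{ intros s Hs; specialize (Hpsi s Hs); eapply is_derive_eq;
    [|apply is_derive_scal, is_derive_Rminus; [now apply Hk | apply @is_derive_const]].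
  change (@zero R_NormedModule) with 0; unfold dd; field; lra. }
assert (Hdd : forall s, ooint a b s -> is_derive dd s (- psi s * cc s)).
{ intros s Hs; pose proof (Hpsi s Hs) as Hp; eapply is_derive_eq;
    [|apply is_derive_Rmult; [apply is_derive_scal; now apply Hk1
                             |apply is_derive_inv; [now apply Hpsid | lra]]].
  simpl; unfold cc.
  pose proof (Hpsi2 s Hs) as E2; pose proof (Hc2 s Hs) as EE; rewrite HP in EE.
  assert (Ec1 : c1 = - (r0 * r1 + (r0 + r1) * r3)).
  { unfold cofactor in Q1; unfold r3; nra. }
  assert (Elam : lam = 2 * (r0 + r1 + r3)) by (unfold r3; field).
  set (z := psi s) in *.
  apply (Rmult_eq_reg_r (B * (z * z * z)));
    [|repeat apply Rmult_integral_contrapositive_currified; lra].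
  transitivity ((c1 + lam * k s - 3 * (k s * k s)) * (z * z) - k1 s * k1 s); [field; lra|].
  transitivity (- (z * z) * (z * z) * (k s - A)); [|field; lra].
  rewrite EE, E2, Ec1, Elam; unfold A; field. }
assert (HX : forall s, ooint a b s -> cc s * cos (phi s) - dd s * sin (phi s) = 1
                              /\ cc s * sin (phi s) + dd s * cos (phi s) = 0).
{ assert (Hcos : forall s, ooint a b s -> is_derive (fun s => cos (phi s)) s (- psi s * sin (phi s))).
  { intros s Hs; eapply is_derive_eq; [|apply (is_derive_comp cos phi); [apply is_derive_cos | now apply Hphi]].
    unfold scal; simpl; unfold mult; simpl; ring. }
  assert (Hsin : forall s, ooint a b s -> is_derive (fun s => sin (phi s)) s (psi s * cos (phi s))).
  { intros s Hs; eapply is_derive_eq; [|apply (is_derive_comp sin phi); [apply is_derive_sin | now apply Hphi]].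
    unfold scal; simpl; unfold mult; simpl; ring. }
  assert (Ec : cc s1 = 1) by (unfold cc, A; rewrite Hr1; unfold B; field; lra).
  assert (Ed : dd s1 = 0) by (unfold dd; rewrite Hz1; ring).
  intros s Hs; split.
  - rewrite (is_derive_zero_const a b (fun s => cc s * cos (phi s) - dd s * sin (phi s))) with (y := s1); auto.
    + rewrite Ec, Ed, Hphi0, cos_0; ring.
    + intros u Hu; eapply is_derive_eq; [|apply is_derive_Rminus; apply is_derive_Rmult; auto].
      simpl; ring.
  - rewrite (is_derive_zero_const a b (fun s => cc s * sin (phi s) + dd s * cos (phi s))) with (y := s1); auto.
    + rewrite Ed, Hphi0, sin_0; ring.
    + intros u Hu; eapply is_derive_eq; [|apply is_derive_Rplus; apply is_derive_Rmult; auto].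
      simpl; ring. }
assert (Hkphi : forall s, ooint a b s -> k s = A + B * cos (phi s) /\ k1 s = - B * psi s * sin (phi s)).
{ intros s Hs; destruct (HX s Hs) as [X1 X2]; pose proof (sin2_cos2 (phi s)) as T; unfold Rsqr in T.
  assert (E1 : cc s = cos (phi s)).
  { transitivity (cc s * (sin (phi s) * sin (phi s) + cos (phi s) * cos (phi s))); [rewrite T; ring|].
    transitivity ((cc s * cos (phi s) - dd s * sin (phi s)) * cos (phi s)
      + (cc s * sin (phi s) + dd s * cos (phi s)) * sin (phi s)); [ring | rewrite X1, X2; ring]. }
  assert (E2 : dd s = - sin (phi s)).
  { transitivity (dd s * (sin (phi s) * sin (phi s) + cos (phi s) * cos (phi s))); [rewrite T; ring|].
    transitivity (- (cc s * cos (phi s) - dd s * sin (phi s)) * sin (phi s)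
      + (cc s * sin (phi s) + dd s * cos (phi s)) * cos (phi s)); [ring | rewrite X1, X2; ring]. }
  specialize (Hpsi s Hs); split.
  - rewrite <- E1; unfold cc; field; lra.
  - replace (sin (phi s)) with (- dd s) by (rewrite E2; ring); unfold dd; field; lra. }
set (p := fun x => 2 * (A + B * cos x - r3)).
assert (Hp : quad m_infty p_infty p).
{ apply (quad_ext m_infty p_infty (fun x => 2 * (A + (B * cos x + - r3)))); [intros; unfold p; ring|].
  auto using quad_mult, quad_plus, quad_const, quad_line_cos. }
assert (Hpp : forall s, ooint a b s -> p (phi s) = 2 * (k s - r3)).
{ intros s Hs; unfold p; rewrite (proj1 (Hkphi s Hs)); ring. }
assert (Hqphi : quad a b phi).
{ apply (quad_autonomous a b phi p o); auto.
  - intros s Hs; rewrite Hpp; auto.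
  - intros s Hs; rewrite Hpp by auto; apply Hphi; auto. }
assert (Hqk : quad a b k).
{ apply (quad_ext a b (fun s => A + B * cos (phi s))); [intros s Hs; symmetry; apply Hkphi; auto|].
  apply quad_plus; auto using quad_const; apply quad_mult; auto using quad_const.
  apply (quad_comp a b m_infty p_infty phi cos); auto using quad_line_cos, ooint_all. }
split; auto.
apply (quad_ext a b (fun s => - B * psi s * sin (phi s))); [intros s Hs; symmetry; apply Hkphi; auto|].
apply quad_mult; [apply quad_mult; auto using quad_const|].
- apply quad_sqrt; auto.
  apply (quad_ext a b (fun s => 2 * (k s + - r3))); [intros; ring|].
  auto using quad_mult, quad_plus, quad_const.
- apply (quad_comp a b m_infty p_infty phi sin); auto using quad_line_sin, ooint_all.
Qed.

Theorem profile_quad : quad a b k /\ quad a b k1.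
Proof.
destruct profile_energy as [c2 Hc2].
assert (Hcr : forall s, cofactor (k s) (k s) = 2 * (c1 + lam * k s - 3 * (k s * k s))).
{ intros s; unfold cofactor; ring. }
destruct (Classical_Prop.classic (exists s, ooint a b s /\ k1 s = 0 /\
  c1 + lam * k s - 3 * (k s * k s) = 0)) as [(s0 & Hs0 & Hz0 & Hd0)|Hnd'].
- (* a degenerate critical point: the profile is constant *)
  assert (H1 : forall s, ooint a b s -> k1 s = 0).
  { intros s Hs.
    apply (linear_ode_unique a b k1 (fun s => c1 + lam * k s - 3 * (k s * k s))
             (fun s => lam - 6 * k s) s0 s); auto.
    - intros x Hx; pose proof (Hk x Hx) as D; eapply is_derive_eq; [|apply is_derive_Rminus;
        [apply is_derive_Rplus; [apply @is_derive_const | apply is_derive_scal; exact D]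
        |apply is_derive_scal, is_derive_Rmult; exact D]].
      change (@zero R_NormedModule) with 0; ring.
    - intros x Hx; apply (continuous_of_derive _ x (0 - 6 * k1 x)).
      apply is_derive_Rminus; [apply @is_derive_const | apply is_derive_scal; auto]. }
  split.
  + apply (quad_ext a b (fun _ => k s0)); auto using quad_const.
    intros s Hs; apply (is_derive_zero_const a b k); auto.
    intros x Hx; rewrite <- (H1 x Hx); auto.
  + apply (quad_ext a b (fun _ => 0)); auto using quad_const.
    intros s Hs; symmetry; auto.
- assert (Hnd : forall s, ooint a b s -> k1 s = 0 -> cofactor (k s) (k s) <> 0).
  { intros s Hs Hz E; apply Hnd'; exists s; rewrite Hcr in E; split; [|split]; auto; lra. }
  destruct (Classical_Prop.classic (exists s, ooint a b s /\ k1 s = 0)) as [(s0 & Hs0 & Hz0)|Hn].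
  2:{ apply profile_monotone; intros s Hs Hz; apply Hn; now exists s. }
  set (r := k s0).
  destruct (Classical_Prop.classic (exists s, ooint a b s /\ k1 s = 0 /\ k s <> r))
    as [(s1 & Hs1 & Hz1 & Hne)|Hall].
  + destruct (Rtotal_order r (k s1)) as [Hlt|[Heq|Hlt]]; [|congruence|].
    * apply (profile_two_critical_values c2 r (k s1) s0 s1); auto; apply Hnd; auto.
    * apply (profile_two_critical_values c2 (k s1) r s1 s0); auto; apply Hnd; auto.
  + apply (profile_one_critical_value c2 r); auto.
    * unfold r; rewrite <- Hc2, Hz0 by auto; ring.
    * intros s Hs E.
      assert (Hz : k1 s = 0).
      { apply Rsqr_0_uniq; unfold Rsqr; rewrite Hc2, (cofactor_spec c2 r), E by
          (auto; unfold r; rewrite <- Hc2, Hz0 by auto; ring); ring. }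
      destruct (Req_dec (k s) r) as [Er|Er]; [|apply Hall; exists s; auto].
      apply (Hnd s Hs Hz); rewrite Er at 1; exact E.
Qed.

End Profile.

(** * Integration of the frame *)

Lemma quad_opp (a b : Rbar) (f : R -> R) : quad a b f -> quad a b (fun x => - f x).
Proof.
intros Hf; apply (quad_ext a b (fun x => -1 * f x)); [intros; ring|].
auto using quad_mult, quad_const.
Qed.

Lemma quad_exp (a b : Rbar) (f : R -> R) : quad a b f -> quad a b (fun x => exp (f x)).
Proof. intros Hf; apply (quad_comp a b m_infty p_infty f exp); auto using quad_line_exp, ooint_all. Qed.

(** Undoing the rotation about [w] by the angle [psi], a primitive of [mu],
    leaves a scalar linear equation in the plane spanned by the initial value
    and [w], which two more quadratures solve. *)
Lemma quad_transport (a b : Rbar) (o : R) (w : vec) (T : R -> vec) (al be mu : R -> R) :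
  ooint a b o -> quad a b al -> quad a b be -> quad a b mu ->
  (forall s, ooint a b s -> is_dvec T s
     (vadd (vadd (vscal (al s) w) (vscal (be s) (T s))) (vscal (mu s) (cross w (T s))))) ->
  forall f, quad a b (fun s => inner (T s) f).
Proof.
intros Ho Hal Hbe Hmu HT f.
destruct (exp_coefficients_exist (normsq w)) as (S & C & D & HE).
destruct (primitive_exists a b mu o Ho (proj2 Hmu)) as (psi & _ & Hpsi).
destruct (primitive_exists a b be o Ho (proj2 Hbe)) as (B & _ & HB).
assert (Qpsi : quad a b psi) by now apply (quad_primitive a b mu).
assert (QB : quad a b B) by now apply (quad_primitive a b be).
assert (QaB : quad a b (fun s => exp (- B s) * al s)) by auto using quad_mult, quad_exp, quad_opp.
destruct (primitive_exists a b _ o Ho (proj2 QaB)) as (G & _ & HG).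
assert (QG : quad a b G) by now apply (quad_primitive a b _ G QaB).
set (E := turn w S C).
assert (Ew : forall t, E t w = w).
{ intros t; unfold E, turn; replace (cross w w) with vzero by vec_ring; vec_ring. }
set (Z := fun s => vadd (vscal (exp (- B s)) (E (- psi s) (T s))) (vscal (- G s) w)).
assert (HZ : forall s, ooint a b s -> Z s = Z o).
{ intros s Hs; apply (is_dvec_zero_const a b Z); auto; intros u Hu; unfold Z.
  assert (He : is_derive (fun s => exp (- B s)) u (- be u * exp (- B u))).
  { eapply is_derive_eq; [|apply (is_derive_comp exp (fun s => - B s));
      [apply is_derive_exp | apply is_derive_Ropp, HB; auto]].
    unfold scal; simpl; unfold mult; simpl; ring. }
  eapply is_dvec_eq; [|apply is_dvec_add; apply is_dvec_scal;
    [exact He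
    |apply (is_dvec_turn_along w S C D HE (fun s => - psi s)); [apply is_derive_Ropp; now apply Hpsi | now apply HT]
    |apply is_derive_Ropp; now apply HG | apply is_dvec_const]].
  fold E; unfold E; rewrite !turn_vadd, !turn_vscal; fold E; rewrite Ew.
  vec_ring. }
assert (HTs : forall s, ooint a b s ->
  T s = vscal (exp (B s)) (vadd (E (psi s) (Z o)) (vscal (G s) w))).
{ intros s Hs; rewrite <- (HZ s Hs); unfold Z, E.
  rewrite turn_vadd, !turn_vscal; change (turn w S C) with E; rewrite Ew.
  replace (E (psi s) (E (- psi s) (T s))) with (T s)
    by (symmetry; rewrite <- (Ropp_involutive (psi s)) at 1; apply (turn_neg w S C D HE)).
  pose proof (exp_plus (B s) (- B s)) as H; rewrite Rplus_opp_r, exp_0 in H.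
  transitivity (vscal (exp (B s) * exp (- B s)) (T s)); [rewrite <- H|]; vec_ring. }
set (z0 := Z o) in *.
apply (quad_ext a b (fun s => exp (B s) * ((inner z0 f + (S (psi s) * inner (cross w z0) f
  + C (psi s) * inner (cross w (cross w z0)) f)) + G s * inner w f))).
- intros s Hs; rewrite (HTs s Hs); unfold E, turn.
  rewrite inner_vscal_l, !inner_vadd_l, !inner_vscal_l; reflexivity.
- assert (QS : quad a b (fun s => S (psi s))).
  { apply (quad_comp a b m_infty p_infty psi S); auto using ooint_all.
    split; [apply (expc_bqS _ _ _ _ HE)|].
    intros x _; eapply continuous_of_derive, (expc_dS _ _ _ _ HE). }
  assert (QC : quad a b (fun s => C (psi s))).
  { apply (quad_comp a b m_infty p_infty psi C); auto using ooint_all.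
    split; [apply (expc_bqC _ _ _ _ HE)|].
    intros x _; eapply continuous_of_derive, (expc_dC _ _ _ _ HE). }
  auto 20 using quad_mult, quad_plus, quad_const, quad_exp.
Qed.

Section FrameIntegration.

Context (a b : Rbar) (g : R -> vec) (o : R) (Ho : ooint a b o)
  (Hg : natural_null (ooint a b) g) (Qk : quad a b (curvature_nat g))
  (W : vec) (x y z : R -> R) (Qx : quad a b x) (Qy : quad a b y) (Qz : quad a b z)
  (HW : forall s, ooint a b s ->
     comb (frenet_t g s) (frenet_n g s) (frenet_b g s) (x s) (y s) (z s) = W)
  (HW0 : W <> vzero).

Let J := ooint a b.
Let HJ : open1 J := open1_ooint a b.
Let k := curvature_nat g.
Let sg := orient g o.

Lemma sg_sqr : sg * sg = 1.
Proof. now apply (orient_sqr J g HJ Hg). Qed.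

Lemma constant_normsq (s : R) : J s -> normsq W = y s * y s - 2 * (x s * z s).
Proof. intros Hs; rewrite <- (HW s Hs); unfold normsq; rewrite (inner_comb J g HJ Hg) by auto; ring. Qed.

Lemma constant_cross_t (s : R) : J s ->
  cross W (frenet_t g s) = vscal sg (comb (frenet_t g s) (frenet_n g s) (frenet_b g s) (y s) (z s) 0).
Proof.
intros Hs; pose proof (frenet_frame J g HJ Hg s Hs) as Hf.
rewrite <- (HW s Hs); unfold sg; rewrite (orient_const a b g o s) by auto; unfold orient.
set (t := frenet_t g s) in *; set (n := frenet_n g s) in *; set (bb := frenet_b g s) in *.
unfold comb; rewrite !cross_vadd_l, !cross_vscal_l.
rewrite (cross_anti n t), (frame_cross_tn t n bb Hf), (frame_cross_bt t n bb Hf).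
replace (cross t t) with vzero by vec_ring.
set (d := det3 t n bb) in *; vec_ring.
Qed.

Lemma constant_cross_b (s : R) : J s ->
  cross W (frenet_b g s) = vscal sg (comb (frenet_t g s) (frenet_n g s) (frenet_b g s) 0 (- x s) (- y s)).
Proof.
intros Hs; pose proof (frenet_frame J g HJ Hg s Hs) as Hf.
rewrite <- (HW s Hs); unfold sg; rewrite (orient_const a b g o s) by auto; unfold orient.
set (t := frenet_t g s) in *; set (n := frenet_n g s) in *; set (bb := frenet_b g s) in *.
unfold comb; rewrite !cross_vadd_l, !cross_vscal_l.
rewrite (cross_anti t bb), (frame_cross_bt t n bb Hf), (frame_cross_nb t n bb Hf).
replace (cross bb bb) with vzero by vec_ring.
set (d := det3 t n bb) in *; vec_ring.
Qed.

(** A timelike [W] is not orthogonal to any null vector, so the tangent itself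
    is transported along [W]. *)
Lemma quad_tangent_timelike :
  normsq W < 0 -> forall f, quad a b (fun s => inner (frenet_t g s) f).
Proof.
intros Hneg.
assert (Hz : forall s, J s -> z s <> 0).
{ intros s Hs E; rewrite (constant_normsq s Hs), E in Hneg; nra. }
assert (Qiz : quad a b (fun s => / z s)) by now apply quad_inv.
apply (quad_transport a b o W (frenet_t g) (fun _ => 0) (fun s => - y s * / z s)
  (fun s => sg * / z s)); auto using quad_const, quad_mult, quad_opp.
intros s Hs; eapply is_dvec_eq; [|apply (is_dvec_frenet_t J g Hg s Hs)].
rewrite constant_cross_t by auto; pose proof sg_sqr as Hsg; specialize (Hz s Hs).
set (t := frenet_t g s); set (n := frenet_n g s); set (bb := frenet_b g s); unfold comb.
transitivity (vadd (vscal (- y s * / z s) t) (vadd (vscal (sg * sg * y s * / z s) t)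
  (vscal (sg * sg * (z s * / z s)) n))); [|vec_ring].
rewrite Hsg, Rinv_r by auto; vec_ring.
Qed.

(** Otherwise [W] is never proportional to the timelike vector [t + b], which
    is transported along [W] and recovers the tangent algebraically. *)
Lemma quad_tangent_not_timelike :
  0 <= normsq W -> forall f, quad a b (fun s => inner (frenet_t g s) f).
Proof.
intros Hpos f.
set (N := fun s => (x s - z s) * (x s - z s) + 2 * (y s * y s)).
(* N vanishes exactly where W is proportional to t + b *)
assert (HN : forall s, J s -> N s <> 0).
{ intros s Hs E; unfold N in E; rewrite (constant_normsq s Hs) in Hpos.
  assert (Hy : y s = 0) by nra; assert (Hxz : x s = z s) by nra.
  rewrite Hy, Hxz in Hpos; assert (Hz : z s = 0) by nra.
  apply HW0; rewrite <- (HW s Hs), Hxz, Hy, Hz; unfold comb; vec_ring. }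
assert (QN : quad a b (fun s => / N s)).
{ apply quad_inv; auto; apply (quad_ext a b (fun s =>
    (x s + - z s) * (x s + - z s) + 2 * (y s * y s))); [intros; reflexivity|].
  auto 10 using quad_plus, quad_mult, quad_opp, quad_const. }
set (T := fun s => vadd (frenet_t g s) (frenet_b g s)).
set (h := fun s => (1 + - (2 * k s)) * / N s).
assert (Qh : quad a b h) by (unfold h; auto 10 using quad_plus, quad_mult, quad_opp, quad_const).
assert (QT : forall f, quad a b (fun s => inner (T s) f)).
{ apply (quad_transport a b o W T (fun s => 2 * (h s * y s)) (fun s => - (h s * (y s * (x s + z s))))
    (fun s => sg * (h s * (z s + - x s)))); auto 10 using quad_plus, quad_mult, quad_opp, quad_const.
  intros s Hs; eapply is_dvec_eq; [|apply is_dvec_add;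
    [apply (is_dvec_frenet_t J g Hg s Hs) | apply (is_dvec_frenet_b J g HJ Hg s Hs)]].
  unfold T; rewrite cross_vadd_r, constant_cross_t, constant_cross_b by auto.
  pose proof sg_sqr as Hsg; specialize (HN s Hs).
  rewrite <- (HW s Hs) at 1; fold k.
  set (t := frenet_t g s); set (n := frenet_n g s); set (bb := frenet_b g s); unfold comb.
  transitivity (vscal (h s * N s) n).
  - unfold h; replace ((1 + - (2 * k s)) * / N s * N s) with (1 - 2 * k s) by (field; auto); vec_ring.
  - transitivity (vadd (vadd (vscal (2 * (h s * y s)) (vadd (vadd (vscal (x s) t) (vscal (y s) n)) (vscal (z s) bb)))
      (vscal (- (h s * (y s * (x s + z s)))) (vadd t bb)))
      (vscal (sg * sg * (h s * (z s + - x s)))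
         (vadd (vadd (vscal (y s) t) (vscal (z s - x s) n)) (vscal (- y s) bb)))).
    + rewrite Hsg; unfold N; vec_ring.
    + vec_ring. }
apply (quad_ext a b (fun s => (x s + - z s) * / N s * inner W f
  + (y s * y s + - ((x s + - z s) * z s)) * / N s * inner (T s) f
  + sg * (y s * / N s) * - inner (T s) (cross W f))).
2:{ auto 20 using quad_plus, quad_mult, quad_opp, quad_const. }
intros s Hs; rewrite <- inner_cross_skew; specialize (HN s Hs).
rewrite <- !inner_vscal_l, <- !inner_vadd_l; f_equal.
unfold T; rewrite cross_vadd_r, constant_cross_t, constant_cross_b by auto.
pose proof sg_sqr as Hsg.
rewrite <- (HW s Hs) at 1.
set (t := frenet_t g s); set (n := frenet_n g s); set (bb := frenet_b g s); unfold comb.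
transitivity (vadd (vadd
  (vscal ((x s + - z s) * / N s) (vadd (vadd (vscal (x s) t) (vscal (y s) n)) (vscal (z s) bb)))
  (vscal ((y s * y s + - ((x s + - z s) * z s)) * / N s) (vadd t bb)))
  (vscal (sg * sg * (y s * / N s)) (vadd (vadd (vscal (y s) t) (vscal (z s - x s) n)) (vscal (- y s) bb)))).
- vec_ring.
- rewrite Hsg; transitivity (vscal (/ N s * N s) t); [unfold N at 5; vec_ring|].
  rewrite Rinv_l by auto; vec_ring.
Qed.

Lemma quad_tangent : forall f, quad a b (fun s => inner (frenet_t g s) f).
Proof.
destruct (Rlt_dec (normsq W) 0);
  [now apply quad_tangent_timelike | apply quad_tangent_not_timelike; lra].
Qed.

End FrameIntegration.

Lemma vec_eq_dec (x y : vec) : {x = y} + {x <> y}.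
Proof. repeat decide equality; apply Req_dec_T. Qed.

Section WaveQuadrature.

Context (a b : Rbar) (g : R -> vec) (lam o : R) (Ho : ooint a b o)
  (Hg : natural_null (ooint a b) g)
  (Hw : forall s, ooint a b s -> wave lam g s = 0).

Let J := ooint a b.
Let HJ : open1 J := open1_ooint a b.
Let k := curvature_nat g.

Lemma wave_first_integral : exists c1, forall s, J s ->
  Derive_n k 2 s = c1 + lam * k s - 3 * (k s * k s).
Proof.
set (f := fun s => Derive_n k 2 s - lam * k s + 3 * (k s * k s)).
exists (f o); intros s Hs.
assert (E : f s = f o).
{ apply (is_derive_zero_const a b f); auto; intros u Hu.
  pose proof (is_derive_curvature J g HJ Hg 0 u Hu) as K0.
  pose proof (is_derive_curvature J g HJ Hg 2 u Hu) as K2.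
  rewrite <- (Hw u Hu); unfold f.
  eapply is_derive_eq; [|apply is_derive_Rplus; [apply is_derive_Rminus;
    [exact K2 | apply is_derive_scal; exact K0]
    |apply is_derive_scal, is_derive_Rmult; exact K0]].
  unfold wave; fold k; change (Derive_n k 1 u) with (Derive k u);
    change (Derive_n k 0 u) with (k u); ring. }
unfold f in E at 1; lra.
Qed.

Lemma quad_curvature : quad a b k /\ quad a b (Derive k).
Proof.
destruct wave_first_integral as [c1 Hc1].
apply (profile_quad a b k (Derive k) lam c1 o Ho).
- intros s Hs; exact (is_derive_curvature J g HJ Hg 0 s Hs).
- intros s Hs; rewrite <- Hc1 by auto; exact (is_derive_curvature J g HJ Hg 1 s Hs).
Qed.

Lemma inner_comb_t (s p q r : R) : J s ->
  inner (comb (frenet_t g s) (frenet_n g s) (frenet_b g s) p q r) (frenet_t g s) = - r.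
Proof.
intros Hs; replace (frenet_t g s) with
  (comb (frenet_t g s) (frenet_n g s) (frenet_b g s) 1 0 0) at 2 by (unfold comb; vec_ring).
rewrite (inner_comb J g HJ Hg) by auto; ring.
Qed.

(** The momentum serves unless it vanishes. In that case the curvature is the
    constant [lam / 2], and [lam t + b], the axis of the helix, is constant. *)
Lemma constant_vector : exists (W : vec) (x y z : R -> R),
  quad a b x /\ quad a b y /\ quad a b z /\ W <> vzero /\
  forall s, J s -> comb (frenet_t g s) (frenet_n g s) (frenet_b g s) (x s) (y s) (z s) = W.
Proof.
destruct wave_first_integral as [c1 Hc1]; destruct quad_curvature as [Qk Qk1].
assert (Hm : forall s, J s -> momentum lam g s = momentum lam g o).
{ intros s Hs; apply (is_dvec_zero_const a b (momentum lam g)); auto; intros u Hu.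
  eapply is_dvec_eq; [|apply (is_dvec_momentum J); auto].
  rewrite Hw by auto; vec_ring. }
destruct (vec_eq_dec (momentum lam g o) vzero) as [H0|H0].
- assert (Hk : forall s, J s -> k s = lam / 2).
  { intros s Hs; specialize (Hm s Hs); rewrite H0 in Hm.
    assert (E : inner (momentum lam g s) (frenet_t g s) = 0) by (rewrite Hm; vec_ring).
    unfold momentum in E; rewrite (inner_comb_t s) in E by auto; fold k in E; lra. }
  set (X := fun s => comb (frenet_t g s) (frenet_n g s) (frenet_b g s) lam 0 1).
  exists (X o), (fun _ => lam), (fun _ => 0), (fun _ => 1).
  split; [|split; [|split; [|split]]]; auto using quad_const.
  + intros E; assert (E2 : inner (X o) (frenet_t g o) = 0) by (rewrite E; vec_ring).
    unfold X in E2; rewrite (inner_comb_t o) in E2 by auto; lra.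
  + intros s Hs; apply (is_dvec_zero_const a b X); auto; intros u Hu.
    eapply is_dvec_eq; [|apply (is_dvec_comb J g HJ Hg (fun _ => lam) (fun _ => 0) (fun _ => 1));
      auto; apply @is_derive_const].
    change (@zero R_NormedModule) with 0; fold k; rewrite (Hk u Hu); unfold comb; apply vec_eq; vec_expand; field.
- exists (momentum lam g o), (fun s => c1 + - (k s * k s)), (fun s => - Derive k s),
    (fun s => k s + - (lam / 2)).
  split; [|split; [|split; [|split]]]; auto 10 using quad_const, quad_plus, quad_mult, quad_opp.
  intros s Hs; rewrite <- (Hm s Hs); unfold momentum; fold k; rewrite (Hc1 s Hs).
  unfold comb; vec_ring.
Qed.

(** The rigid motion can be taken to be the identity: expressing the curve in
    a basis only requires constants, which are free. *)
Theorem wave_quadrature : integrable_by_quadrature a b g.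
Proof.
destruct constant_vector as (W & x & y & z & Qx & Qy & Qz & HW0 & HW).
pose proof (quad_tangent a b g o Ho Hg (proj1 quad_curvature) W x y z Qx Qy Qz HW HW0) as Qt.
assert (Qg : forall f, quad a b (fun s => inner (g s) f)).
{ intros f; apply (quad_primitive a b _ _ (Qt f)); intros s Hs.
  eapply is_derive_eq; [|apply is_derive_inner; [apply (is_dvec_n J g 0 s); auto; apply Hg | apply is_dvec_const]].
  rewrite inner_zero_r; unfold frenet_t; ring. }
assert (Hlin : forall v, lin e1 e2 e3 v = v).
{ intros [[v1 v2] v3]; unfold lin; apply vec_eq; vec_expand;
    unfold e1, e2, e3, pr1, pr2, pr3; simpl; ring. }
exists (fun v => v); split; [|split; [|split]].
- exists e1, e2, e3, vzero; split; [|split; [|split]].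
  + intros v; rewrite Hlin; vec_ring.
  + intros u v; now rewrite !Hlin.
  + unfold det3, wedge, e1, e2, e3, pr1, pr2, pr3; simpl; ring.
  + intros v Hv; now rewrite Hlin.
- apply (quad_ext a b (fun s => - inner (g s) e3)); [|auto using quad_opp].
  intros s _; unfold inner, e3, pr1, pr2, pr3; simpl; ring.
- apply (quad_ext a b (fun s => inner (g s) e2)); [|auto].
  intros s _; unfold inner, e2, pr1, pr2, pr3; simpl; ring.
- apply (quad_ext a b (fun s => - inner (g s) e1)); [|auto using quad_opp].
  intros s _; unfold inner, e1, pr1, pr2, pr3; simpl; ring.
Qed.

End WaveQuadrature.

Theorem theorem3 (lam : R) (a b : Rbar) (Hab : Rbar_lt a b) (gamma : R -> vec)
    (Hnull : null_curve (ooint a b) gamma)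
    (Hflex : flex_free (ooint a b) gamma)
    (Hnat : natural_parameter (ooint a b) gamma) :
  (congruence_curve lam (ooint a b) gamma <->
   critical_point lam (ooint a b) gamma) /\
  (congruence_curve lam (ooint a b) gamma ->
   integrable_by_quadrature a b gamma).
Proof.
assert (Hg : natural_null (ooint a b) gamma) by (split; [|split]; assumption).
pose proof (open1_ooint a b) as HJ.
assert (Hwave : congruence_curve lam (ooint a b) gamma <->
  forall s, ooint a b s -> wave lam gamma s = 0).
{ split; [now apply congruence_wave | intros Hw; now apply wave_congruence]. }
split.
- rewrite Hwave; symmetry; now apply critical_iff_wave.
- intros Hc; destruct (ooint_inhabited a b Hab) as [o Ho].
  apply (wave_quadrature a b gamma lam o Ho Hg); now apply Hwave.
Qed.
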